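(* As $n \to \infty$, $$\bar{p}_{\geq 2}(n) \sim \frac{\pi}{32}\, n^{-3/2}\, e^{\pi\sqrt{n}}.$$
   Context: An overpartition of a non-negative integer $n$ is a partition of $n$ (a finite non-increasing sequence of positive integers with sum $n$) in which the first occurrence of each distinct part may or may not be overlined. Let $\bar p_{\geq 2}(n)$ be the number of overpartitions of $n$ all of whose parts are at least $2$. The notation $a(n)\sim b(n)$ means $a(n)/b(n)\to 1$. *)

(* Defs.v *)
From HB Require Import structures.
From mathcomp Require Import all_boot all_order all_algebra finmap.
From mathcomp Require Import all_classical all_reals all_analysis.

Set Implicit Arguments.
Unset Strict Implicit.
Unset Printing Implicit Defensive.

(* A pair (a, o) in s is a part a, overlined when o = true.  As [index] returns
   the first occurrence, the last clause allows an overline only on the first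
   occurrence of each distinct part. *)
Definition is_overpartition (n : nat) (s : seq (nat * bool)) : Prop :=
  [/\ sorted geq (unzip1 s),
      forall a, a \in unzip1 s -> 0 < a,
      sumn (unzip1 s) = n &
      forall i, i < size s -> nth false (unzip2 s) i ->
        index (nth 0 (unzip1 s) i) (unzip1 s) = i].

Definition overpartitions_ge (m n : nat) : set (seq (nat * bool)) :=
  [set s | is_overpartition n s /\ forall a, a \in unzip1 s -> m <= a]%classic.

(* [fset_set] of an infinite set is empty, so the count below relies on this. *)
Lemma finite_overpartitions_ge (m n : nat) :
  finite_set (overpartitions_ge m n).
Proof.
pose T := {k : 'I_n.+1 & k.-tuple ('I_n.+1 * bool)%type}.
pose f (x : T) : seq (nat * bool) :=
  [seq (nat_of_ord p.1, p.2) | p <- tval (tagged x)].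
apply: (@sub_finite_set _ _ (f @` setT)%classic); last first.
  exact/finite_image/finite_finset.
move=> s [[_ pos sum_s _] _].
have le_size : size s <= n.
  rewrite -sum_s; elim: s pos {sum_s} => [//|[a o] s IHs] /= pos.
  have a0 : 0 < a by apply: pos; rewrite mem_head.
  rewrite -add1n leq_add// IHs// => b bs.
  by apply: pos; rewrite in_cons bs orbT.
have le_part a : a \in unzip1 s -> a <= n.
  rewrite -sum_s; elim: (unzip1 s) => [//|b u IHu] /=.
  rewrite in_cons => /predU1P[->|/IHu]; first exact: leq_addr.
  by move=> /leq_trans; apply; exact: leq_addl.
pose k : 'I_n.+1 := inord (size s).
pose t := [seq (inord p.1 : 'I_n.+1, p.2) | p <- s].
have st : size t == k by rewrite size_map inordK.
exists (Tagged (fun k : 'I_n.+1 => k.-tuple ('I_n.+1 * bool)%type) (Tuple st)) => //.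
rewrite /f /= /t -map_comp -[RHS]map_id; apply/eq_in_map => -[a o] aos /=.
by rewrite inordK// ltnS le_part//; apply/mapP; exists (a, o).
Qed.

Definition overp_ge (m n : nat) : nat := #|` fset_set (overpartitions_ge m n)|%fset.

(* Main.v *)
(* Let G(z) = prod_(k >= 2) (1 + z^k) / (1 - z^k), and let L(t) be the logarithm
   of G(exp (- t)). Put S(t) = L(t) + log ((1 + q) / (1 - q)), q = exp (- t), so
   that S includes the factor k = 1. Then t S(t) --> pi^2 / 4, because the sum of
   1 / (2 j + 1)^2 is pi^2 / 8, and S(t) - 2 S(2 t) = log (pi / t) / 2 + o(1),
   because twice the left-hand side is log ((1 + q) / (1 - q)) plus a series of
   second differences that tends termwise to the logarithm of the Wallis product.
   Iterating this relation yields S(t) = pi^2 / (4 t) + log (t / (4 pi)) / 2 + o(1)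
   without any modular transformation.
   The n-th coefficient of G is a Fourier integral on the circle of radius
   exp (- t), t = pi / (2 sqrt n). Near the real axis log |G| and arg G are
   compared with (L(t - s) + L(t + s)) / 2 - L(t) and (L(t - s) - L(t + s)) / 2,
   so no asymptotics of derivatives of L is needed; after scaling the integrand
   tends to exp (- u^2). It is dominated because log |G| drops by at least
   2 sum_(k >= 2) q^k (1 - cos (k theta)). G is truncated to finitely many
   factors, their number depending on n, so that only finite products are used. *)

Require Import Defs.
From HB Require Import structures.
From mathcomp Require Import all_boot all_order all_algebra.
From mathcomp Require Import all_classical all_reals all_analysis.
From mathcomp Require Import finmap measurable_realfun zify ring lra.

Import Order.TTheory GRing.Theory Num.Theory.
Import numFieldNormedType.Exports.

Local Open Scope classical_set_scope.
Local Open Scope ring_scope.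

Set Implicit Arguments.
Unset Strict Implicit.
Unset Printing Implicit Defensive.

(** * Overpartitions as chains *)

(** The comparison on the real axis succeeds because its step is large. With d = [dev_ratio t] and
    step t d, the second difference of pi^2 / (4 t) is already 1 / (1 - d^2), so an error o(1) in L
    never has to be divided by a small quantity. Since d^2 is a multiple of t, the Taylor
    remainders, of order d^3 / t and d^4 / t, vanish. Complex values are encoded by a free phase:
    cos (n theta + psi) for every psi carries real and imaginary part, and multiplication by exp (i
    m theta) shifts psi. The coefficients being real, half of the circle suffices, and the limit is
    half a Gaussian integral, sqrt pi / 2. Origin of pi / 32: at t = pi / (2 sqrt n), exp (L(t) + n
    t) is asymptotic to t^(3/2) / (4 sqrt pi) exp (pi sqrt n), one power of t being due to the
    missing factor k = 1. Scaling the angle contributes (2 / pi^2) t^(3/2), the integral sqrt pi /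
    2, and the product t^3 / (4 pi^2) equals pi / (32 n^(3/2)). *)

Section Counting.
Local Open Scope nat_scope.

(* Ordering the pairs by [overpart_code], an overpartition is a list in which
   every entry is at most twice the part of the preceding one: a part may be
   repeated only without overline. *)
Definition overpart_code (p : nat * bool) : nat := p.1.*2 + p.2.

Definition overpart_next : rel (nat * bool) := fun p q => overpart_code q <= p.1.*2.

(** Parts at least 2 have codes at least 4, so only the empty list lies below 4. Raising c by one
    admits a single new pair, a plain part when c is even and an overlined one when c is odd. *)
Definition overpartitions_below (c n : nat) : set (seq (nat * bool)) :=
  [set s | [/\ sorted overpart_next s,
    all (fun p => (1 < p.1) && (overpart_code p < c)) s & sumn (unzip1 s) = n]]%classic.

Lemma overpart_next_trans : transitive overpart_next.
Proof. by move=> y x z; rewrite /overpart_next /overpart_code; lia. Qed.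

Lemma overpart_nextE p q : overpart_next p q = (q.1 <= p.1) && (q.2 ==> (q.1 != p.1)).
Proof. by rewrite /overpart_next /overpart_code; case: q => a [] /=; lia. Qed.

(** [overpart_next] is transitive, so sortedness compares every pair of entries: an overlined entry
    differs from all entries before it, which is what the clause with [index] says. *)
Lemma sorted_overpart_nextP (s : seq (nat * bool)) :
  sorted overpart_next s <-> sorted geq (unzip1 s) /\
  forall i, i < size s -> nth false (unzip2 s) i ->
    index (nth 0 (unzip1 s) i) (unzip1 s) = i.
Proof.
have tr : transitive geq by move=> y x z /= h1 h2; exact: leq_trans h2 h1.
elim: s => [|p s ih] //=.
rewrite (path_sortedE overpart_next_trans) (path_sortedE tr).
have -> : all (overpart_next p) s =
    all (geq p.1) (unzip1 s) && all (fun q => q.2 ==> (q.1 != p.1)) s.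
  by rewrite all_map -all_predI; apply: eq_all => q /=; rewrite overpart_nextE.
split.
  move=> /andP[/andP[h1 /allP h2] /ih[h3 h4]]; rewrite h1 h3; split=> //.
  move=> [|i] /=; first by rewrite eqxx.
  rewrite ltnS => si oi.
  have e1 : nth 0 (unzip1 s) i = (nth (0, false) s i).1 by rewrite (nth_map (0, false)).
  have e2 : nth false (unzip2 s) i = (nth (0, false) s i).2 by rewrite (nth_map (0, false)).
  have := h2 _ (mem_nth (0, false) si); rewrite -e1 -e2 oi /= eq_sym => /negbTE->.
  by rewrite h4.
move=> [/andP[h1 h3] h4]; rewrite h1 /=; apply/andP; split.
  apply/allP => q /(nthP (0, false))[i si <-]; apply/implyP => oi.
  have e1 : nth 0 (unzip1 s) i = (nth (0, false) s i).1 by rewrite (nth_map (0, false)).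
  have e2 : nth false (unzip2 s) i = (nth (0, false) s i).2 by rewrite (nth_map (0, false)).
  have := h4 i.+1; rewrite /= ltnS e1 e2 => /(_ si oi).
  by rewrite eq_sym; case: eqP.
apply/ih; split=> // i si oi; have := h4 i.+1; rewrite /= ltnS => /(_ si oi).
by case: eqP => // _ [].
Qed.

Lemma overpartitions_below_sub c n :
  (overpartitions_below c n `<=` overpartitions_ge 2 n)%classic.
Proof.
move=> s [/sorted_overpart_nextP[h1 h2] /allP h3 h4].
have g a : a \in unzip1 s -> 1 < a by move=> /mapP[p /h3/andP[p1 _] ->].
by split=> //; split=> // a /g; exact: ltnW.
Qed.

Lemma finite_overpartitions_below c n : finite_set (overpartitions_below c n).
Proof.
exact: sub_finite_set (@overpartitions_below_sub c n) (finite_overpartitions_ge 2 n).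
Qed.

Lemma leq_sumn a (s : seq nat) : a \in s -> a <= sumn s.
Proof.
elim: s => [//|b s ih]; rewrite in_cons => /orP[/eqP<-|/ih h] /=; first exact: leq_addr.
exact: leq_trans h (leq_addl _ _).
Qed.

Lemma overpartitions_belowE c n : n.*2.+1 < c ->
  overpartitions_below c n = overpartitions_ge 2 n.
Proof.
move=> nc; apply/seteqP; split; first exact: overpartitions_below_sub.
move=> s [[h1 h2 h3 h4] h5]; split=> //; first exact/sorted_overpart_nextP.
apply/allP => p ps; have p1 : p.1 \in unzip1 s by exact: map_f.
rewrite h5//=; have := leq_sumn p1; rewrite h3 /overpart_code.
by case: (p.2) => /=; lia.
Qed.

Definition overp_below (c n : nat) : nat :=
  #|` fset_set (overpartitions_below c n)|%fset.

Lemma overpartitions_below4 n : overpartitions_below 4 n = if n == 0 then [set [::]]%classic else set0.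
Proof.
apply/seteqP; split => s.
  move=> [_ h <-]; case: s h => [|p s] //=; rewrite /overpart_code; lia.
by case: eqP => [->|] //= ->.
Qed.

(** Codes never increase along a chain, so a list containing the code c starts with it. The
    remaining codes are at most twice the part of this head: c may occur again when it is even, and
    may not when it is odd. *)
Lemma overpartitions_belowS c n : 3 < c ->
  overpartitions_below c.+1 n = (overpartitions_below c n `|`
    if c./2 <= n then cons (c./2, odd c) @` overpartitions_below (c./2).*2.+1 (n - c./2)
    else set0)%classic.
Proof.
move=> c3; have ec : overpart_code (c./2, odd c) = c.
  by rewrite /overpart_code /= addnC odd_double_half.
have c2 : 1 < c./2 by lia.
apply/seteqP; split => s.
  move=> [h1 h2 h3]; case: s h1 h2 h3 => [|p s]; first by move=> _ _ <-; left.
  rewrite [sorted _ _]/= (path_sortedE overpart_next_trans).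
  move=> /andP[h1 h2] /= /andP[/andP[p1 pc] h3] h4.
  have [pc'|cp] := ltnP (overpart_code p) c.
    left; split => //=; first by rewrite (path_sortedE overpart_next_trans) h1.
    rewrite p1 pc' /=; apply/allP => q qs.
    have := allP h1 _ qs; have /andP[-> _] := allP h3 _ qs.
    move: pc'; rewrite /overpart_next /overpart_code; lia.
  have e : overpart_code p = c by apply/eqP; rewrite eqn_leq cp andbT -ltnS.
  have ep : p = (c./2, odd c).
    move: e; rewrite /overpart_code; case: (p) => a o /= <-.
    by congr pair; case: o => /=; lia.
  right; rewrite -h4 ep leq_addr addKn; exists s => //; split=> //.
  apply/allP => q qs; have := allP h1 _ qs; have /andP[-> _] := allP h3 _ qs.
  by rewrite ep /overpart_next ltnS.
move=> [[h1 h2 h3]|].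
  split=> //; apply: sub_all h2 => p /andP[-> h]; exact: ltnW.
case: ifP => // cn [s' [h1 h2 h3] <-]; split => /=.
- rewrite (path_sortedE overpart_next_trans) h1 andbT.
  by apply: sub_all h2 => p /andP[_]; rewrite ltnS.
- rewrite c2 ec ltnSn /=; apply: sub_all h2 => p /andP[-> h] /=.
  by apply: leq_trans h _; rewrite -{2}(odd_double_half c); lia.
- by rewrite h3 subnKC.
Qed.

Lemma overp_below4 n : overp_below 4 n = (n == 0).
Proof.
rewrite /overp_below overpartitions_below4; case: eqP => _.
  by rewrite fset_set1 cardfs1.
by rewrite fset_set0 cardfs0.
Qed.

Lemma overp_belowS c n : 3 < c -> overp_below c.+1 n = overp_below c n +
  if c./2 <= n then overp_below (c./2).*2.+1 (n - c./2) else 0.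
Proof.
move=> c3; rewrite /overp_below overpartitions_belowS//.
case: ifP => cn; last by rewrite setU0 addn0.
have fE := finite_overpartitions_below c n.
have fE' := finite_overpartitions_below (c./2).*2.+1 (n - c./2).
rewrite fset_setU//; last exact: finite_image.
rewrite cardfsU fset_set_image// card_imfset /=; last by move=> s s' [].
set I := (_ `&` _)%fset; have -> : I = fset0.
  apply/fsetP => s; rewrite !inE; apply/negP => /andP[].
  rewrite in_fset_set// => /set_mem[_ h _] /imfsetP[s' _ es].
  move: h; rewrite es /= /overpart_code /= addnC odd_double_half ltnn.
  by rewrite andbF.
by rewrite cardfs0 subn0.
Qed.

(** The bound 2 k + 4 admits the parts 2, ..., k + 1, hence k factors of the product. *)
Definition overp_upto (k n : nat) : nat := overp_below k.*2.+4 n.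

Lemma overp_upto0 n : overp_upto 0 n = (n == 0).
Proof. exact: overp_below4. Qed.

(* Coefficientwise form of (1 - x^(k+2)) A_(k+1) = (1 + x^(k+2)) A_k. *)
Lemma overp_uptoS k n : overp_upto k.+1 n = overp_upto k n +
  if k.+2 <= n then overp_upto k.+1 (n - k.+2) + overp_upto k (n - k.+2) else 0.
Proof.
(* The codes 2 k + 4 and 2 k + 5 of the part k + 2 enter separately: [e1] adds the overlined copy,
   usable once, and [e2] the plain copies, usable repeatedly. *)
have e1 m : overp_upto k.+1 m = overp_below k.*2.+4.+1 m +
    if k.+2 <= m then overp_below k.*2.+4.+1 (m - k.+2) else 0.
  rewrite /overp_upto doubleS overp_belowS// /= uphalf_double.
  by rewrite !doubleS.
have e2 m : overp_below k.*2.+4.+1 m = overp_upto k m +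
    if k.+2 <= m then overp_below k.*2.+4.+1 (m - k.+2) else 0.
  by rewrite /overp_upto overp_belowS// /= doubleK !doubleS.
rewrite e1 e2; case: ifP => kn; last by rewrite !addn0.
rewrite (e1 (n - k.+2)); have := e2 (n - k.+2); lia.
Qed.

Lemma overp_uptoE k n : n <= k -> overp_upto k n = overp_ge 2 n.
Proof.
move=> nk; rewrite /overp_upto /overp_below overpartitions_belowE//.
by lia.
Qed.

End Counting.

(** * Dominated convergence for series *)

Section Series.
Context {R : realType}.
Implicit Types (u v M l : R^nat).

Lemma cvg_series_dominated u M : (forall j, `|u j| <= M j) -> cvgn (series M) ->
  cvgn (series u).
Proof.
move=> uM cM; apply: normed_cvg.
apply: (series_le_cvg _ _ _ cM) => // n; first exact: normr_ge0.
exact: le_trans (uM n).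
Qed.

Lemma series_tail_le u M N : (forall j, `|u j| <= M j) -> cvgn (series M) ->
  `|limn (series u) - series u N| <= limn (series M) - series M N.
Proof.
move=> uM cM; have cu := cvg_series_dominated uM cM.
have h1 : (fun n => `|series u n - series u N|) @ \oo -->
    `|limn (series u) - series u N|.
  by apply: cvg_norm; apply: cvgB => //; exact: cvg_cst.
have h2 : (fun n => series M n - series M N) @ \oo -->
    limn (series M) - series M N.
  by apply: cvgB => //; exact: cvg_cst.
apply: (ler_cvg_to h1 h2); exists N => // n /= Nn.
by rewrite !sub_series Nn (le_trans (ler_norm_sum _ _ _))// ler_sum.
Qed.

Lemma norm_lim_series_le u M : (forall j, `|u j| <= M j) -> cvgn (series M) ->
  `|limn (series u)| <= limn (series M).
Proof.
move=> uM cM; have := series_tail_le 0 uM cM.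
by rewrite /series /= !big_geq// !subr0.
Qed.

(** Tannery's theorem along a filter: one tail of M bounds the tails of l and of every f x alike,
    and the finite sum that is left converges termwise. *)
Lemma tannery (T : Type) (F : set_system T) {FF : ProperFilter F}
    (f : T -> R^nat) l M :
  (forall j, f x j @[x --> F] --> l j) ->
  (\forall x \near F, forall j, `|f x j| <= M j) -> cvgn (series M) ->
  cvgn (series l) /\ limn (series (f x)) @[x --> F] --> limn (series l).
Proof.
move=> fl fM cM.
have lM j : `|l j| <= M j.
  have h : `|f x j| @[x --> F] --> `|l j| by apply: cvg_norm; exact: fl.
  by apply: (cvgr_to_le h); near=> x; apply: (near fM x).
split; first exact: cvg_series_dominated cM.
apply/cvgrPdist_le => e e0.
have e30 : 0 < e / 3 by rewrite divr_gt0.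
have [N hN] : exists N, limn (series M) - series M N <= e / 3.
  have /cvgrPdist_le/(_ _ e30)[N _ hN] := cM.
  by exists N; apply: le_trans (hN N _) => //=; exact: ler_norm.
have part : series (f x) N @[x --> F] --> series l N.
  rewrite /series /=; by apply: cvg_big => [|j _]; [exact: add_continuous|exact: fl].
near=> x.
have -> : limn (series l) - limn (series (f x)) =
   (limn (series l) - series l N) + (series l N - series (f x) N)
   - (limn (series (f x)) - series (f x) N) by ring.
apply: le_trans (ler_normB _ _) _.
have : `|limn (series (f x)) - series (f x) N| <= e / 3.
  apply: le_trans hN; apply: series_tail_le => //; near: x; exact: fM.
have : `|series l N - series (f x) N| <= e / 3.
  by near: x; move/cvgrPdist_le : part; exact.
have : `|limn (series l) - series l N| <= e / 3.
  by apply: le_trans hN; exact: series_tail_le.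
have := ler_normD (limn (series l) - series l N) (series l N - series (f x) N).
lra.
Unshelve. all: by end_near. Qed.

Lemma cvg_series_mull (k : R) u : cvgn (series u) -> cvgn (series (fun j => k * u j)).
Proof. exact: is_cvg_seriesZ. Qed.

Lemma lim_series_mull (k : R) u : cvgn (series u) ->
  limn (series (fun j => k * u j)) = k * limn (series u).
Proof. exact: lim_seriesZ. Qed.

Lemma cvg_series_add u v : cvgn (series u) -> cvgn (series v) ->
  cvgn (series (fun j => u j + v j)).
Proof. exact: is_cvg_seriesD. Qed.

Lemma lim_series_add u v : cvgn (series u) -> cvgn (series v) ->
  limn (series (fun j => u j + v j)) = limn (series u) + limn (series v).
Proof. exact: lim_seriesD. Qed.

Lemma cvg_expn (T : Type) (F : set_system T) {FF : Filter F} (f : T -> R) (a : R) (n : nat) :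
  f x @[x --> F] --> a -> f x ^+ n @[x --> F] --> a ^+ n.
Proof.
move=> fa; elim: n => [|n ih]; first by under eq_fun do rewrite expr0; exact: cvg_cst.
by rewrite exprS; under eq_fun do rewrite exprS; exact: cvgM.
Qed.

Lemma cvg_near_eq (T : Type) (F : set_system T) {FF : Filter F} (f g : T -> R) (a : R) :
  (\forall x \near F, f x = g x) -> f x @[x --> F] --> a -> g x @[x --> F] --> a.
Proof.
by move=> fg; apply: cvg_trans; apply: near_eq_cvg; apply: filterS fg => x.
Qed.

Lemma cvg_unique_real (T : Type) (F : set_system T) {FF : ProperFilter F}
    (f : T -> R) (a b : R) :
  f x @[x --> F] --> a -> f x @[x --> F] --> b -> a = b.
Proof. by move=> fa fb; rewrite -(cvg_lim (@Rhausdorff R) fa) (cvg_lim (@Rhausdorff R) fb). Qed.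

End Series.

(** * Taylor estimates *)

Section Derive.
Context {R : realType}.
Implicit Types (f g df : R -> R) (x y u : R).

Lemma is_derive_addf f g x a b : is_derive x 1 f a -> is_derive x 1 g b ->
  is_derive x 1 (fun z => f z + g z) (a + b).
Proof. by move=> hf hg; exact: is_deriveD. Qed.

Lemma is_derive_oppf f x a : is_derive x 1 f a ->
  is_derive x 1 (fun z => - f z) (- a).
Proof. by move=> hf; exact: is_deriveN. Qed.

Lemma is_derive_mulf f g x a b : is_derive x 1 f a -> is_derive x 1 g b ->
  is_derive x 1 (fun z => f z * g z) (a * g x + f x * b).
Proof.
move=> hf hg; have h := @is_deriveM _ _ f g x 1 a b hf hg.
by apply: is_derive_eq; rewrite /GRing.scale /= addrC mulrC.
Qed.

Lemma is_derive_compf f g x a b : is_derive (g x) 1 f a -> is_derive x 1 g b ->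
  is_derive x 1 (fun z => f (g z)) (a * b).
Proof. by move=> hf hg; exact: is_derive1_comp. Qed.

Lemma is_derive_expf f n x a : is_derive x 1 f a ->
  is_derive x 1 (fun z => f z ^+ n) (n%:R * f x ^+ n.-1 * a).
Proof.
move=> hf; have -> : (fun z => f z ^+ n) = f ^+ n.
  by apply/funext => z; rewrite exprfctE.
exact: is_deriveX.
Qed.

Lemma is_derive_invf f x a : f x != 0 -> is_derive x 1 f a ->
  is_derive x 1 (fun z => (f z)^-1) (- a / f x ^+ 2).
Proof.
move=> f0 hf; have h := is_deriveV f0 hf.
apply: is_derive_eq; rewrite /GRing.scale /=. by field; rewrite f0.
Qed.

(** Integrates an inequality from 0. The bounds on the trigonometric and hyperbolic functions come
    from differentiating until the sign is evident. *)
Lemma ge0_of_is_derive f df : (forall x, is_derive x 1 f (df x)) ->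
  (forall x, 0 <= x -> 0 <= df x) -> 0 <= f 0 -> forall x, 0 <= x -> 0 <= f x.
Proof.
move=> hf df0 f0 x x0.
have [|c] := @MVT_segment R f df 0 x x0 (fun y _ => hf y).
  by apply: derivable_within_continuous => y _; have [] := hf y.
rewrite subr0 in_itv /= => /andP[c0 _] e.
by rewrite -(subrK (f 0) (f x)) e addr_ge0// mulr_ge0// df0.
Qed.

End Derive.

(** The derivative is synthesised as a metavariable, so that [derive_by] leaves only an equation
    between two expressions of it. *)
Ltac derive_rules := repeat first
  [ eapply is_derive_addf | eapply is_derive_oppf
  | eapply is_derive_expf
  | eapply is_derive_cst | eapply is_derive_id | eapply is_derive_mulf
  | eapply is_derive_sin | eapply is_derive_cos | eapply is_derive_expR
  | (eapply is_derive_invf)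
  | (eapply (@is_derive_compf _ (@ln _)); [eapply is_derive1_ln|])
  | (eapply (@is_derive_compf _ (@atan _)); [eapply is_derive1_atan|])
  | (eapply (@is_derive_compf _ sin); [eapply is_derive_sin|])
  | (eapply (@is_derive_compf _ cos); [eapply is_derive_cos|])
  | (eapply (@is_derive_compf _ expR); [eapply is_derive_expR|])].

Tactic Notation "derive_by" tactic(t) :=
  (notypeclasses refine (is_derive_eq _ _)); [derive_rules | rewrite /=; t].

Section Taylor.
Context {R : realType}.
Implicit Types (x y u : R).

Lemma sin_le_id x : 0 <= x -> sin x <= x.
Proof.
have d y : is_derive y 1 (fun x : R => x - sin x) (1 - cos y).
  by derive_by ring.
move=> x0; rewrite -subr_ge0; apply: (ge0_of_is_derive d _ _ x0).
- by move=> y _; rewrite subr_ge0 cos_le1.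
- by rewrite sin0 subr0.
Qed.

Lemma cos_ge_quadratic x : 0 <= x -> 1 - x ^+ 2 / 2 <= cos x.
Proof.
have d y : is_derive y 1 (fun x : R => cos x - (1 - x ^+ 2 / 2)) (y - sin y).
  by derive_by field.
move=> x0; rewrite -subr_ge0; apply: (ge0_of_is_derive d _ _ x0).
- by move=> y y0; rewrite subr_ge0 sin_le_id.
- by rewrite cos0; lra.
Qed.

Lemma sin_ge_cubic x : 0 <= x -> x - x ^+ 3 / 6 <= sin x.
Proof.
have d y : is_derive y 1 (fun x : R => sin x - (x - x ^+ 3 / 6))
  (cos y - (1 - y ^+ 2 / 2)) by derive_by field.
move=> x0; rewrite -subr_ge0; apply: (ge0_of_is_derive d _ _ x0).
- by move=> y y0; rewrite subr_ge0 cos_ge_quadratic.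
- by rewrite sin0; lra.
Qed.

Lemma cos_le_quartic x : 0 <= x -> cos x <= 1 - x ^+ 2 / 2 + x ^+ 4 / 24.
Proof.
have d y : is_derive y 1 (fun x : R => 1 - x ^+ 2 / 2 + x ^+ 4 / 24 - cos x)
  (sin y - (y - y ^+ 3 / 6)) by derive_by field.
move=> x0; rewrite -subr_ge0; apply: (ge0_of_is_derive d _ _ x0).
- by move=> y y0; rewrite subr_ge0 sin_ge_cubic.
- by rewrite cos0; lra.
Qed.

Lemma sinh_ge x : 0 <= x -> 0 <= expR x - expR (- x) - 2 * x.
Proof.
have d y : is_derive y 1 (fun x : R => expR x - expR (- x) - 2 * x)
  (expR y + expR (- y) - 2) by derive_by ring.
move=> x0; apply: (ge0_of_is_derive d _ _ x0) => [y y0|].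
- have e0 := expR_gt0 y; have -> : expR (- y) = (expR y)^-1 by rewrite expRN.
  have -> : expR y + (expR y)^-1 - 2 = (expR y - 1) ^+ 2 / expR y.
    by field; rewrite gt_eqF.
  by rewrite divr_ge0 ?sqr_ge0// ltW.
- by rewrite oppr0 expR0; lra.
Qed.

Lemma cosh_ge x : 0 <= x -> 0 <= expR x + expR (- x) - 2 - x ^+ 2.
Proof.
have d y : is_derive y 1 (fun x : R => expR x + expR (- x) - 2 - x ^+ 2)
  (expR y - expR (- y) - 2 * y) by derive_by ring.
move=> x0; apply: (ge0_of_is_derive d _ _ x0) => [y y0|]; first exact: sinh_ge.
by rewrite oppr0 expR0; lra.
Qed.

Lemma sinh_le_cubic x : 0 <= x ->
  expR x - expR (- x) <= 2 * x + 2 * (x ^+ 3 * expR x).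
Proof.
have d1 y : is_derive y 1
  (fun x : R => 2 * x + 2 * (x ^+ 3 * expR x) - (expR x - expR (- x)))
  (2 * (y ^+ 3 + 3 * y ^+ 2) * expR y - expR y - expR (- y) + 2).
  by derive_by ring.
have d2 y : is_derive y 1
  (fun x : R => 2 * (x ^+ 3 + 3 * x ^+ 2) * expR x - expR x - expR (- x) + 2)
  (2 * (y ^+ 3 + 6 * y ^+ 2 + 6 * y) * expR y - expR y + expR (- y)).
  by derive_by ring.
have d3 y : is_derive y 1
  (fun x : R => 2 * (x ^+ 3 + 6 * x ^+ 2 + 6 * x) * expR x - expR x + expR (- x))
  (2 * (y ^+ 3 + 9 * y ^+ 2 + 18 * y + 6) * expR y - expR y - expR (- y)).
  by derive_by ring.
move=> x0; rewrite -subr_ge0; apply: (ge0_of_is_derive d1 _ _ x0); last first.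
  by rewrite oppr0 expR0; lra.
apply: (ge0_of_is_derive d2); last by rewrite oppr0 expR0; lra.
apply: (ge0_of_is_derive d3) => [y y0|]; last by rewrite oppr0 expR0; lra.
have e1 : 1 <= expR y by rewrite -expR0 ler_expR.
have e2 : expR (- y) <= 1 by rewrite -expR0 ler_expR oppr_le0.
have : 0 <= (y ^+ 3 + 9 * y ^+ 2 + 18 * y) * expR y.
  by rewrite mulr_ge0 ?expR_ge0// ?addr_ge0// ?mulr_ge0// exprn_ge0.
nra.
Qed.

Lemma cosh_le_quartic x : 0 <= x ->
  expR x + expR (- x) <= 2 + x ^+ 2 + 2 * (x ^+ 4 * expR x).
Proof.
have d y : is_derive y 1
  (fun x : R => 2 + x ^+ 2 + 2 * (x ^+ 4 * expR x) - (expR x + expR (- x)))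
  ((2 * y + 2 * (y ^+ 3 * expR y) - (expR y - expR (- y))) +
    2 * (y ^+ 4 + 3 * y ^+ 3) * expR y) by derive_by ring.
move=> x0; rewrite -subr_ge0; apply: (ge0_of_is_derive d _ _ x0) => [y y0|].
- rewrite addr_ge0 ?subr_ge0 ?sinh_le_cubic//.
  by rewrite mulr_ge0 ?expR_ge0// mulr_ge0// addr_ge0 ?mulr_ge0 ?exprn_ge0.
- by rewrite oppr0 expR0; lra.
Qed.

(** With y = N s, the bracket multiplied by u^2 is what the values at t - s and t + s produce. Both
    cos (u y) - 1 and minus u^2 times the bracket equal - u^2 y^2 / 2 up to fourth order, so the
    quadratic terms cancel. *)
Lemma cos_cosh_taylor u y : 0 <= u -> 0 <= y ->
  `|cos (u * y) - 1 + u ^+ 2 * ((expR y + expR (- y)) / 2 - 1)|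
   <= (u ^+ 4 + u ^+ 2) * (y ^+ 4 * expR y).
Proof.
move=> u0 y0; have uy0 : 0 <= u * y by rewrite mulr_ge0.
have c1 := cos_ge_quadratic uy0; have c2 := cos_le_quartic uy0.
have h1 := cosh_ge y0; have h2 := cosh_le_quartic y0.
rewrite exprMn in c1; rewrite !exprMn in c2.
have e1 : 1 <= expR y by rewrite -expR0 ler_expR.
have u4 : 0 <= u ^+ 4 * y ^+ 4 by rewrite mulr_ge0// exprn_ge0.
have u2 : 0 <= u ^+ 2 by rewrite exprn_ge0.
have k1 : 0 <= u ^+ 2 * (expR y + expR (- y) - 2 - y ^+ 2) by rewrite mulr_ge0.
have k2 : 0 <= u ^+ 2 * (2 + y ^+ 2 + 2 * (y ^+ 4 * expR y) - (expR y + expR (- y))).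
  by rewrite mulr_ge0// subr_ge0.
have k3 : u ^+ 4 * y ^+ 4 <= u ^+ 4 * y ^+ 4 * expR y by rewrite ler_peMr.
rewrite ler_norml; apply/andP; split; nra.
Qed.

Lemma sin_sinh_taylor u y : 0 <= u -> 0 <= y ->
  `|sin (u * y) - u * ((expR y - expR (- y)) / 2)|
   <= (u ^+ 3 + u) * (y ^+ 3 * expR y).
Proof.
move=> u0 y0; have uy0 : 0 <= u * y by rewrite mulr_ge0.
have c1 := sin_ge_cubic uy0; have c2 := sin_le_id uy0.
rewrite exprMn in c1.
have h1 := sinh_ge y0; have h2 := sinh_le_cubic y0.
have e1 : 1 <= expR y by rewrite -expR0 ler_expR.
have u4 : 0 <= u ^+ 3 * y ^+ 3 by rewrite mulr_ge0// exprn_ge0.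
have k1 : 0 <= u * (expR y - expR (- y) - 2 * y) by rewrite mulr_ge0.
have k2 : 0 <= u * (2 * y + 2 * (y ^+ 3 * expR y) - (expR y - expR (- y))).
  by rewrite mulr_ge0// subr_ge0.
have k3 : u ^+ 3 * y ^+ 3 <= u ^+ 3 * y ^+ 3 * expR y by rewrite ler_peMr.
rewrite ler_norml; apply/andP; split; nra.
Qed.

(** Jordan's inequality, by concavity: were the sine below the chord at x, the mean value theorem on
    both sides of x would give c < d with cos c < 2 / pi < cos d. *)
Lemma sin_ge_chord x : 0 <= x <= pi / 2 -> 2 / pi * x <= sin x.
Proof.
move=> /andP[]; rewrite le_eqVlt => /orP[/eqP<- _|x0]; first by rewrite sin0 mulr0.
have p0 := @pi_gt0 R.
rewrite le_eqVlt => /orP[/eqP->|xp].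
  by rewrite sin_pihalf; have -> : 2 / pi * (pi / 2) = 1 :> R by rewrite mulrA divfK ?divff ?gt_eqF.
pose f (y : R) := sin y - 2 / pi * y.
have df y : is_derive y 1 f (cos y - 2 / pi).
  by rewrite /f; derive_by ring.
have fc (a b : R) : {within `[a, b], continuous f}.
  by apply: derivable_within_continuous => y _; have [] := df y.
rewrite leNgt; apply/negP => sx.
have [c] := MVT x0 (fun y _ => df y) (@fc _ _).
rewrite in_itv /= => /andP[c0 cx]; rewrite {2}/f sin0 mulr0 !subr0 => ec.
have [d] := MVT xp (fun y _ => df y) (@fc _ _).
rewrite in_itv /= => /andP[dx dp].
rewrite {1}/f sin_pihalf.
have -> : 2 / pi * (pi / 2) = 1 :> R by rewrite mulrA divfK ?divff ?gt_eqF.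
rewrite subrr sub0r => ed.
have cl : cos c - 2 / pi < 0 by rewrite -(pmulr_llt0 _ x0) -ec /f subr_lt0.
have dl : 0 < cos d - 2 / pi.
  have xp' : 0 < pi / 2 - x by rewrite subr_gt0.
  by rewrite -(pmulr_lgt0 _ xp') -ed oppr_gt0 /f subr_lt0.
have : cos d < cos c.
  rewrite ltr_cos ?in_itv /=; lra.
lra.
Qed.

End Taylor.

(** * The sum of 1 / (2 j + 1) ^ 2 and the Wallis product *)

Section TrigSums.
Context {R : realType}.

Lemma natr_doubleS (n : nat) : (n.*2.+1)%:R = 2 * n%:R + 1 :> R.
Proof. by rewrite -natr1 -mul2n natrM. Qed.

Lemma natr_doubleS3 (n : nat) : (n.*2.+3)%:R = 2 * n%:R + 3 :> R.
Proof. by rewrite -doubleS natr_doubleS -natr1; ring. Qed.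

Lemma cvg_series_finite_support (u : R^nat) N : (forall j, (N <= j)%N -> u j = 0) ->
  series u @ \oo --> series u N.
Proof.
move=> u0; apply: cvg_near_cst; exists N => // n /= Nn.
apply/eqP; rewrite -subr_eq0 sub_series Nn big_nat_cond big1// => i.
by rewrite andbT => /andP[/u0].
Qed.

Lemma sum_inv_odd_pairs (n : nat) :
  series (fun j => ((j.*2.+1 * j.*2.+3)%:R)^-1 : R) n = n%:R / n.*2.+1%:R.
Proof.
rewrite /series /=; elim: n => [|n ih]; first by rewrite big_geq// mul0r.
rewrite big_nat_recr//= ih natrM doubleS !natr_doubleS natr_doubleS3 -natr1.
have n0 : 0 <= n%:R :> R by rewrite ler0n.
by field; lra.
Qed.

Lemma cvg_inv_odd_pairs : cvgn (series (fun j => ((j.*2.+1 * j.*2.+3)%:R)^-1 : R)).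
Proof.
apply: nondecreasing_is_cvgn.
  by apply: nondecreasing_series => i _ _; rewrite invr_ge0 ler0n.
exists 1 => _ [n _ <-]; rewrite sum_inv_odd_pairs ler_pdivrMr ?ltr0n// mul1r ler_nat.
by rewrite -addnn; apply: leqW; exact: leq_addr.
Qed.

Lemma inv_odd_sqr_le (j : nat) :
  ((j.*2.+1)%:R ^+ 2)^-1 <= 3 * ((j.*2.+1 * j.*2.+3)%:R)^-1 :> R.
Proof.
rewrite natrM natr_doubleS natr_doubleS3.
have j0 : 0 <= j%:R :> R by rewrite ler0n.
rewrite -[leLHS]mul1r ler_pdivrMr ?exprn_gt0 ?ltr_pwDr ?mulr_ge0//.
rewrite mulrAC ler_pdivlMr; first by nra.
by rewrite mulr_gt0// ltr_pwDr ?mulr_ge0// addr_ge0 ?mulr_ge0.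
Qed.

Lemma cvg_inv_odd_sqr : cvgn (series (fun j => ((j.*2.+1)%:R ^+ 2)^-1 : R)).
Proof.
apply: (cvg_series_dominated (M := fun j => 3 * ((j.*2.+1 * j.*2.+3)%:R)^-1)).
  by move=> j; rewrite ger0_norm ?inv_odd_sqr_le// invr_ge0 exprn_ge0.
exact: cvg_series_mull cvg_inv_odd_pairs.
Qed.

Lemma cvg_pow2_sin (a : R) : 0 <= a ->
  2 ^+ m * sin (a / 2 ^+ m) @[m --> \oo] --> a.
Proof.
move=> a0.
have h : (2^-1 ^+ m : R) @[m --> \oo] --> 0.
  by apply: cvg_expr; rewrite ger0_norm ?invr_ge0// invf_lt1// ltr1n.
have hl : a - a ^+ 3 / 6 * (2^-1 ^+ m * 2^-1 ^+ m) @[m --> \oo] --> a.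
  rewrite -[X in _ --> X]subr0; apply: cvgB; first exact: cvg_cst.
  have := cvgM (cvg_cst (a ^+ 3 / 6)) (cvgM h h); rewrite !mulr0; exact.
apply: (squeeze_cvgr _ hl (cvg_cst a)).
near=> m; have p0 : 0 < 2 ^+ m :> R by rewrite exprn_gt0.
have am : 0 <= a / 2 ^+ m by rewrite divr_ge0// ltW.
rewrite exprVn; apply/andP; split; last first.
  by rewrite mulrC -ler_pdivlMr// sin_le_id.
apply: le_trans (ler_wpM2l (ltW p0) (sin_ge_cubic am)).
by rewrite le_eqVlt; apply/orP; left; apply/eqP; field; rewrite gt_eqF.
Unshelve. all: by end_near. Qed.

(** The first N odd multiples of [tau N] are the midpoints of N equal pieces of the interval from 0
    to pi / 2. Passing from N to 2 N halves the angle, and x -> pi / 2 - x exchanges the two halves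
    of the new points. *)
Let tau (N : nat) : R := pi / (4 * N%:R).

Let tau_double (N : nat) : (0 < N)%N -> tau N = tau N.*2 * 2.
Proof.
move=> N0; rewrite /tau -mul2n natrM; field.
by rewrite pnatr_eq0 -lt0n.
Qed.

Let tau_pihalf (N : nat) : (0 < N)%N -> 4 * N%:R * tau N.*2 = pi / 2.
Proof.
move=> N0; rewrite /tau -mul2n natrM; field.
by rewrite pnatr_eq0 -lt0n.
Qed.

Let odd_reflect (N i : nat) : (i < N)%N ->
  ((N.*2 - i.+1).*2.+1)%:R * tau N.*2 = pi / 2 - i.*2.+1%:R * tau N.*2.
Proof.
move=> iN; have N0 : (0 < N)%N by exact: leq_ltn_trans iN.
rewrite -(tau_pihalf N0) !natr_doubleS natrB; last first.
  by rewrite -addnn ltn_addr.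
by rewrite -natr1 -mul2n natrM; ring.
Qed.

Let odd_angle (N i : nat) : (i < N)%N -> 0 < i.*2.+1%:R * tau N < pi / 2.
Proof.
move=> iN; have N0 : (0 < N)%N by exact: leq_ltn_trans iN.
have p0 := @pi_gt0 R; have N0' : 0 < N%:R :> R by rewrite ltr0n.
have t0 : 0 < tau N by rewrite divr_gt0// mulr_gt0.
rewrite mulr_gt0 ?ltr0n//=.
have -> : pi / 2 = N.*2%:R * tau N.
  by rewrite /tau -mul2n natrM; field; rewrite gt_eqF.
by rewrite ltr_pM2r// ltr_nat ltn_Sdouble.
Qed.

Lemma big_nat_upper_half_rev (T : Type) (idx : T) (op : Monoid.com_law idx)
    N (F : nat -> T) :
  \big[op/idx]_(N <= i < N.*2) F i = \big[op/idx]_(0 <= i < N) F (N.*2 - i.+1)%N.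
Proof.
have -> : \big[op/idx]_(N <= i < N.*2) F i = \big[op/idx]_(0 + N <= i < N.*2) F i.
  by rewrite add0n.
rewrite big_addn -addnn addnK big_nat_rev add0n !big_nat.
by apply: eq_bigr => i /= iN; congr F; lia.
Qed.

Lemma sin_pihalfB (x : R) : sin (pi / 2 - x) = cos x.
Proof. by rewrite sinB sin_pihalf cos_pihalf mul1r mul0r subr0. Qed.

Lemma sin_quarter_sqr : sin (pi / 4) ^+ 2 = 1 / 2 :> R.
Proof.
have e : cos (pi / 4) = sin (pi / 4) :> R.
  by rewrite -sin_pihalfB; congr sin; field.
by have := cos2Dsin2 (pi / 4 : R); rewrite e; lra.
Qed.

Let sin_odd_neq0 (N i : nat) : (i < N)%N ->
  (sin (i.*2.+1%:R * tau N) != 0) * (cos (i.*2.+1%:R * tau N) != 0).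
Proof.
move=> iN; have /andP[a0 a1] := odd_angle iN.
by rewrite !gt_eqF ?cos_gt0_pihalf ?sin_gt0_pihalf ?a0// a1 andbT; lra.
Qed.

Let odd_tau (N i : nat) : (i < N)%N ->
  sin (i.*2.+1%:R * tau N) = 2 * sin (i.*2.+1%:R * tau N.*2) * cos (i.*2.+1%:R * tau N.*2).
Proof.
move=> iN; rewrite tau_double ?(leq_ltn_trans _ iN)// mulrA mulr_natr sin_mulr2n.
by rewrite -mulr_natr; ring.
Qed.

(** Pairing x with pi / 2 - x gives 1 / sin^2 x + 1 / cos^2 x = 4 / sin^2 (2 x), so each doubling
    multiplies the sum by 4. *)
Lemma sum_inv_sin_sqr (m : nat) :
  \sum_(0 <= i < 2 ^ m) (sin (i.*2.+1%:R * tau (2 ^ m)) ^+ 2)^-1 = 2 * (2 ^ m)%:R ^+ 2.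
Proof.
elim: m => [|m ih].
  by rewrite expn0 big_nat1 mul1r /tau mulr1 sin_quarter_sqr; field.
rewrite expnS mul2n; set N := (2 ^ m)%N in ih *.
have N0 : (0 < N)%N by rewrite expn_gt0.
rewrite (@big_cat_nat _ _ _ N)//=; last by rewrite -addnn leq_addr.
have -> : \sum_(N <= i < N.*2) (sin (i.*2.+1%:R * tau N.*2) ^+ 2)^-1 =
    \sum_(0 <= i < N) (cos (i.*2.+1%:R * tau N.*2) ^+ 2)^-1.
  rewrite big_nat_upper_half_rev !big_nat.
  by apply: eq_bigr => i /= iN; rewrite -sin_pihalfB -odd_reflect.
have -> : N.*2%:R = 2 * N%:R :> R by rewrite -mul2n natrM.
rewrite -big_split/= exprMn mulrCA -ih mulr_sumr !big_nat.
apply: eq_bigr => i /= iN; rewrite (odd_tau iN).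
have [] := @sin_odd_neq0 N.*2 i; first by rewrite -addnn ltn_addr.
set x := _ * _ => s0 c0.
have := cos2Dsin2 x; set c := cos x in c0 *; set t := sin x in s0 *.
move=> e; transitivity ((c ^+ 2 + t ^+ 2) / (t ^+ 2 * c ^+ 2)).
  by field; rewrite s0 c0.
by rewrite e; field; rewrite s0 c0.
Qed.

(** The same pairing, now with sin x cos x = sin (2 x) / 2. Squaring keeps the root in sin (pi / 4)
    out of the formula. *)
Lemma prod_sin_odd (m : nat) :
  (\prod_(0 <= i < 2 ^ m) sin (i.*2.+1%:R * tau (2 ^ m))) ^+ 2 = 2 / 4 ^+ (2 ^ m).
Proof.
elim: m => [|m ih].
  by rewrite expn0 big_nat1 mul1r /tau mulr1 sin_quarter_sqr; field.
rewrite expnS mul2n; set N := (2 ^ m)%N in ih *.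
have N0 : (0 < N)%N by rewrite expn_gt0.
rewrite (@big_cat_nat _ _ _ N)//=; last by rewrite -addnn leq_addr.
have -> : \prod_(N <= i < N.*2) sin (i.*2.+1%:R * tau N.*2) =
    \prod_(0 <= i < N) cos (i.*2.+1%:R * tau N.*2).
  rewrite big_nat_upper_half_rev !big_nat.
  by apply: eq_bigr => i /= iN; rewrite -sin_pihalfB -odd_reflect.
rewrite -big_split/=.
have -> : \prod_(0 <= i < N) (sin (i.*2.+1%:R * tau N.*2) * cos (i.*2.+1%:R * tau N.*2))
   = \prod_(0 <= i < N) (2^-1 * sin (i.*2.+1%:R * tau N)).
  rewrite !big_nat; apply: eq_bigr => i /= iN; rewrite (odd_tau iN); by field.
rewrite big_split /= exprMn ih prodr_const_nat subn0.
rewrite -addnn exprD -exprM mulnC exprM exprVn expr2.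
have -> : 2 * 2 = 4 :> R by ring.
by rewrite exprVn invfM; ring.
Qed.

(** After doubling, the factors with i + 1 odd form the previous product over odd multiples, and
    those with i + 1 even the induction hypothesis. *)
Lemma prod_sin_even (m : nat) :
  (\prod_(0 <= i < (2 ^ m).-1) sin (i.+1.*2%:R * tau (2 ^ m))) ^+ 2
    = 4 * (2 ^ m)%:R / 4 ^+ (2 ^ m).
Proof.
elim: m => [|m ih].
  by rewrite expn0 big_geq// expr1n; field.
have split_parity (F : nat -> R) M : \prod_(0 <= i < M.*2.+1) F i =
    \prod_(0 <= i < M.+1) F i.*2 * \prod_(0 <= i < M) F i.*2.+1.
  elim: M => [|M ihM]; first by rewrite !big_nat1 big_geq// mulr1.
  rewrite doubleS big_nat_recr//= big_nat_recr//= ihM.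
  rewrite [X in _ = X * _]big_nat_recr//= [X in _ = _ * X]big_nat_recr//= doubleS.
  by ring.
rewrite expnS mul2n; have := prod_sin_odd m; set N := (2 ^ m)%N in ih *.
have N0 : (0 < N)%N by rewrite expn_gt0.
have -> : (N.*2).-1 = N.-1.*2.+1 by lia.
rewrite split_parity prednK// exprMn => odd.
have e i : i.+1.*2%:R * tau N.*2 = i.+1%:R * tau N.
  by rewrite (tau_double N0) -mul2n natrM; ring.
under eq_bigr do rewrite e.
under [X in _ * X ^+ 2 = _]eq_bigr do rewrite e -doubleS.
rewrite odd ih -addnn exprD natrD.
by field; rewrite expf_neq0.
Qed.

Let scaled_tau m (k : R) : k * tau (2 ^ m) = k * (pi / 4) / 2 ^+ m.
Proof. by rewrite /tau natrX; field; rewrite expf_neq0. Qed.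

Let near_pow2 j : \forall m \near \oo, (j < 2 ^ m)%N.
Proof.
exists j => // m /= jm; apply: leq_ltn_trans jm _; exact: ltn_expl.
Qed.

(** [sum_inv_sin_sqr] divided by 4^m is 2 for every m, while its terms tend to 16 / (pi^2 (2 j +
    1)^2); [sin_ge_chord] supplies the dominating series. *)
Lemma lim_inv_odd_sqr :
  limn (series (fun j => ((j.*2.+1)%:R ^+ 2)^-1 : R)) = pi ^+ 2 / 8.
Proof.
have p0 := @pi_gt0 R.
pose f m j : R := if (j < 2 ^ m)%N then
  ((2 ^+ m * sin (j.*2.+1%:R * tau (2 ^ m))) ^+ 2)^-1 else 0.
pose l j : R := ((j.*2.+1%:R * (pi / 4)) ^+ 2)^-1.
have [|||cl] := @tannery R nat \oo _ f l (fun j => 4 * ((j.*2.+1)%:R ^+ 2)^-1).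
- move=> j; have : ((2 ^+ m * sin (j.*2.+1%:R * (pi / 4) / 2 ^+ m)) ^+ 2)^-1 @[m --> \oo] --> l j.
    apply: cvgV; first by rewrite expf_neq0// mulf_neq0 ?pnatr_eq0// gt_eqF// divr_gt0.
    by apply: cvg_expn; apply: cvg_pow2_sin; rewrite mulr_ge0// divr_ge0// ltW.
  apply: cvg_trans; apply: near_eq_cvg.
  by near=> m; rewrite /f (near (near_pow2 j) m)// scaled_tau.
- near=> m => j; rewrite /f; case: ifP => jm; last first.
    by rewrite normr0 mulr_ge0// invr_ge0 exprn_ge0.
  rewrite ger0_norm ?invr_ge0 ?sqr_ge0//.
  have /andP[a0 a1] := odd_angle jm.
  have := sin_ge_chord (x := j.*2.+1%:R * tau (2 ^ m)); rewrite (ltW a0) (ltW a1) => /(_ isT).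
  have e0 : 0 < 2 ^+ m :> R by rewrite exprn_gt0.
  rewrite -(ler_pM2l e0).
  have -> : 2 ^+ m * (2 / pi * (j.*2.+1%:R * tau (2 ^ m))) = j.*2.+1%:R / 2.
    by rewrite scaled_tau; move: (pi : R) p0 => p p0; field; rewrite !gt_eqF.
  have q0 : 0 < j.*2.+1%:R / 2 :> R by rewrite divr_gt0// ltr0n.
  move=> h; have -> : 4 * (j.*2.+1%:R ^+ 2)^-1 = ((j.*2.+1%:R / 2) ^+ 2)^-1 :> R.
    have : j.*2.+1%:R != 0 :> R by rewrite pnatr_eq0.
    by move: (j.*2.+1%:R) => y y0; field.
  rewrite lef_pV2 ?posrE ?exprn_gt0 ?(lt_le_trans q0)//.
  by rewrite lerXn2r// nnegrE ltW// (lt_le_trans q0).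
- exact: cvg_series_mull cvg_inv_odd_sqr.
have e m : limn (series (f m)) = 2.
  have h : forall j, (2 ^ m <= j)%N -> f m j = 0 by move=> j; rewrite leqNgt /f; case: ifP.
  rewrite (cvg_lim _ (cvg_series_finite_support h))// /series /=.
  have := sum_inv_sin_sqr m; set S := \sum_(0 <= i < _) _ => eS.
  have -> : \sum_(0 <= i < 2 ^ m) f m i = (2 ^+ m ^+ 2)^-1 * S.
    rewrite /S mulr_sumr !big_nat; apply: eq_bigr => i /= im.
    by rewrite /f im exprMn invfM.
  by rewrite eS natrX mulrCA mulVf ?mulr1// !expf_neq0.
under eq_fun do rewrite e.
move=> /(cvg_unique_real (cvg_cst (2 : R))) h.
have : l = (fun j => 16 / pi ^+ 2 * ((j.*2.+1)%:R ^+ 2)^-1).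
  apply/funext => j; rewrite /l; have : j.*2.+1%:R != 0 :> R by rewrite pnatr_eq0.
  by move: (j.*2.+1%:R) (pi : R) p0 => y p p0 y0; field; rewrite y0 gt_eqF.
move=> le; move: h; rewrite {}le lim_series_mull; last exact: cvg_inv_odd_sqr.
set L := limn _ => h.
have -> : L = pi ^+ 2 / 16 * (16 / pi ^+ 2 * L) by move: (pi : R) p0 => p p0; field; rewrite gt_eqF.
by rewrite -h; move: (pi : R) => p; field.
Unshelve. all: by end_near. Qed.

Let sin_sqr_sub (b t : R) : sin (b - t) * sin (b + t) = sin b ^+ 2 - sin t ^+ 2.
Proof.
have := cos2Dsin2 b; have := cos2Dsin2 t; rewrite sinB sinD => et eb.
transitivity (sin b ^+ 2 * (cos t ^+ 2 + sin t ^+ 2) - sin t ^+ 2 * (cos b ^+ 2 + sin b ^+ 2)).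
  by ring.
by rewrite et eb !mulr1.
Qed.

Let even_odd_tau N j : ((j.+1.*2)%:R * tau N - tau N = j.*2.+1%:R * tau N) *
  ((j.+1.*2)%:R * tau N + tau N = j.*2.+3%:R * tau N).
Proof.
rewrite natr_doubleS natr_doubleS3 -mul2n natrM -natr1.
by split; ring.
Qed.

(** A finite Wallis product. The denominator consists of two copies of the product over all odd
    multiples, one without its last value, the cosine of [tau], and one without its first, the sine
    of [tau]. *)
Lemma prod_sin_ratio (m : nat) : \prod_(0 <= j < (2 ^ m).-1)
   (sin (j.+1.*2%:R * tau (2 ^ m)) ^+ 2 /
     (sin (j.*2.+1%:R * tau (2 ^ m)) * sin (j.*2.+3%:R * tau (2 ^ m))))
  = 2 ^+ m * sin (2 * (pi / 4) / 2 ^+ m).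
Proof.
have := prod_sin_even m; have := prod_sin_odd m.
rewrite -scaled_tau -(natrX _ 2 m); set N := (2 ^ m)%N.
have N0 : (0 < N)%N by rewrite expn_gt0.
have sn j : (j < N)%N -> sin (j.*2.+1%:R * tau N) != 0.
  by move=> jN; rewrite (sin_odd_neq0 jN).
pose s (j : nat) := sin (j.*2.+1%:R * tau N).
set O := \prod_(0 <= i < N) _ => eO.
set E := \prod_(0 <= i < _) _ => eE.
have O1 : O = \prod_(0 <= j < N.-1) s j * cos (tau N).
  rewrite /O -{1}(prednK N0) big_nat_recr//=; congr (_ * _).
  rewrite -sin_pihalfB; congr sin; rewrite natr_doubleS -subn1 natrB//.
  have -> : pi / 2 = 2 * N%:R * tau N :> R.
    by rewrite /tau; move: (pi : R) => p; field; rewrite pnatr_eq0 -lt0n.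
  by ring.
have O2 : O = sin (tau N) * \prod_(0 <= j < N.-1) s j.+1.
  by rewrite /O -{1}(prednK N0) big_nat_recl//= mul1r.
have O0 : O != 0.
  rewrite /O big_seq_cond prodf_seq_neq0; apply/allP => j.
  by rewrite mem_index_iota /= => /sn->; rewrite implybT.
have c0 : cos (tau N) != 0 by apply: contraNneq O0 => c; rewrite O1 c mulr0.
have t0 : sin (tau N) != 0 by apply: contraNneq O0 => c; rewrite O2 c mul0r.
rewrite prodf_div prodrXl -/E big_split /=.
have -> : \prod_(0 <= i < N.-1) sin (i.*2.+1%:R * tau N) = O / cos (tau N).
  by rewrite O1 mulfK.
have -> : \prod_(0 <= i < N.-1) sin (i.*2.+3%:R * tau N) = O / sin (tau N).
  by rewrite O2 mulrC mulKf.
have -> : sin (2 * tau N) = 2 * (cos (tau N) * sin (tau N)).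
  by rewrite mulr_natl sin_mulr2n -mulr_natl.
rewrite eE.
have -> : O / cos (tau N) * (O / sin (tau N)) = 2 / 4 ^+ N / (cos (tau N) * sin (tau N)).
  by rewrite -eO; field; rewrite ?c0 ?t0.
have p0 : 4 ^+ N != 0 :> R by rewrite expf_neq0.
by move: (4 ^+ N) p0 => q q0; field; rewrite c0 t0.
Qed.

(** Tannery's theorem carries the finite products to the infinite one. As sin (b - t) sin (b + t) =
    sin^2 b - sin^2 t, with t = [tau] each logarithm is that of 1 + sin^2 t / (sin (b - t) sin (b +
    t)), and the chord bound makes it at most (pi / 2)^2 / ((2 j + 1) (2 j + 3)). *)
Lemma wallis_lim : limn (series (fun j =>
    ln ((j.+1.*2%:R ^+ 2) / (j.*2.+1%:R * j.*2.+3%:R)) : R)) = ln (pi / 2) /\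
  cvgn (series (fun j =>
    ln ((j.+1.*2%:R ^+ 2) / (j.*2.+1%:R * j.*2.+3%:R)) : R)).
Proof.
have p0 := @pi_gt0 R.
pose S m (k : nat) : R := sin (k%:R * tau (2 ^ m)).
pose f m j : R := if (j < (2 ^ m).-1)%N then
  ln (S m j.+1.*2 ^+ 2 / (S m j.*2.+1 * S m j.*2.+3)) else 0.
pose l j : R := ln ((j.+1.*2%:R ^+ 2) / (j.*2.+1%:R * j.*2.+3%:R)).
have S_gt0 m j : (j < 2 ^ m)%N -> 0 < S m j.*2.+1.
  move=> jm; rewrite sin_gt0_pihalf//; exact: odd_angle.
have [|||cl] := @tannery R nat \oo _ f l
    (fun j => (pi / 2) ^+ 2 * ((j.*2.+1 * j.*2.+3)%:R)^-1).
- move=> j.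
  have cS (k : nat) : 2 ^+ m * S m k @[m --> \oo] --> k%:R * (pi / 4).
    rewrite /S; under eq_fun do rewrite scaled_tau.
    by apply: cvg_pow2_sin; rewrite mulr_ge0// divr_ge0// ltW.
  have kp (k : nat) : 0 < k.+1%:R * (pi / 4) :> R by rewrite mulr_gt0 ?divr_gt0.
  have : ln ((2 ^+ m * S m j.+1.*2) ^+ 2 / ((2 ^+ m * S m j.*2.+1) * (2 ^+ m * S m j.*2.+3)))
      @[m --> \oo] --> l j.
    rewrite /l.
    have -> : j.+1.*2%:R ^+ 2 / (j.*2.+1%:R * j.*2.+3%:R) =
      (j.+1.*2%:R * (pi / 4)) ^+ 2 / ((j.*2.+1%:R * (pi / 4)) * (j.*2.+3%:R * (pi / 4))) :> R.
      have : j.*2.+1%:R != 0 :> R by rewrite pnatr_eq0.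
      have : j.*2.+3%:R != 0 :> R by rewrite pnatr_eq0.
      move: (j.*2.+1%:R) (j.*2.+3%:R) (pi : R) p0 => y z p p0 y0 z0.
      by field; rewrite y0 z0 gt_eqF.
    apply: (@continuous_cvg _ _ _ _ _ _ (@ln R)).
      by apply: continuous_ln; rewrite divr_gt0 ?exprn_gt0 ?mulr_gt0 ?divr_gt0.
    apply: cvgM; first exact: cvg_expn.
    by apply: cvgV; [rewrite gt_eqF// mulr_gt0|apply: cvgM].
  apply: cvg_trans; apply: near_eq_cvg; near=> m.
  have jm : (j.+1 < 2 ^ m)%N by near: m; exact: near_pow2.
  rewrite /f -ltnS prednK ?expn_gt0// jm; congr ln.
  have e0 : 2 ^+ m != 0 :> R by rewrite expf_neq0.
  have := S_gt0 m j (ltnW jm); have := S_gt0 m j.+1 jm; rewrite doubleS => s1 s2.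
  by move: (2 ^+ m) e0 => e e0; field; rewrite e0 !gt_eqF.
- near=> m => j; rewrite /f; case: ifP => jm; last first.
    by rewrite normr0 mulr_ge0 ?sqr_ge0// invr_ge0.
  have jm1 : (j.+1 < 2 ^ m)%N by rewrite -(prednK (_ : 0 < 2 ^ m)%N) ?expn_gt0.
  have s1 := S_gt0 m j (ltnW jm1); have := S_gt0 m j.+1 jm1; rewrite doubleS => s3.
  have /andP[a1 b1] := odd_angle (ltnW jm1); have /andP[a3 b3] := odd_angle jm1.
  have t0 : 0 < tau (2 ^ m) by rewrite divr_gt0// mulr_gt0// ltr0n expn_gt0.
  have [e1 e3] := even_odd_tau (2 ^ m) j.
  have e2 : S m j.+1.*2 ^+ 2 = S m j.*2.+1 * S m j.*2.+3 + sin (tau (2 ^ m)) ^+ 2.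
    by rewrite /S -e1 -e3 sin_sqr_sub subrK.
  have tpi : tau (2 ^ m) <= pi / 2.
    apply: le_trans (ltW b1); rewrite ler_peMl ?(ltW t0)// ler1n.
    by [].
  rewrite e2 mulrDl divff ?gt_eqF ?mulr_gt0//.
  set r := _ / _; have r0 : 0 <= r by rewrite divr_ge0 ?sqr_ge0// ltW// mulr_gt0.
  rewrite ger0_norm; last by rewrite ln_ge0// lerDl.
  apply: le_trans (le_ln1Dx _) _; first by rewrite (lt_le_trans _ r0)// ltrN10.
  rewrite /r.
  have j1 := sin_ge_chord (x := j.*2.+1%:R * tau (2 ^ m)).
  have j3 := sin_ge_chord (x := j.+1.*2.+1%:R * tau (2 ^ m)).
  rewrite (ltW a1) (ltW b1) in j1; rewrite (ltW a3) (ltW b3) in j3.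
  have st : sin (tau (2 ^ m)) <= tau (2 ^ m) by rewrite sin_le_id// ltW.
  have st0 : 0 <= sin (tau (2 ^ m)).
    by rewrite sin_ge0_pi// (ltW t0)/=; apply: le_trans tpi _; lra.
  rewrite ler_pdivrMr ?mulr_gt0//.
  move/(_ isT) in j1; move/(_ isT) in j3.
  have h : 2 / pi * (j.*2.+1%:R * tau (2 ^ m)) * (2 / pi * (j.*2.+3%:R * tau (2 ^ m)))
     <= S m j.*2.+1 * S m j.*2.+3.
    by apply: ler_pM => //; rewrite mulr_ge0 ?divr_ge0 ?(ltW p0)// mulr_ge0// ltW.
  have c0 : 0 <= (pi / 2) ^+ 2 / (j.*2.+1 * j.*2.+3)%:R :> R.
    by rewrite divr_ge0 ?sqr_ge0.
  apply: le_trans (ler_wpM2l c0 h).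
  have -> : (pi / 2) ^+ 2 / (j.*2.+1 * j.*2.+3)%:R * (2 / pi * (j.*2.+1%:R * tau (2 ^ m)) *
     (2 / pi * (j.*2.+3%:R * tau (2 ^ m)))) = tau (2 ^ m) ^+ 2.
    have : j.*2.+1%:R != 0 :> R by rewrite pnatr_eq0.
    have : j.*2.+3%:R != 0 :> R by rewrite pnatr_eq0.
    rewrite natrM.
    move: (j.*2.+1%:R) (j.*2.+3%:R) (pi : R) p0 (tau _) => y z p p' t y0 z0.
    by field; rewrite y0 z0 gt_eqF.
  by rewrite lerXn2r ?nnegrE// ltW.
- exact: cvg_series_mull cvg_inv_odd_pairs.
move=> h; split=> //; apply: (cvg_unique_real h).
have e m : limn (series (f m)) = ln (2 ^+ m * sin (2 * (pi / 4) / 2 ^+ m)).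
  have hf : forall j, ((2 ^ m).-1 <= j)%N -> f m j = 0.
    by move=> j; rewrite leqNgt /f; case: ifP.
  rewrite (cvg_lim _ (cvg_series_finite_support hf))// /series /=.
  rewrite -prod_sin_ratio.
  have : forall n, (n <= (2 ^ m).-1)%N -> \sum_(0 <= i < n) f m i =
    ln (\prod_(0 <= j < n) (S m j.+1.*2 ^+ 2 / (S m j.*2.+1 * S m j.*2.+3))) /\
    0 < \prod_(0 <= j < n) (S m j.+1.*2 ^+ 2 / (S m j.*2.+1 * S m j.*2.+3)).
    elim=> [_|n ih nm]; first by rewrite !big_geq// ln1.
    have [e1 e2] := ih (ltnW nm).
    have jm1 : (n.+1 < 2 ^ m)%N by rewrite -(prednK (_ : 0 < 2 ^ m)%N) ?expn_gt0.
    have s1 := S_gt0 m n (ltnW jm1); have := S_gt0 m n.+1 jm1; rewrite doubleS => s3.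
    have [e3 e4] := even_odd_tau (2 ^ m) n.
    have s2 : 0 < S m n.*2.+2 ^+ 2.
      have -> : S m n.*2.+2 ^+ 2 = S m n.*2.+1 * S m n.*2.+3 + sin (tau (2 ^ m)) ^+ 2.
        by rewrite /S -e3 -e4 sin_sqr_sub subrK.
      by rewrite ltr_wpDr ?sqr_ge0// mulr_gt0.
    have r0 : 0 < S m n.*2.+2 ^+ 2 / (S m n.*2.+1 * S m n.*2.+3).
      by rewrite divr_gt0// mulr_gt0.
    rewrite !big_nat_recr//= doubleS lnM ?posrE// -e1 /f nm doubleS; split=> //.
    exact: mulr_gt0.
  by move=> /(_ _ (leqnn _))[].
under eq_fun do rewrite e.
have -> : pi / 2 = 2 * (pi / 4) :> R by move: (pi : R) => p; field.
apply: (@continuous_cvg _ _ _ _ _ _ (@ln R)).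
  by apply: continuous_ln; rewrite mulr_gt0// divr_gt0.
by apply: cvg_pow2_sin; rewrite mulr_ge0// divr_ge0// ltW.
Unshelve. all: by end_near. Qed.

End TrigSums.

(** * The series of log ((1 + z) / (1 - z)) *)

Section LogSeries.
Context {R : realType}.
Implicit Types (x r phi a : R).

Lemma cos_double phi : cos (2 * phi) = 2 * cos phi ^+ 2 - 1.
Proof. by rewrite mulr_natl cos_mulr2n -mulr_natl. Qed.

(** The squared modulus of 1 - z^2 at z = x exp (i phi). *)
Let D2 phi x : R := 1 - 2 * x ^+ 2 * cos (2 * phi) + x ^+ 4.

Let D2_ge phi x : (1 - x ^+ 2) ^+ 2 <= D2 phi x.
Proof.
rewrite -subr_ge0; have -> : D2 phi x - (1 - x ^+ 2) ^+ 2 = 2 * x ^+ 2 * (1 - cos (2 * phi)).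
  by rewrite /D2; ring.
by rewrite mulr_ge0 ?subr_ge0 ?cos_le1// mulr_ge0// sqr_ge0.
Qed.

Let oneBsqr_gt0 x r : 0 <= x <= r -> r < 1 -> 0 < 1 - x ^+ 2.
Proof. by move=> /andP[x0 xr] r1; rewrite subr_gt0 expr_lt1//; exact: le_lt_trans r1. Qed.

Let D2_gt0 phi x r : 0 <= x <= r -> r < 1 -> 0 < D2 phi x.
Proof.
by move=> xr r1; apply: lt_le_trans (D2_ge _ _); rewrite exprn_gt0// (oneBsqr_gt0 xr r1).
Qed.

(** The real part of 2 exp (i (phi + a)) z^(2 n) / (1 - z^2) at z = x exp (i phi), a geometric tail.
    The offset a is 0 for the cosine series and - pi / 2 for the sine series. *)
Let remainder phi a (n : nat) x : R := 2 * x ^+ (2 * n) *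
  (cos ((2 * n%:R + 1) * phi + a) - x ^+ 2 * cos ((2 * n%:R - 1) * phi + a)) / D2 phi x.

Let remainderS phi a n x r : 0 <= x <= r -> r < 1 ->
  remainder phi a n.+1 x =
  remainder phi a n x - 2 * x ^+ (2 * n) * cos ((2 * n%:R + 1) * phi + a).
Proof.
move=> xr r1; have d0 := D2_gt0 phi xr r1.
rewrite /remainder -(natr1 n).
have e : cos ((2 * (n%:R + 1) + 1) * phi + a) = 2 * cos (2 * phi) *
   cos ((2 * n%:R + 1) * phi + a) - cos ((2 * n%:R - 1) * phi + a).
  set b := (2 * n%:R + 1) * phi + a.
  have -> : (2 * (n%:R + 1) + 1) * phi + a = b + 2 * phi by rewrite /b; ring.
  have -> : (2 * n%:R - 1) * phi + a = b - 2 * phi by rewrite /b; ring.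
  by rewrite cosD cosB; ring.
have -> : (2 * (n%:R + 1) - 1) * phi + a = (2 * n%:R + 1) * phi + a by ring.
rewrite e mulnS exprD.
have := gt_eqF d0; rewrite /D2; set u := cos _; set v := cos (2 * phi).
by move=> d; field; rewrite d.
Qed.

(* The remainder of the n-th partial sum has derivative [remainder], which is
   O(r^(2n)), so the mean value theorem gives convergence. *)
Lemma cvg_odd_series_cos phi a r (F : R -> R) : 0 <= r < 1 -> F 0 = 0 ->
  (forall x, 0 <= x <= r -> is_derive x 1 F
     (2 * (cos (phi + a) - x ^+ 2 * cos (a - phi)) / D2 phi x)) ->
  series (fun j => 2 / j.*2.+1%:R * r ^+ j.*2.+1 * cos (j.*2.+1%:R * phi + a))
    @ \oo --> F r.
Proof.
move=> /andP[r0 r1] F0 dF.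
pose G (n : nat) (x : R) := F x -
  series (fun j => 2 / j.*2.+1%:R * x ^+ j.*2.+1 * cos (j.*2.+1%:R * phi + a)) n.
have dG n x : 0 <= x <= r -> is_derive x 1 (G n) (remainder phi a n x).
  move=> xr; elim: n => [|n ih].
    have -> : G 0 = F.
      by apply/funext => y; rewrite /G /series /= big_geq// subr0.
    rewrite /remainder !mulr0 expr0 add0r sub0r mul1r mulN1r mulr1 [- phi + a]addrC.
    exact: dF.
  have -> : G n.+1 = fun y => G n y -
      2 / n.*2.+1%:R * y ^+ n.*2.+1 * cos (n.*2.+1%:R * phi + a).
    by apply/funext => y; rewrite /G seriesSr/=; ring.
  rewrite (remainderS _ _ _ xr r1).
  apply: is_derive_addf.
  apply: is_derive_oppf.
  derive_by idtac.
  have : n.*2.+1%:R != 0 :> R by rewrite pnatr_eq0.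
  rewrite natr_doubleS mul2n; move: (_ + 1) => k k0.
  by field.
have rn : 0 < 1 - r ^+ 2 by rewrite (oneBsqr_gt0 (r := r))// r0 lexx.
have bnd n : `|G n r| <= 4 * r ^+ (2 * n) / (1 - r ^+ 2) ^+ 2.
  have [||c] := @MVT_segment R (G n) (remainder phi a n) 0 r r0.
  - by move=> x; rewrite in_itv/= => /andP[x0 xr]; apply: dG; rewrite !ltW.
  - by apply: derivable_within_continuous => y; rewrite in_itv/= => /(dG n)[].
  rewrite in_itv/= => cr; have /andP[c0 cr'] := cr.
  have -> : G n 0 = 0.
    rewrite /G F0 /series /= big1 ?subr0// => i _.
    by rewrite expr0n /= mulr0 mul0r.
  rewrite !subr0 => ->; rewrite normrM (ger0_norm r0).
  apply: le_trans (_ : `|remainder phi a n c| * 1 <= _).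
    by rewrite ler_wpM2l// ltW.
  rewrite mulr1 /remainder normrM normfV (gtr0_norm (D2_gt0 phi cr r1)).
  apply: ler_pM => //; first by rewrite invr_ge0 ltW// (D2_gt0 phi cr r1).
    rewrite normrM normrM ger0_norm// normrX (ger0_norm c0).
    have -> : 4 * r ^+ (2 * n) = 2 * r ^+ (2 * n) * 2 by ring.
    apply: ler_pM => //.
      by rewrite mulr_ge0// exprn_ge0.
      by rewrite ler_pM2l// lerXn2r.
    apply: le_trans (ler_normB _ _) _; rewrite normrM -[2]/(1 + 1).
    apply: lerD; first exact: cos_max.
    rewrite -[1]mulr1; apply: ler_pM => //; last exact: cos_max.
    by rewrite ger0_norm ?sqr_ge0// expr_le1// (le_trans cr')// ltW.
  rewrite lef_pV2 ?posrE ?exprn_gt0//; last exact: D2_gt0 cr r1.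
  apply: le_trans (D2_ge _ _); rewrite lerXn2r ?nnegrE ?(ltW rn)//.
    by rewrite ltW// (oneBsqr_gt0 cr r1).
  by rewrite lerD2l lerN2 lerXn2r.
have lim0 : 4 * r ^+ (2 * n) / (1 - r ^+ 2) ^+ 2 @[n --> \oo] --> 0.
  under eq_fun do rewrite exprM mulrAC.
  rewrite -(mulr0 (4 / (1 - r ^+ 2) ^+ 2)); apply: cvgM; first exact: cvg_cst.
  by apply: cvg_expr; rewrite ger0_norm ?sqr_ge0// -subr_gt0.
have G0 : G n r @[n --> \oo] --> 0.
  by apply/norm_cvg0P; apply: (squeeze_cvgr _ (cvg_cst 0) lim0); near=> n; rewrite normr_ge0 bnd.
rewrite -[F r]subr0.
have -> : series (fun j => 2 / j.*2.+1%:R * r ^+ j.*2.+1 * cos (j.*2.+1%:R * phi + a))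
   = fun n => F r - G n r by apply/funext => n; rewrite /G; ring.
by apply: cvgB => //; exact: cvg_cst.
Unshelve. all: by end_near. Qed.

Let quad_gt0 c x r : `|c| <= 1 -> 0 <= x <= r -> r < 1 -> 0 < 1 + 2 * c * x + x ^+ 2.
Proof.
rewrite ler_norml => /andP[c1 c2] /andP[x0 xr] r1.
have -> : 1 + 2 * c * x + x ^+ 2 = (1 - x) ^+ 2 + 2 * (1 + c) * x by ring.
rewrite ltr_pwDl ?exprn_gt0 ?subr_gt0 ?(le_lt_trans xr)// mulr_ge0// mulr_ge0//.
by rewrite -lerBlDl sub0r.
Qed.

(** This and [odd_log_im] are the logarithm of the modulus and the argument of (1 + z) / (1 - z) at
    z = r exp (i phi). For r < 1 the real part of this quotient is positive, so the arctangent is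
    the argument itself. *)
Definition odd_log_re phi r : R :=
  (ln (1 + 2 * cos phi * r + r ^+ 2) - ln (1 + 2 * (- cos phi) * r + r ^+ 2)) / 2.

Definition odd_log_im phi r : R := atan (2 * r * sin phi / (1 - r ^+ 2)).

Lemma cvg_odd_log_re phi r : 0 <= r < 1 ->
  series (fun j => 2 / j.*2.+1%:R * r ^+ j.*2.+1 * cos (j.*2.+1%:R * phi))
    @ \oo --> odd_log_re phi r.
Proof.
move=> r01; have /andP[r0 r1] := r01.
have := @cvg_odd_series_cos phi 0 r (odd_log_re phi) r01.
have -> : (fun j => 2 / j.*2.+1%:R * r ^+ j.*2.+1 * cos (j.*2.+1%:R * phi + 0)) =
   (fun j => 2 / j.*2.+1%:R * r ^+ j.*2.+1 * cos (j.*2.+1%:R * phi)).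
  by apply/funext => j; rewrite addr0.
apply.
  by rewrite /odd_log_re !mulr0 expr0n !addr0 ln1 subrr mul0r.
move=> x xr; rewrite addr0 sub0r cosN.
have c1 := cos_max phi; have c2 : `|- cos phi| <= 1 by rewrite normrN.
have q1 := quad_gt0 c1 xr r1; have q2 := quad_gt0 c2 xr r1.
have d := D2_gt0 phi xr r1.
rewrite /odd_log_re.
(notypeclasses refine (is_derive_eq _ _)); [by derive_rules|].
rewrite /=.
move: q1 q2 d; rewrite /D2 cos_double; set c := cos phi.
have -> : 1 - 2 * x ^+ 2 * (2 * c ^+ 2 - 1) + x ^+ 4 =
   (1 + 2 * c * x + x ^+ 2) * (1 + 2 * - c * x + x ^+ 2) by ring.
move=> q1 q2 d; field.
by rewrite !gt_eqF.
Qed.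

Lemma cvg_odd_log_im phi r : 0 <= r < 1 ->
  series (fun j => 2 / j.*2.+1%:R * r ^+ j.*2.+1 * sin (j.*2.+1%:R * phi))
    @ \oo --> odd_log_im phi r.
Proof.
move=> r01; have /andP[r0 r1] := r01.
have := @cvg_odd_series_cos phi (- (pi / 2)) r (odd_log_im phi) r01.
have -> : (fun j => 2 / j.*2.+1%:R * r ^+ j.*2.+1 * cos (j.*2.+1%:R * phi - pi / 2)) =
   (fun j => 2 / j.*2.+1%:R * r ^+ j.*2.+1 * sin (j.*2.+1%:R * phi)).
  by apply/funext => j; rewrite cosBpihalf.
apply.
  by rewrite /odd_log_im mulr0 !mul0r atan0.
move=> x xr; rewrite cosBpihalf -opprD cosN [pi / 2 + phi]addrC cosDpihalf.
have w := oneBsqr_gt0 xr r1; have d := D2_gt0 phi xr r1.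
rewrite /odd_log_im.
(notypeclasses refine (is_derive_eq _ _)); [by derive_rules; rewrite gt_eqF|].
rewrite /=.
have e : D2 phi x = (1 - x ^+ 2) ^+ 2 + 4 * x ^+ 2 * sin phi ^+ 2.
  by rewrite /D2 cos_double cos2sin2; ring.
move: d w; rewrite e; set s := sin phi; move=> d w; field.
by rewrite !gt_eqF// addrC.
Qed.

(** Real and imaginary part of (1 + z) / (1 - z), with D = |1 - z|^2. Both sides of the first
    identity are nonnegative, so their squares may be compared, by cos^2 (atan W) = 1 / (1 + W^2);
    the second follows through the tangent. *)
Lemma expR_odd_log phi r : 0 <= r < 1 ->
  let D := 1 - 2 * cos phi * r + r ^+ 2 in
  [/\ 0 < D, expR (odd_log_re phi r) * cos (odd_log_im phi r) = (1 - r ^+ 2) / D &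
  expR (odd_log_re phi r) * sin (odd_log_im phi r) = 2 * r * sin phi / D].
Proof.
move=> r01 /=; have /andP[r0 r1] := r01.
have xr : 0 <= r <= r by rewrite r0 lexx.
have c1 := cos_max phi; have c2 : `|- cos phi| <= 1 by rewrite normrN.
have q1 := quad_gt0 c1 xr r1; have := quad_gt0 c2 xr r1.
have -> : 1 + 2 * - cos phi * r + r ^+ 2 = 1 - 2 * cos phi * r + r ^+ 2 by ring.
move=> q2; have w := oneBsqr_gt0 xr r1.
set W := 2 * r * sin phi / (1 - r ^+ 2).
have eW : 1 + W ^+ 2 = (1 + 2 * cos phi * r + r ^+ 2) * (1 - 2 * cos phi * r + r ^+ 2)
    / (1 - r ^+ 2) ^+ 2.
  rewrite /W; have := sin2cos2 phi; set s := sin phi; set c := cos phi => es.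
  have -> : (2 * r * s / (1 - r ^+ 2)) ^+ 2 = 4 * r ^+ 2 * s ^+ 2 / (1 - r ^+ 2) ^+ 2.
    by field; rewrite gt_eqF.
  by rewrite es; field; rewrite gt_eqF.
have eC : expR (odd_log_re phi r) * cos (odd_log_im phi r) =
    (1 - r ^+ 2) / (1 - 2 * cos phi * r + r ^+ 2).
  apply/eqP; rewrite -(@eqrXn2 _ 2)//; last 2 first.
    by rewrite mulr_ge0 ?expR_ge0// cos_ge0_pihalf// ltW ?atan_gtNpi2// ltW// atan_ltpi2.
    by rewrite divr_ge0// ltW.
  have -> : (expR (odd_log_re phi r) * cos (odd_log_im phi r)) ^+ 2 =
    expR (odd_log_re phi r + odd_log_re phi r) * cos (odd_log_im phi r) ^+ 2.
    by rewrite expRD; ring.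
  rewrite /odd_log_im cos_atan -/W exprVn sqr_sqrtr ?addr_ge0 ?sqr_ge0//.
  rewrite eW /odd_log_re.
  have -> : 1 + 2 * - cos phi * r + r ^+ 2 = 1 - 2 * cos phi * r + r ^+ 2 by ring.
  rewrite -splitr expRD expRN !lnK ?posrE//.
  apply/eqP; field; by rewrite !gt_eqF.
split => //.
have c0 : cos (odd_log_im phi r) != 0.
  by rewrite gt_eqF// cos_gt0_pihalf// atan_gtNpi2 atan_ltpi2.
have -> : sin (odd_log_im phi r) = cos (odd_log_im phi r) * W.
  by rewrite -[W]atanK /tan mulrCA mulfV ?mulr1.
rewrite mulrA eC /W; field.
by rewrite !gt_eqF.
Qed.

End LogSeries.

(** * Asymptotics of the logarithm of the generating function *)

Section LogGenerating.
Context {R : realType}.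
Implicit Types (x t : R).

(* [log_factor x] is the logarithm of (1 + q) / (1 - q) at q = exp (- x), and
   [log_gen t] the logarithm of the generating function of all overpartitions
   at exp (- t). *)
Definition log_factor x : R := ln ((1 + expR (- x)) / (1 - expR (- x))).

Definition log_gen t : R :=
  limn (series (fun j => 2 / j.*2.+1%:R / (expR (j.*2.+1%:R * t) - 1))).

Lemma expRN_itv x : 0 < x -> 0 <= expR (- x) < 1.
Proof. by move=> x0; rewrite expR_ge0 expR_lt1 oppr_lt0. Qed.

Lemma odd_log_re0 x : 0 < x -> odd_log_re 0 (expR (- x)) = log_factor x.
Proof.
move=> /expRN_itv; rewrite /odd_log_re /log_factor cos0; set q := expR _ => /andP[q0 q1].
have -> : 1 + 2 * 1 * q + q ^+ 2 = (1 + q) ^+ 2 by ring.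
have -> : 1 + 2 * - 1 * q + q ^+ 2 = (1 - q) ^+ 2 by ring.
have a : 0 < 1 + q by rewrite ltr_pwDl. have b : 0 < 1 - q by rewrite subr_gt0.
by rewrite !lnXn// ln_div ?posrE// -mulrnBl -[_ *+ 2]mulr_natr mulfK.
Qed.

Lemma cvg_log_factor_series x : 0 < x ->
  series (fun j => 2 / j.*2.+1%:R * expR (- (j.*2.+1%:R * x))) @ \oo --> log_factor x.
Proof.
move=> x0; rewrite -odd_log_re0//.
have -> : (fun j : nat => 2 / j.*2.+1%:R * expR (- (j.*2.+1%:R * x)) : R) =
  (fun j => 2 / j.*2.+1%:R * expR (- x) ^+ j.*2.+1 * cos (j.*2.+1%:R * 0)).
  by apply/funext => j; rewrite mulr0 cos0 mulr1 -expRM_natl mulrN.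
exact/cvg_odd_log_re/expRN_itv.
Qed.

Lemma odd_ge1 (j : nat) : 1 <= j.*2.+1%:R :> R.
Proof. by rewrite ler1n. Qed.

Let term t j : R := 2 / j.*2.+1%:R / (expR (j.*2.+1%:R * t) - 1).

Lemma inv_expR_subr1_ge0 x : 0 < x -> 0 <= (expR x - 1)^-1 <= x^-1.
Proof.
move=> x0; have e : x <= expR x - 1 by rewrite lerBrDl expR_ge1Dx.
by rewrite lef_pV2 ?posrE// ?(lt_le_trans x0)// e andbT invr_ge0 (le_trans (ltW x0)).
Qed.

Let term_bound t j : 0 < t -> 0 <= t * term t j <= 2 * (j.*2.+1%:R ^+ 2)^-1.
Proof.
move=> t0; have j1 := odd_ge1 j; have j0 := lt_le_trans ltr01 j1.
have /andP[a b] := inv_expR_subr1_ge0 (mulr_gt0 j0 t0).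
rewrite /term mulr_ge0 ?(ltW t0)//=; last by rewrite mulr_ge0// divr_ge0// ltW.
have -> : 2 / j.*2.+1%:R ^+ 2 = t * (2 / j.*2.+1%:R / (j.*2.+1%:R * t)) :> R.
  by move: (j.*2.+1%:R) j0 => y y0; field; rewrite !gt_eqF.
rewrite ler_pM2l// ler_wpM2l// divr_ge0// ltW.
Qed.

Let term_le t j : 0 < t -> `|term t j| <= 2 / t * (j.*2.+1%:R ^+ 2)^-1.
Proof.
move=> t0; have /andP[a b] := term_bound j t0.
rewrite ger0_norm; last by move: a; rewrite pmulr_rge0.
by rewrite -(ler_pM2l t0) (le_trans b)// mulrA mulrCA mulfV ?mulr1// gt_eqF.
Qed.

Lemma cvg_log_gen_series t : 0 < t -> cvgn (series (term t)).
Proof.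
move=> t0; apply: (cvg_series_dominated (M := fun j => 2 / t * (j.*2.+1%:R ^+ 2)^-1)).
  by move=> j; exact: term_le.
exact/cvg_series_mull/cvg_inv_odd_sqr.
Qed.

Lemma log_factor_ge0 x : 0 < x -> 0 <= log_factor x.
Proof.
move=> /expRN_itv; rewrite /log_factor; set q := expR _ => /andP[q0 q1].
by rewrite ln_ge0// ler_pdivlMr ?subr_gt0// mul1r; lra.
Qed.

Lemma lim_series_sum (n : nat) (u : nat -> R^nat) : (forall k, cvgn (series (u k))) ->
  cvgn (series (fun j => \sum_(0 <= k < n) u k j)) /\
  limn (series (fun j => \sum_(0 <= k < n) u k j)) = \sum_(0 <= k < n) limn (series (u k)).
Proof.
move=> cu; elim: n => [|n [ih1 ih2]].
  have -> : (fun j => \sum_(0 <= k < 0) u k j) = (fun _ => 0).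
    by apply/funext => j; rewrite big_geq.
  have e : series (fun _ : nat => 0 : R) = (fun=> 0).
    by apply/funext => m; rewrite /series /= big1.
  by rewrite e big_geq//; split; [exact: is_cvg_cst|rewrite lim_cst].
have -> : (fun j => \sum_(0 <= k < n.+1) u k j) =
   (fun j => \sum_(0 <= k < n) u k j + u n j).
  by apply/funext => j; rewrite big_nat_recr.
by rewrite big_nat_recr//= -ih2; split; [exact: cvg_series_add|rewrite lim_series_add].
Qed.

(** Expanding each factor gives a double series, geometric in k for fixed j. All terms are
    nonnegative, so the full sums over k dominate the partial ones and Tannery's theorem exchanges
    the summations. *)
Lemma cvg_sum_log_factor t : 0 < t ->
  series (fun k => log_factor (k.+1%:R * t)) @ \oo --> log_gen t.
Proof.
move=> t0.
pose u k j : R := 2 / j.*2.+1%:R * expR (- (j.*2.+1%:R * (k.+1%:R * t))).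
have cu k : series (u k) @ \oo --> log_factor (k.+1%:R * t).
  by apply: cvg_log_factor_series; rewrite mulr_gt0.
have e : series (fun k => log_factor (k.+1%:R * t)) =
    (fun n => limn (series (fun j => \sum_(0 <= k < n) u k j))).
  apply/funext => n; have [|_ ->] := @lim_series_sum n u.
    by move=> k; apply/cvg_ex; eexists; exact: cu.
  by apply: eq_bigr => k _; rewrite (cvg_lim _ (cu k)).
rewrite e.
have geom j : \sum_(0 <= k < n) u k j @[n --> \oo] --> term t j.
  have j0 := lt_le_trans ltr01 (odd_ge1 j).
  have /expRN_itv := mulr_gt0 j0 t0; set q := expR _ => /andP[q0 q1].
  have -> : term t j = 2 / j.*2.+1%:R * q / (1 - q).
    rewrite /term; have -> : expR (j.*2.+1%:R * t) = q^-1 by rewrite /q expRN invrK.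
    have q0' : 0 < q by exact: expR_gt0.
    by field; rewrite !gt_eqF// subr_gt0.
  have -> : (fun n => \sum_(0 <= k < n) u k j) =
     series (geometric (2 / j.*2.+1%:R * q) q).
    apply/funext => n; apply: eq_bigr => k _; rewrite /u /geometric /= -!mulrA; congr (_ * _).
    rewrite -[q * _]exprS /q -expRM_natl; congr (_ * expR _).
    by ring.
  by apply: cvg_geometric_series; rewrite ger0_norm.
have u0 k j : 0 <= u k j by rewrite mulr_ge0 ?expR_ge0// divr_ge0.
have [] := @tannery R nat \oo _ (fun n j => \sum_(0 <= k < n) u k j) (term t) (term t).
- exact: geom.
- near=> n => j; rewrite ger0_norm; last by rewrite sumr_ge0.
  rewrite -(cvg_lim (@Rhausdorff R) (geom j)).
  apply: (@nondecreasing_cvgn_le R (series (fun k => u k j))).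
    by apply: nondecreasing_series => k _ _; exact: u0.
  by apply/cvg_ex; eexists; exact: geom.
- exact: cvg_log_gen_series.
- by move=> _.
Unshelve. all: by end_near. Qed.

Lemma cvg_div_expR_subr1 (a : R) : 0 < a ->
  t / (expR (a * t) - 1) @[t --> 0^'+] --> a^-1.
Proof.
move=> a0.
have h : a^-1 - t @[t --> 0^'+] --> a^-1.
  rewrite -[X in _ --> X]subr0; apply: cvgB; first exact: cvg_cst.
  exact: cvg_at_right_filter.
apply: (squeeze_cvgr _ h (cvg_cst a^-1)); near=> t.
have t0 : 0 < t by near: t; exact: nbhs_right_gt.
have at0 : 0 < a * t by rewrite mulr_gt0.
have at1 : a * t < 1.
  rewrite mulrC -ltr_pdivlMr// div1r.
  by near: t; apply: nbhs_right_lt; rewrite invr_gt0.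
have /andP[_ b] := inv_expR_subr1_ge0 at0.
apply/andP; split; last first.
  have := ler_wpM2l (ltW t0) b; rewrite invfM mulrCA mulfV ?mulr1// gt_eqF//.
have e : expR (a * t) * (1 - a * t) <= 1.
  have := expR_ge1Dx (- (a * t)); rewrite expRN => h1.
  by rewrite mulrC -ler_pdivlMr ?expR_gt0// div1r.
have e0 : 0 < expR (a * t) - 1 by rewrite subr_gt0 expR_gt1.
rewrite ler_pdivlMr//.
have -> : (a^-1 - t) * (expR (a * t) - 1) = (expR (a * t) * (1 - a * t) - 1) / a + t.
  by field; rewrite gt_eqF.
by rewrite gerDr pmulr_lle0 ?invr_gt0// subr_le0.
Unshelve. all: by end_near. Qed.

Lemma cvg_mul_log_gen : t * log_gen t @[t --> 0^'+] --> pi ^+ 2 / 4.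
Proof.
have [] := @tannery R R (0^'+) _ (fun t j => t * term t j)
    (fun j => 2 * (j.*2.+1%:R ^+ 2)^-1) (fun j => 2 * (j.*2.+1%:R ^+ 2)^-1).
- move=> j; have j0 := lt_le_trans ltr01 (odd_ge1 j).
  have -> : 2 / j.*2.+1%:R ^+ 2 = 2 / j.*2.+1%:R * (j.*2.+1%:R)^-1 :> R.
    by rewrite -mulrA -invfM -expr2.
  rewrite /term; under eq_fun do rewrite mulrCA.
  by apply: cvgM; [exact: cvg_cst|exact: cvg_div_expR_subr1].
- near=> t => j; have t0 : 0 < t by near: t; exact: nbhs_right_gt.
  by have /andP[a b] := term_bound j t0; rewrite ger0_norm.
- exact: cvg_series_mull cvg_inv_odd_sqr.
rewrite (lim_series_mull _ cvg_inv_odd_sqr) lim_inv_odd_sqr => _.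
have -> : 2 * (pi ^+ 2 / 8) = pi ^+ 2 / 4 :> R by move: (pi : R) => p; field.
apply: cvg_trans; apply: near_eq_cvg; near=> t.
by rewrite lim_series_mull//; exact: cvg_log_gen_series.
Unshelve. all: by end_near. Qed.

Lemma cvg_log_factor_add_ln : log_factor x + ln x @[x --> 0^'+] --> ln 2.
Proof.
have h1 : 2 - x @[x --> (0:R)^'+] --> (2:R).
  rewrite -[X in _ --> X]subr0; apply: cvgB; first exact: cvg_cst.
  exact: cvg_at_right_filter.
have h2 : 2 + 2 * x @[x --> (0:R)^'+] --> (2:R).
  have h0 : x @[x --> (0:R)^'+] --> (0:R) by exact: cvg_at_right_filter.
  have := cvgD (cvg_cst (2 : R)) (cvgM (cvg_cst (2 : R)) h0).
  by rewrite mulr0 addr0; exact.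
have : (1 + expR (- x)) * (x / (1 - expR (- x))) @[x --> 0^'+] --> (2:R).
  apply: (squeeze_cvgr _ h1 h2); near=> x.
  have x0 : 0 < x by near: x; exact: nbhs_right_gt.
  have x1 : x < 1 by near: x; exact: nbhs_right_lt.
  have /andP[q0 q1] := expRN_itv x0.
  have e1 := expR_ge1Dx (- x).
  have e2 : expR (- x) * (1 + x) <= 1.
    by rewrite expRN mulrC ler_pdivrMr ?expR_gt0// mul1r expR_ge1Dx.
  set q := expR (- x) in q0 q1 e1 e2 *.
  have d : 0 < 1 - q by rewrite subr_gt0.
  rewrite mulrA ler_pdivlMr// ler_pdivrMr//.
  by apply/andP; split; nra.
move=> h.
have : ln ((1 + expR (- x)) * (x / (1 - expR (- x)))) @[x --> 0^'+] --> ln (2 : R).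
  by apply: (@continuous_cvg _ _ _ _ _ _ (@ln R)) h; exact: continuous_ln.
apply: cvg_trans; apply: near_eq_cvg; near=> x.
have x0 : 0 < x by near: x; exact: nbhs_right_gt.
have /andP[q0 q1] := expRN_itv x0.
rewrite /log_factor -lnM ?posrE// ?divr_gt0 ?subr_gt0 ?ltr_pwDl//.
by congr ln; field; rewrite gt_eqF ?subr_gt0.
Unshelve. all: by end_near. Qed.

(** Twice sinh and cosh. In these terms [log_factor (2 x)] is ln (coth x), and the addition theorems
    turn its second differences into a single logarithm. *)
Let sh x : R := expR x - expR (- x).
Let ch x : R := expR x + expR (- x).

Let shD x y : 2 * sh (x + y) = sh x * ch y + ch x * sh y.
Proof. by rewrite /sh /ch opprD !expRD; ring. Qed.

Let sh_gt0 x : 0 < x -> 0 < sh x.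
Proof. by move=> x0; rewrite subr_gt0 ltr_expR gtrN. Qed.

Let ch_ge2 x : 2 <= ch x.
Proof.
rewrite /ch expRN; have e0 := expR_gt0 x; rewrite -subr_ge0.
have -> : expR x + (expR x)^-1 - 2 = (expR x - 1) ^+ 2 / expR x by field; rewrite gt_eqF.
by rewrite divr_ge0 ?sqr_ge0// ltW.
Qed.

Let sh_mul x (n : nat) : 0 < x -> n%:R * sh x <= sh (n%:R * x).
Proof.
move=> x0; elim: n => [|n ih]; first by rewrite !mul0r /sh oppr0 subrr.
rewrite -natr1 !mulrDl !mul1r -(ler_pM2l (ltr0n R 2)) shD.
have s0 := sh_gt0 x0; have c1 := ch_ge2 x; have c2 := ch_ge2 (n%:R * x).
have n0 : 0 <= n%:R * sh x by rewrite mulr_ge0// ltW.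
have sn0 : 0 <= sh (n%:R * x) := le_trans n0 ih.
have h1 : sh (n%:R * x) * 2 <= sh (n%:R * x) * ch x by rewrite ler_wpM2l.
have h2 : 2 * sh x <= ch (n%:R * x) * sh x by rewrite ler_wpM2r// ltW.
lra.
Qed.

Let log_factor_sh x : 0 < x -> log_factor (2 * x) = ln (ch x) - ln (sh x).
Proof.
move=> x0; have c0 : 0 < ch x by rewrite addr_gt0 ?expR_gt0.
have s0 := sh_gt0 x0; rewrite -ln_div ?posrE// /log_factor; congr ln.
have -> : expR (- (2 * x)) = expR (- x) / expR x.
  by rewrite -expRN -expRD; congr expR; ring.
move: s0; rewrite /ch /sh; have := expR_gt0 x; set e := expR x => e0 s0.
by field; rewrite !gt_eqF// subr_gt0 -subr_gt0.
Qed.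

Definition second_diff t (j : nat) : R := log_factor (j.*2.+1%:R * t) -
  2 * log_factor (j.*2.+2%:R * t) + log_factor (j.*2.+3%:R * t).

(* With s = t / 2, b = (2 j + 2) s, the quantity is the logarithm of
   sinh^2 b (cosh^2 b + sinh^2 s) / (cosh^2 b (sinh^2 b - sinh^2 s)). *)
Lemma second_diff_bound t j : 0 < t ->
  0 <= second_diff t j <= 2 * ((j.*2.+1 * j.*2.+3)%:R)^-1.
Proof.
move=> t0; pose u := t / 2; have u0 : 0 < u by rewrite divr_gt0.
have eu k : k * t = 2 * (k * u) by rewrite /u; field.
rewrite /second_diff !eu !log_factor_sh ?mulr_gt0//.
set a := j.*2.+1%:R * u; set b := j.*2.+2%:R * u; set c := j.*2.+3%:R * u.
have ea : a = b - u by rewrite /a /b -[j.*2.+2%:R]natr1; ring.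
have ec : c = b + u by rewrite /c /b -[j.*2.+3%:R]natr1; ring.
have a0 : 0 < a by rewrite mulr_gt0.
have b0 : 0 < b by rewrite mulr_gt0.
have c0 : 0 < c by rewrite mulr_gt0.
have e1 : sh a * sh c = sh b ^+ 2 - sh u ^+ 2.
  by rewrite ea ec /sh opprB opprD !expRD; have := expRxMexpNx_1 b; have := expRxMexpNx_1 u;
   move: (expR b) (expR (- b)) (expR u) (expR (- u)) => p q r s; nra.
have e2 : ch a * ch c = ch b ^+ 2 + sh u ^+ 2.
  by rewrite ea ec /sh /ch opprB opprD !expRD; have := expRxMexpNx_1 b; have := expRxMexpNx_1 u;
   move: (expR b) (expR (- b)) (expR u) (expR (- u)) => p q r s; nra.
have sa := sh_gt0 a0; have sb := sh_gt0 b0; have sc := sh_gt0 c0; have su := sh_gt0 u0.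
have cp x : 0 < ch x by exact: lt_le_trans (ch_ge2 x).
have P0 : 0 < sh a * sh c by rewrite mulr_gt0.
set r := sh u ^+ 2 * (sh b ^+ 2 + ch b ^+ 2) / (sh a * sh c * ch b ^+ 2).
have r0 : 0 <= r.
  by apply: divr_ge0; apply: mulr_ge0; rewrite ?addr_ge0 ?sqr_ge0// ltW.
have -> : ln (ch a) - ln (sh a) - 2 * (ln (ch b) - ln (sh b)) + (ln (ch c) - ln (sh c)) =
   ln (1 + r).
  have -> : 1 + r = (ch a * ch c) * sh b ^+ 2 / (sh a * sh c * ch b ^+ 2).
    rewrite /r e2 e1; move: P0; rewrite e1 => P0.
    by field; rewrite !gt_eqF.
  rewrite ln_div ?posrE ?mulr_gt0 ?exprn_gt0//.
  by rewrite !lnM ?posrE ?mulr_gt0 ?exprn_gt0//; ring.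
rewrite ln_ge0 ?lerDl//=.
apply: le_trans (le_ln1Dx _) _; first by rewrite (lt_le_trans _ r0)// ltrN10.
have hbc : sh b ^+ 2 <= ch b ^+ 2.
  rewrite lerXn2r ?nnegrE ?(ltW sb) ?(ltW (cp b))//.
  by rewrite /sh /ch lerD2l; have := expR_gt0 (- b); lra.
have h1 : r <= 2 * sh u ^+ 2 / (sh a * sh c).
  rewrite /r ler_pdivrMr; last by rewrite mulr_gt0 ?exprn_gt0.
  rewrite mulrA divfK ?gt_eqF//.
  have : 0 <= sh u ^+ 2 * (ch b ^+ 2 - sh b ^+ 2) by rewrite mulr_ge0 ?sqr_ge0 ?subr_ge0.
  lra.
apply: le_trans h1 _; rewrite -mulrA ler_pM2l// ler_pdivrMr// mulrC ler_pdivlMr; last first.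
  by rewrite ltr0n.
(* By [sh_mul], [sh a] and [sh c] are at least 2 j + 1 and 2 j + 3 times [sh u]. This is what makes
   the bound uniform in t. *)
have -> : sh u ^+ 2 * (j.*2.+1 * j.*2.+3)%:R = (j.*2.+1%:R * sh u) * (j.*2.+3%:R * sh u).
  by rewrite natrM; ring.
apply: ler_pM; [by rewrite mulr_ge0// ltW|by rewrite mulr_ge0// ltW| |]; exact: sh_mul.
Qed.

Lemma cvg_mull_at_right0 (c : R) : 0 < c -> c * t @[t --> 0^'+] --> 0^'+.
Proof.
move=> c0 A [e /= e0 hA]; exists (e / c) => /= [|t /= tb t0].
  by rewrite divr_gt0.
apply: hA => /=; last by rewrite mulr_gt0.
rewrite sub0r normrN in tb; rewrite sub0r normrN normrM (gtr0_norm c0).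
by rewrite mulrC -ltr_pdivlMr.
Qed.

Lemma cvg_double_infty : n.*2 @[n --> \oo] --> \oo.
Proof.
move=> A [N _ hN]; exists N => // n /= Nn; apply: hN => /=.
by rewrite -addnn (leq_trans Nn)// leq_addr.
Qed.

Let wallis_term j : R := ln ((j.+1.*2%:R ^+ 2) / (j.*2.+1%:R * j.*2.+3%:R)).

(** As [log_factor x] = ln 2 - ln x + o(1), the second difference cancels both ln 2 and ln t and
    leaves a ratio of integers. *)
Let cvg_second_diff j : second_diff t j @[t --> 0^'+] --> wallis_term j.
Proof.
have h (k : nat) : log_factor (k.+1%:R * t) + ln (k.+1%:R * t) @[t --> 0^'+] --> ln (2 : R).
  apply: (@cvg_comp _ _ _ (fun t => k.+1%:R * t) (fun x => log_factor x + ln x)); last first.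
    exact: cvg_log_factor_add_ln.
  exact: cvg_mull_at_right0.
have : (log_factor (j.*2.+1%:R * t) + ln (j.*2.+1%:R * t)) -
   2 * (log_factor (j.*2.+2%:R * t) + ln (j.*2.+2%:R * t)) +
   (log_factor (j.*2.+3%:R * t) + ln (j.*2.+3%:R * t)) + wallis_term j
   @[t --> 0^'+] --> ln 2 - 2 * ln 2 + ln 2 + wallis_term j.
  apply: cvgD; last exact: cvg_cst.
  apply: cvgD; last exact: h.
  apply: cvgB; first exact: h.
  by apply: cvgM; [exact: cvg_cst|exact: h].
have -> : ln 2 - 2 * ln 2 + ln 2 + wallis_term j = wallis_term j by ring.
apply: cvg_trans; apply: near_eq_cvg; near=> t.
have t0 : 0 < t by near: t; exact: nbhs_right_gt.
rewrite /second_diff /wallis_term doubleS ln_div ?posrE ?mulr_gt0 ?exprn_gt0//.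
by rewrite !lnM ?posrE//; ring.
Unshelve. all: by end_near. Qed.

(** log_gen t - 2 log_gen (2 t) is the alternating sum of the [log_factor (k t)], positive at odd k.
    Splitting each odd term into two halves groups it into half second differences, half of the
    first term being left over. *)
Lemma log_gen_double t : 0 < t -> log_gen t = 2 * log_gen (2 * t) +
  (log_factor t + limn (series (second_diff t))) / 2.
Proof.
move=> t0; have t20 : 0 < 2 * t by rewrite mulr_gt0.
have c1 := cvg_sum_log_factor t0; have c2 := cvg_sum_log_factor t20.
pose u n := series (fun k => log_factor (k.+1%:R * t)) n.*2 -
  2 * series (fun k => log_factor (k.+1%:R * (2 * t))) n.
have cu : u n @[n --> \oo] --> log_gen t - 2 * log_gen (2 * t).
  apply: cvgB; last by apply: cvgM c2; exact: cvg_cst.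
  exact: (cvg_comp _ _ cvg_double_infty c1).
have eu n : u n = (log_factor t + series (second_diff t) n - log_factor (n.*2.+1%:R * t)) / 2.
  elim: n => [|n ih].
    by rewrite /u /series /= !big_geq// mul1r; ring.
  rewrite seriesSr/= /second_diff.
  have -> : u n.+1 = u n + log_factor (n.*2.+1%:R * t) - log_factor (n.*2.+2%:R * t).
    rewrite /u doubleS !seriesSr /=.
    have -> : n.+1%:R * (2 * t) = n.*2.+2%:R * t by rewrite mulrA -natrM muln2.
    by ring.
  by rewrite ih doubleS; field.
have cd : cvgn (series (second_diff t)).
  apply: (cvg_series_dominated (M := fun j => 2 * ((j.*2.+1 * j.*2.+3)%:R)^-1)).
    by move=> j; have /andP[a b] := second_diff_bound j t0; rewrite ger0_norm.
  exact: cvg_series_mull cvg_inv_odd_pairs.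
have c3 : log_factor (n.*2.+1%:R * t) @[n --> \oo] --> 0.
  have : log_factor (k.+1%:R * t) @[k --> \oo] --> 0.
    by apply: cvg_series_cvg_0; apply/cvg_ex; eexists; exact: c1.
  exact: (cvg_comp _ _ cvg_double_infty).
have cu' : u n @[n --> \oo] --> (log_factor t + limn (series (second_diff t)) - 0) / 2.
  under eq_fun do rewrite eu.
  apply: cvgM; last exact: cvg_cst.
  by apply: cvgB => //; apply: cvgD => //; exact: cvg_cst.
have := cvg_unique_real cu cu'; rewrite subr0 => e.
by rewrite -e; ring.
Qed.

(** The constant is forced: subtracting twice the value at 2 t turns ln t / 2 + c into - ln t / 2 -
    ln 2 - c, which has to be ln (pi / t) / 2. *)
Definition log_gen_error t : R :=
  log_gen t - pi ^+ 2 / 4 / t - ln t / 2 + ln (4 * pi) / 2.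

Lemma cvg_log_gen_error_double :
  log_gen_error t - 2 * log_gen_error (2 * t) @[t --> 0^'+] --> 0.
Proof.
have [w cw] := @wallis_lim R.
have [|||_ h] := @tannery R R (0^'+) _ second_diff wallis_term
    (fun j => 2 * ((j.*2.+1 * j.*2.+3)%:R)^-1).
- exact: cvg_second_diff.
- near=> t => j; have t0 : 0 < t by near: t; exact: nbhs_right_gt.
  by have /andP[a b] := second_diff_bound j t0; rewrite ger0_norm.
- exact: cvg_series_mull cvg_inv_odd_pairs.
have : ((log_factor t + ln t) + limn (series (second_diff t))) / 2 - ln pi / 2
   @[t --> 0^'+] --> (ln 2 + ln (pi / 2)) / 2 - ln pi / 2.
  apply: cvgB; last exact: cvg_cst.
  apply: cvgM; last exact: cvg_cst.
  by apply: cvgD; [exact: cvg_log_factor_add_ln|rewrite -w].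
have p0 := @pi_gt0 R.
have e2 : 2 * (pi / 2) = pi :> R by rewrite mulrC divfK.
rewrite -lnM ?posrE ?divr_gt0// e2 subrr.
apply: cvg_trans; apply: near_eq_cvg; near=> t.
have t0 : 0 < t by near: t; exact: nbhs_right_gt.
have ep : pi ^+ 2 / 4 / (2 * t) = pi ^+ 2 / 4 / t / 2.
  by move: (pi : R) => p; field; exact: lt0r_neq0.
rewrite /log_gen_error log_gen_double// ep !lnM ?posrE//.
have -> : ln 4 = 2 * ln 2 :> R.
  have -> : 4 = 2 * 2 :> R by ring.
  by rewrite lnM ?posrE//; ring.
set A := pi ^+ 2 / 4 / t; move: (ln pi) A => a b; field.
Unshelve. all: by end_near. Qed.

(** With s = sqrt t, - ln s is at most 1 / s, so |t ln t| is at most 2 s. *)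
Lemma cvg_mul_ln0 : t * ln t @[t --> (0 : R)^'+] --> (0 : R).
Proof.
have h : - (2 * Num.sqrt t) @[t --> (0 : R)^'+] --> (0 : R).
  have : Num.sqrt t @[t --> (0 : R)^'+] --> Num.sqrt (0 : R).
    apply: cvg_at_right_filter; exact: sqrt_continuous.
  rewrite sqrtr0 => s.
  have := cvgN (cvgM (cvg_cst (2 : R)) s); rewrite mulr0 oppr0; exact.
apply: (squeeze_cvgr _ h (cvg_cst 0)); near=> t.
have t0 : 0 < t by near: t; exact: nbhs_right_gt.
have t1 : t < 1 by near: t; exact: nbhs_right_lt.
set s := Num.sqrt t; have s0 : 0 < s by rewrite sqrtr_gt0.
have e : s ^+ 2 = t by rewrite sqr_sqrtr ?ltW.
have s1 : s <= 1 by rewrite /s -sqrtr1 ler_wsqrtr// ltW.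
have el : ln t = 2 * ln s by rewrite -e lnXn// mulr_natl.
rewrite el -e /=; have := @ln_sublinear R s^-1; rewrite invr_gt0 => /(_ s0).
rewrite lnV ?posrE// => h1; have l0 : ln s <= 0 by rewrite ln_le0.
apply/andP; split; last by rewrite mulr_ge0_le0 ?sqr_ge0// mulr_ge0_le0.
have : s ^+ 2 * (- ln s) <= s ^+ 2 * s^-1 by rewrite ler_wpM2l ?sqr_ge0// ltW.
have -> : s ^+ 2 * s^-1 = s by rewrite expr2 mulfK// gt_eqF.
lra.
Unshelve. all: by end_near. Qed.

Let cvg_mul_log_gen_error : t * log_gen_error t @[t --> 0^'+] --> 0.
Proof.
have c0 : t @[t --> (0:R)^'+] --> (0:R) by exact: cvg_at_right_filter.
have : t * log_gen t - pi ^+ 2 / 4 - (t * ln t) / 2 + t * (ln (4 * pi) / 2)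
    @[t --> 0^'+] --> pi ^+ 2 / 4 - pi ^+ 2 / 4 - 0 / 2 + 0 * (ln (4 * pi) / 2).
  apply: cvgD; last by apply: cvgM => //; exact: cvg_cst.
  apply: cvgB; last by apply: cvgM; [exact: cvg_mul_ln0|exact: cvg_cst].
  by apply: cvgB; [exact: cvg_mul_log_gen|exact: cvg_cst].
rewrite subrr !mul0r subr0 addr0.
apply: cvg_trans; apply: near_eq_cvg; near=> t.
have t0 : 0 < t by near: t; exact: nbhs_right_gt.
rewrite /log_gen_error; move: (pi ^+ 2 / 4) (ln (4 * pi)) => a b.
by field; rewrite (gt_eqF t0).
Unshelve. all: by end_near. Qed.

(* Halving t repeatedly, [t * log_gen_error t --> 0] removes the solutions c / t
   of the homogeneous equation. *)
Lemma cvg_log_gen_error : log_gen_error t @[t --> 0^'+] --> 0.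
Proof.
apply/cvgrPdist_le => e e0; have e20 : 0 < e / 2 by rewrite divr_gt0.
have /cvgrPdist_le/(_ _ e20)[d /= d0 hd] := cvg_log_gen_error_double.
near=> t; have t0 : 0 < t by near: t; exact: nbhs_right_gt.
have td : t < d by near: t; exact: nbhs_right_lt.
have step s : 0 < s -> s < d ->
    `|log_gen_error s| <= (`|log_gen_error (s / 2)| + e / 2) / 2.
  move=> s0 sd; have s20 : 0 < s / 2 by rewrite divr_gt0.
  have sd2 : ball_ Num.norm 0 d (s / 2).
    by rewrite /= sub0r normrN gtr0_norm//; lra.
  have := hd (s / 2) sd2 s20.
  have -> : 2 * (s / 2) = s by rewrite mulrC divfK.
  rewrite sub0r normrN => h.
  have := ler_normB (log_gen_error (s / 2)) (log_gen_error (s / 2) - 2 * log_gen_error s).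
  by rewrite opprB addrCA subrr addr0 normrM ger0_norm//; lra.
(* With x = t / 2^n, the first term is |x [log_gen_error x]| / t and tends to 0 for fixed t; the
   second is a partial geometric sum of the errors and stays below e / 2. *)
have iter n : `|log_gen_error t| <=
    `|log_gen_error (t / 2 ^+ n)| / 2 ^+ n + e / 2 * (1 - (2 ^+ n)^-1).
  elim: n => [|n ih]; first by rewrite expr0 invr1 !mulr1 subrr mulr0 addr0.
  apply: le_trans ih _.
  have p0 : 0 < 2 ^+ n :> R by rewrite exprn_gt0.
  have p1 : 1 <= 2 ^+ n :> R by rewrite exprn_ege1// ler1n.
  have s0 : 0 < t / 2 ^+ n by rewrite divr_gt0.
  have sd : t / 2 ^+ n < d.
    by rewrite ltr_pdivrMr// (lt_le_trans td)// ler_peMr// ltW.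
  have := step _ s0 sd; rewrite exprS.
  have -> : t / 2 ^+ n / 2 = t / (2 * 2 ^+ n) by rewrite invfM; ring.
  have i0 : 0 <= (2 ^+ n)^-1 :> R by rewrite invr_ge0 ltW.
  rewrite invfM => /(ler_wpM2r i0).
  by set a := `|log_gen_error _|; set b := `|log_gen_error _|; nra.
have tn : t / 2 ^+ n @[n --> \oo] --> 0.
  have : t * 2^-1 ^+ n @[n --> \oo] --> t * 0.
    apply: cvgM; first exact: cvg_cst.
    by apply: cvg_expr; rewrite ger0_norm ?invr_ge0// invf_lt1// ltr1n.
  by rewrite mulr0; under eq_fun do rewrite exprVn.
have te0 : 0 < t * (e / 2) by rewrite mulr_gt0.
have /cvgrPdist_le/(_ _ te0)[d' /= d'0 hd'] := cvg_mul_log_gen_error.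
have /cvgrPdist_lt/(_ _ d'0)[N _ hN] := tn.
have := hN N (leqnn N); rewrite /= => tN.
have p0 : 0 < 2 ^+ N :> R by rewrite exprn_gt0.
have s0 : 0 < t / 2 ^+ N by rewrite divr_gt0.
have := hd' _ tN s0; rewrite sub0r normrN normrM gtr0_norm// mulrAC.
rewrite ler_pdivrMr// -!mulrA ler_pM2l// => h.
rewrite sub0r normrN; apply: le_trans (iter N) _.
have : `|log_gen_error (t / 2 ^+ N)| / 2 ^+ N <= e / 2.
  by rewrite ler_pdivrMr// -mulrA.
have : 0 <= e / 2 * (2 ^+ N)^-1 by rewrite mulr_ge0 ?invr_ge0// ltW.
lra.
Unshelve. all: by end_near. Qed.

End LogGenerating.

(** * The generating function on a circle *)

Section GeneratingFunction.
Context {R : realType}.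
Variables (q : R) (q01 : 0 < q < 1).
Implicit Types (theta psi : R) (f : R^nat).

Let q0 : 0 < q. Proof. by case/andP: q01. Qed.
Let q1 : q < 1. Proof. by case/andP: q01. Qed.

Definition shift_seq (m : nat) f : R^nat := fun n => if (m <= n)%N then f (n - m)%N else 0.

Lemma series_shift_seq m f n : series (shift_seq m f) (n + m)%N = series f n.
Proof.
elim: n => [|n ih].
  rewrite add0n /series /= [RHS]big_geq// big_nat big1// => i /andP[_ im].
  by rewrite /shift_seq leqNgt im.
by rewrite addSn !seriesSr ih /shift_seq leq_addl addnK.
Qed.

Lemma cvg_series_shift_seq m f (l : R) : series f @ \oo --> l ->
  series (shift_seq m f) @ \oo --> l.
Proof.
move=> h; rewrite -(cvg_shiftn m).
by under eq_fun do rewrite series_shift_seq.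
Qed.

Let A k n : R := (overp_upto k n)%:R.

Let A_S k n : A k.+1 n = A k n + shift_seq k.+2 (fun n => A k.+1 n + A k n) n.
Proof.
by rewrite /A overp_uptoS natrD /shift_seq; case: ifP => _ //; rewrite natrD.
Qed.

Let qX_gt0 m : 0 < q ^+ m. Proof. exact: exprn_gt0. Qed.
Let qX_lt1 m : q ^+ m.+1 < 1. Proof. by rewrite expr_lt1// ltW. Qed.

(** If B bounds the partial sums for k factors, a partial sum x for k + 1 factors satisfies x <= B +
    q^m (x + B) with m = k + 2, which bounds x because q^m < 1. *)
Lemma cvg_series_overp_upto k : cvgn (series (fun n => A k n * q ^+ n)).
Proof.
apply: nondecreasing_is_cvgn.
  by apply: nondecreasing_series => i _ _; rewrite mulr_ge0 ?ler0n// ltW.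
suff [B hB] : exists B, forall L, series (fun n => A k n * q ^+ n) L <= B.
  by exists B => _ [n _ <-]; exact: hB.
have series_ge0 j L : 0 <= series (fun n => A j n * q ^+ n) L.
  by apply: sumr_ge0 => i _; rewrite mulr_ge0 ?ler0n// ltW.
elim: k => [|k [B hB]].
  exists 1 => L; case: L => [|L]; first by rewrite /series /= big_geq.
  rewrite /series /= big_nat_recl// big1 ?addr0.
    by rewrite /A overp_upto0 expr0 mulr1.
  by move=> i _; rewrite /A overp_upto0 mul0r.
pose m := k.+2; exists ((1 + q ^+ m) * B / (1 - q ^+ m)) => L.
have d : 0 < 1 - q ^+ m by rewrite subr_gt0 qX_lt1.
rewrite ler_pdivlMr//.
pose h n := (A k.+1 n + A k n) * q ^+ n.
have e : series (fun n => A k.+1 n * q ^+ n) L =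
   series (fun n => A k n * q ^+ n) L + q ^+ m * series (shift_seq m h) L.
  rewrite /series /= mulr_sumr -big_split /=; apply: eq_bigr => n _.
  rewrite A_S mulrDl; congr (_ + _); rewrite /shift_seq /h /m.
  case: ifP => mn; last by rewrite mul0r mulr0.
  by rewrite mulrCA -exprD subnKC.
have : series (shift_seq m h) L <= series h L.
  have h0 n : 0 <= h n by rewrite mulr_ge0 ?addr_ge0 ?ler0n// ltW.
  rewrite -(series_shift_seq m h L); apply: nondecreasing_series; last exact: leq_addr.
  by move=> i _ _; rewrite /shift_seq; case: ifP.
have -> : series h L = series (fun n => A k.+1 n * q ^+ n) L + series (fun n => A k n * q ^+ n) L.
  by rewrite /series /= -big_split /=; apply: eq_bigr => n _; rewrite /h mulrDl.
have := hB L; move: e.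
have := series_ge0 k.+1 L; have := series_ge0 k L; have := qX_gt0 m.
move: (series _ L) (series _ L) (series _ L) (q ^+ m) d => x y z p d p0 x0 z0 e xB yz.
nra.
Qed.

(** The terms of the real part of exp (i psi) times the truncated product at q exp (i theta).
    Keeping psi free lets a multiplication by exp (i m theta) act as a shift of psi. *)
Let wave k theta psi : R^nat := fun n => A k n * q ^+ n * cos (n%:R * theta + psi).

Let wave_le k theta psi n : `|wave k theta psi n| <= A k n * q ^+ n.
Proof.
have a0 : 0 <= A k n * q ^+ n by rewrite mulr_ge0 ?ler0n// ltW.
by rewrite /wave normrM (ger0_norm a0) ler_piMr ?cos_max.
Qed.

Let cvg_wave k theta psi : cvgn (series (wave k theta psi)).
Proof.
exact: (cvg_series_dominated (wave_le k theta psi) (@cvg_series_overp_upto k)).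
Qed.

Let C k theta psi : R := limn (series (wave k theta psi)).

Let C_S k theta psi : C k.+1 theta psi = C k theta psi +
  q ^+ k.+2 * (C k.+1 theta (psi + k.+2%:R * theta) + C k theta (psi + k.+2%:R * theta)).
Proof.
pose psi' := psi + k.+2%:R * theta.
have e : wave k.+1 theta psi = fun n => wave k theta psi n +
   shift_seq k.+2 (fun n => q ^+ k.+2 * (wave k.+1 theta psi' n + wave k theta psi' n)) n.
  apply/funext => n; rewrite /wave A_S !mulrDl; congr (_ + _); rewrite /shift_seq.
  case: ifP => kn; last by rewrite !mul0r.
  have en : n%:R * theta + psi = (n - k.+2)%:R * theta + psi'.
    by rewrite /psi' natrB//; ring.
  have eq : q ^+ n = q ^+ k.+2 * q ^+ (n - k.+2) by rewrite -exprD subnKC.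
  by rewrite en eq; ring.
rewrite {1}/C e lim_series_add; first last.
- apply/cvg_ex; eexists; apply: cvg_series_shift_seq.
  by apply: cvg_series_mull; apply: cvg_series_add; exact: cvg_wave.
- exact: cvg_wave.
congr (_ + _); apply: cvg_lim => //; apply: cvg_series_shift_seq.
have c2 : cvgn (series (fun n => wave k.+1 theta psi' n + wave k theta psi' n)).
  by apply: cvg_series_add; exact: cvg_wave.
rewrite /C -/psi' -lim_series_add; [|exact: cvg_wave|exact: cvg_wave].
rewrite -(lim_series_mull _ c2); exact: cvg_series_mull c2.
Qed.

Definition upto_log_re k theta : R :=
  \sum_(0 <= i < k) odd_log_re (i.+2%:R * theta) (q ^+ i.+2).
Definition upto_log_im k theta : R :=
  \sum_(0 <= i < k) odd_log_im (i.+2%:R * theta) (q ^+ i.+2).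

Let upto_log_reS k theta : upto_log_re k.+1 theta =
  upto_log_re k theta + odd_log_re (k.+2%:R * theta) (q ^+ k.+2).
Proof. by rewrite /upto_log_re big_nat_recr. Qed.

Let upto_log_imS k theta : upto_log_im k.+1 theta =
  upto_log_im k theta + odd_log_im (k.+2%:R * theta) (q ^+ k.+2).
Proof. by rewrite /upto_log_im big_nat_recr. Qed.

(** The quotient w = (1 + z) / (1 - z) satisfies w = 1 + z (w + 1). This is the real part of that
    equation times exp (i x), at z = r exp (i phi). *)
Let wave_factor (phi r x : R) : 0 <= r < 1 ->
  expR (odd_log_re phi r) * cos (x + odd_log_im phi r) =
  cos x + r * (expR (odd_log_re phi r) * cos (x + phi + odd_log_im phi r) + cos (x + phi)).
Proof.
move=> /(expR_odd_log phi) /=; set D := 1 - _ + _; set P := expR _; set a := odd_log_im _ _.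
move=> [D0 ec es]; rewrite -addrA [phi + a]addrC addrA.
rewrite !(cosD, sinD).
have e2 := sin2cos2 phi; rewrite expr2 in e2.
suff eC : P * cos a - r * (P * cos a * cos phi - P * sin a * sin phi) = 1 + r * cos phi /\
    P * sin a - r * (P * sin a * cos phi + P * cos a * sin phi) = r * sin phi.
  case: eC => /eqP; rewrite -subr_eq0 => /eqP c1 /eqP; rewrite -subr_eq0 => /eqP c2.
  apply/eqP; rewrite -subr_eq0; apply/eqP.
  rewrite -[RHS](subrr 0) -{1}(mulr0 (cos x)) -{1}c1 -(mulr0 (sin x)) -c2.
  by ring.
rewrite ec es; split.
  transitivity ((1 - r ^+ 2 - r * ((1 - r ^+ 2) * cos phi - 2 * r * (sin phi * sin phi))) / D).
    by field; rewrite gt_eqF.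
  by rewrite e2 /D; rewrite /D in D0; field; rewrite gt_eqF.
by rewrite /D; rewrite /D in D0; field; rewrite gt_eqF.
Qed.

(** For each new factor both sides obey the same recursion, so their difference satisfies D x = q^m
    D (x + m theta). Being bounded in the phase, D vanishes on iteration. *)
Lemma cvg_series_overp_upto_cos k theta psi :
  series (fun n => A k n * q ^+ n * cos (n%:R * theta + psi)) @ \oo -->
  expR (upto_log_re k theta) * cos (psi + upto_log_im k theta).
Proof.
suff <- : C k theta psi = expR (upto_log_re k theta) * cos (psi + upto_log_im k theta).
  exact: cvg_wave.
elim: k psi => [|k ih] psi.
  rewrite /upto_log_re /upto_log_im !big_geq// expR0 addr0 mul1r.
  apply: cvg_lim => //.
  have -> : cos psi = series (wave 0 theta psi) 1%N.
    by rewrite /series /= big_nat1 /wave /A overp_upto0 ?expr0 !mul1r mul0r add0r.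
  apply: cvg_series_finite_support => -[|j] // _.
  by rewrite /wave /A overp_upto0 !mul0r.
pose m := k.+2; have m01 : 0 <= q ^+ m < 1 by rewrite ltW ?qX_lt1.
pose D psi := C k.+1 theta psi - expR (upto_log_re k.+1 theta) * cos (psi + upto_log_im k.+1 theta).
have DS x : D x = q ^+ m * D (x + m%:R * theta).
  rewrite /D C_S !ih upto_log_reS upto_log_imS expRD -/m.
  set P := expR (upto_log_re k theta); set a := upto_log_im k theta.
  have := wave_factor (m%:R * theta) (x + a) m01; move: (q ^+ m) => r.
  set P' := expR _; set b := odd_log_im _ _ => e.
  rewrite !addrA; move: (C _ _ _) => c.
  have -> : x + m%:R * theta + a = x + a + m%:R * theta by ring.
  rewrite -[P * P' * cos (x + a + b)]mulrA e.
  by ring.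
have [B hB] : exists B, forall x, `|D x| <= B.
  exists (limn (series (fun n => A k.+1 n * q ^+ n)) + expR (upto_log_re k.+1 theta)) => x.
  apply: le_trans (ler_normB _ _) _; apply: lerD.
    exact: (norm_lim_series_le (wave_le _ _ _) (@cvg_series_overp_upto _)).
  by rewrite normrM ger0_norm ?expR_ge0// ler_piMr ?expR_ge0// cos_max.
have Dn n : `|D psi| <= (q ^+ m) ^+ n * B.
  elim: n psi => [|n ihn] x; first by rewrite expr0 mul1r.
  rewrite DS normrM ger0_norm; last by case/andP: m01.
  by rewrite exprS -mulrA ler_pM2l ?qX_gt0.
apply/eqP; rewrite -subr_eq0 -/(D psi) -normr_le0.
have h : (q ^+ m) ^+ n * B @[n --> \oo] --> 0 * B.
  apply: cvgM; last exact: cvg_cst.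
  by apply: cvg_expr; rewrite ger0_norm; case/andP: m01.
rewrite mul0r in h; apply: (cvgr_to_ge h); near=> n; exact: Dn.
Unshelve. all: by end_near. Qed.

End GeneratingFunction.

(** * Comparison with the values on the real axis *)

Section OddSum.
Context {R : realType}.
Implicit Types (f g h : R^nat) (t s u theta : R) (k : nat).

(* Sum of f over the products N = (i + 2) (2 j + 1) with i < k, weighted as in
   log ((1 + z) / (1 - z)) = sum_j 2 z^(2 j + 1) / (2 j + 1). *)
Let tm f (i : nat) : R^nat := fun j => 2 / j.*2.+1%:R * f (i.+2 * j.*2.+1)%N.
Let T k f : R := \sum_(0 <= i < k) limn (series (tm f i)).
Let summ f := forall i, cvgn (series (tm f i)).

Let wt_ge0 (j : nat) : 0 <= 2 / j.*2.+1%:R :> R. Proof. by rewrite divr_ge0. Qed.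

Let tm_le f h i : (forall N, `|f N| <= h N) -> forall j, `|tm f i j| <= tm h i j.
Proof. by move=> fh j; rewrite /tm normrM ger0_norm ?wt_ge0// ler_wpM2l. Qed.

Let summ_le f h : (forall N, `|f N| <= h N) -> summ h -> summ f.
Proof. by move=> fh sh i; apply: cvg_series_dominated (tm_le i fh) (sh i). Qed.

Let T_le k f h : (forall N, `|f N| <= h N) -> summ h -> `|T k f| <= T k h.
Proof.
move=> fh sh; apply: le_trans (ler_norm_sum _ _ _) _; apply: ler_sum => i _.
exact: norm_lim_series_le (tm_le i fh) (sh i).
Qed.

Let tm_lin (a : R) f g i : tm (fun N => a * f N + g N) i = fun j => a * tm f i j + tm g i j.
Proof. by apply/funext => j; rewrite /tm; ring. Qed.

Let summ_lin (a : R) f g : summ f -> summ g -> summ (fun N => a * f N + g N).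
Proof.
move=> sf sg i; rewrite tm_lin; apply: cvg_series_add => //; exact: cvg_series_mull.
Qed.

Let T_lin k (a : R) f g : summ f -> summ g -> T k (fun N => a * f N + g N) = a * T k f + T k g.
Proof.
move=> sf sg; rewrite /T mulr_sumr -big_split /=; apply: eq_bigr => i _.
rewrite tm_lin lim_series_add//; last exact: cvg_series_mull.
by rewrite lim_series_mull.
Qed.

Let tm_scale (a : R) f i : tm (fun N => a * f N) i = fun j => a * tm f i j.
Proof. by apply/funext => j; rewrite /tm mulrCA. Qed.

Let summ_scale (a : R) f : summ f -> summ (fun N => a * f N).
Proof. by move=> sf i; rewrite tm_scale; exact: cvg_series_mull. Qed.

Let T_scale k (a : R) f : summ f -> T k (fun N => a * f N) = a * T k f.
Proof.
move=> sf; rewrite /T mulr_sumr; apply: eq_bigr => i _.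
by rewrite tm_scale lim_series_mull.
Qed.

Definition upto_log_gen k t : R := \sum_(0 <= i < k) log_factor (i.+2%:R * t).

Let ex t : R^nat := fun N => expR (- (N%:R * t)).

Let cvg_tm_ex t i : 0 < t -> series (tm (ex t) i) @ \oo --> log_factor (i.+2%:R * t).
Proof.
move=> t0; have := @cvg_log_factor_series R (i.+2%:R * t) _.
rewrite mulr_gt0// => /(_ isT).
have -> // : (fun j : nat => 2 / j.*2.+1%:R * expR (- (j.*2.+1%:R * (i.+2%:R * t))) : R) =
  tm (ex t) i.
by apply/funext => j; rewrite /tm /ex natrM; congr (_ * expR _); ring.
Qed.

Let summ_ex t : 0 < t -> summ (ex t).
Proof. by move=> t0 i; apply/cvg_ex; eexists; exact: cvg_tm_ex. Qed.

Let T_ex k t : 0 < t -> T k (ex t) = upto_log_gen k t.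
Proof. by move=> t0; apply: eq_bigr => i _; apply: cvg_lim => //; exact: cvg_tm_ex. Qed.

Let exc t theta : R^nat := fun N => expR (- (N%:R * t)) * cos (N%:R * theta).
Let exs t theta : R^nat := fun N => expR (- (N%:R * t)) * sin (N%:R * theta).

Let summ_exc t theta : 0 < t -> summ (exc t theta).
Proof.
move=> t0; apply: summ_le (summ_ex t0) => N.
by rewrite /exc normrM ger0_norm ?expR_ge0// ler_piMr ?expR_ge0// cos_max.
Qed.

Let summ_exs t theta : 0 < t -> summ (exs t theta).
Proof.
move=> t0; apply: summ_le (summ_ex t0) => N.
by rewrite /exs normrM ger0_norm ?expR_ge0// ler_piMr ?expR_ge0// sin_max.
Qed.

Let expRX_itv t i : 0 < t -> 0 <= expR (- t) ^+ i.+1 < 1.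
Proof.
move=> /expRN_itv /andP[q0 q1]; rewrite exprn_ge0//=.
by rewrite expr_lt1.
Qed.

Let T_exc k t theta : 0 < t -> T k (exc t theta) = upto_log_re (expR (- t)) k theta.
Proof.
move=> t0; apply: eq_bigr => i _; apply: cvg_lim => //.
have := @cvg_odd_log_re R (i.+2%:R * theta) _ (expRX_itv i.+1 t0).
have -> // : (fun j : nat => 2 / j.*2.+1%:R * (expR (- t) ^+ i.+2) ^+ j.*2.+1 *
   cos (j.*2.+1%:R * (i.+2%:R * theta))) = tm (exc t theta) i.
apply/funext => j; rewrite /tm /exc -exprM -expRM_natl mulrN -mulrA.
by congr (_ * (_ * cos _)); rewrite natrM; ring.
Qed.

Let T_exs k t theta : 0 < t -> T k (exs t theta) = upto_log_im (expR (- t)) k theta.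
Proof.
move=> t0; apply: eq_bigr => i _; apply: cvg_lim => //.
have := @cvg_odd_log_im R (i.+2%:R * theta) _ (expRX_itv i.+1 t0).
have -> // : (fun j : nat => 2 / j.*2.+1%:R * (expR (- t) ^+ i.+2) ^+ j.*2.+1 *
   sin (j.*2.+1%:R * (i.+2%:R * theta))) = tm (exs t theta) i.
apply/funext => j; rewrite /tm /exs -exprM -expRM_natl mulrN -mulrA.
by congr (_ * (_ * sin _)); rewrite natrM; ring.
Qed.

(* Powers of N s are absorbed by exp (N t / 4). *)
Let pow_exp_le (m N : nat) t s : 0 < t -> 0 <= s -> s <= t / 4 ->
  expR (- (N%:R * t)) * ((N%:R * s) ^+ m.+1 * expR (N%:R * s)) <=
  m.+1`!%:R * (4 * s / t) ^+ m.+1 * expR (- (N%:R * (t / 2))).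
Proof.
move=> t0 s0 st; have N0 : 0 <= N%:R :> R by [].
pose x := N%:R * (t / 4); have x0 : 0 <= x by rewrite mulr_ge0// divr_ge0// ltW.
have -> : (N%:R * s) ^+ m.+1 = (4 * s / t) ^+ m.+1 * x ^+ m.+1.
  by rewrite -exprMn; congr (_ ^+ _); rewrite /x; field; rewrite gt_eqF.
have p0 : 0 <= (4 * s / t) ^+ m.+1 by rewrite exprn_ge0// divr_ge0 ?mulr_ge0// ltW.
have f0 : 0 < m.+1`!%:R :> R by rewrite ltr0n fact_gt0.
have h1 : x ^+ m.+1 <= m.+1`!%:R * expR x.
  rewrite mulrC -ler_pdivrMr//; apply: le_trans (expR_ge1Dxn m x0).
  by rewrite lerDr.
have h2 : expR (N%:R * s) <= expR x by rewrite ler_expR ler_wpM2l.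
have e0 := expR_gt0 (- (N%:R * t)).
have -> : expR (- (N%:R * (t / 2))) = expR (- (N%:R * t)) * (expR x * expR x).
  by rewrite -!expRD /x; congr expR; field.
apply: le_trans (_ : expR (- (N%:R * t)) * ((4 * s / t) ^+ m.+1 * (m.+1`!%:R * expR x) * expR x) <= _).
  rewrite ler_wpM2l ?expR_ge0//; apply: ler_pM.
  - by apply: mulr_ge0 => //; exact: exprn_ge0.
  - exact: expR_ge0.
  - by rewrite ler_wpM2l.
  - exact: h2.
by rewrite le_eqVlt; apply/orP; left; apply/eqP; ring.
Qed.

Let T_lin3 k (a b d : R) f1 f2 f3 f4 : summ f1 -> summ f2 -> summ f3 -> summ f4 ->
  T k (fun N => a * f1 N + (b * f2 N + (d * f3 N + f4 N))) =
  a * T k f1 + (b * T k f2 + (d * T k f3 + T k f4)).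
Proof.
move=> s1 s2 s3 s4; rewrite T_lin//; last by apply: summ_lin => //; exact: summ_lin.
by rewrite T_lin//; [rewrite T_lin|exact: summ_lin].
Qed.

(** Termwise, the values at t - s and t + s average to exp (- N t) cosh (N s), so [cos_cosh_taylor]
    applies with y = N s. The growth (N s)^4 exp (N s) is paid for by passing from t to t / 2; 24 is
    4!. *)
Lemma upto_log_re_taylor k t s u : 0 < t -> 0 <= s -> s <= t / 4 -> 0 <= u ->
  `|upto_log_re (expR (- t)) k (s * u) - upto_log_gen k t + u ^+ 2 *
     ((upto_log_gen k (t - s) + upto_log_gen k (t + s)) / 2 - upto_log_gen k t)|
  <= (u ^+ 4 + u ^+ 2) * 24 * (4 * s / t) ^+ 4 * upto_log_gen k (t / 2).
Proof.
move=> t0 s0 st u0.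
have t1 : 0 < t - s by lra. have t2 : 0 < t + s by lra. have t3 : 0 < t / 2 by lra.
rewrite -T_exc// -!T_ex//.
pose C := (u ^+ 4 + u ^+ 2) * 24 * (4 * s / t) ^+ 4.
pose F N := u ^+ 2 / 2 * ex (t - s) N + (u ^+ 2 / 2 * ex (t + s) N +
  (- (1 + u ^+ 2) * ex t N + exc t (s * u) N)).
have -> : T k (exc t (s * u)) - T k (ex t) +
    u ^+ 2 * ((T k (ex (t - s)) + T k (ex (t + s))) / 2 - T k (ex t)) = T k F.
  rewrite T_lin3; [|exact: summ_ex|exact: summ_ex|exact: summ_ex|exact: summ_exc].
  by field.
rewrite -/C -T_scale; last exact: summ_ex.
apply: T_le => [N|]; last by apply: summ_scale; exact: summ_ex.
have y0 : 0 <= N%:R * s by rewrite mulr_ge0.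
have -> : F N = ex t N * (cos (u * (N%:R * s)) - 1 + u ^+ 2 * ((expR (N%:R * s) +
    expR (- (N%:R * s))) / 2 - 1)).
  rewrite /F /ex /exc.
  have -> : expR (- (N%:R * (t - s))) = expR (- (N%:R * t)) * expR (N%:R * s).
    by rewrite -expRD; congr expR; ring.
  have -> : expR (- (N%:R * (t + s))) = expR (- (N%:R * t)) * expR (- (N%:R * s)).
    by rewrite -expRD; congr expR; ring.
  have -> : N%:R * (s * u) = u * (N%:R * s) by ring.
  by field.
rewrite normrM ger0_norm ?expR_ge0//.
apply: le_trans (ler_wpM2l (expR_ge0 _) (cos_cosh_taylor u0 y0)) _.
rewrite mulrCA; have u2 : 0 <= u ^+ 4 + u ^+ 2 by rewrite addr_ge0 ?exprn_ge0.
apply: le_trans (ler_wpM2l u2 (pow_exp_le 3 N t0 s0 st)) _.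
have -> : 4`! = 24%N by [].
by rewrite /C /ex !mulrA.
Qed.

Lemma upto_log_im_taylor k t s u : 0 < t -> 0 <= s -> s <= t / 4 -> 0 <= u ->
  `|upto_log_im (expR (- t)) k (s * u) - u *
     ((upto_log_gen k (t - s) - upto_log_gen k (t + s)) / 2)|
  <= (u ^+ 3 + u) * 6 * (4 * s / t) ^+ 3 * upto_log_gen k (t / 2).
Proof.
move=> t0 s0 st u0.
have t1 : 0 < t - s by lra. have t2 : 0 < t + s by lra. have t3 : 0 < t / 2 by lra.
rewrite -T_exs// -!T_ex//.
pose C := (u ^+ 3 + u) * 6 * (4 * s / t) ^+ 3.
pose F N := - (u / 2) * ex (t - s) N + (u / 2 * ex (t + s) N +
  (0 * ex t N + exs t (s * u) N)).
have -> : T k (exs t (s * u)) - u * ((T k (ex (t - s)) - T k (ex (t + s))) / 2) = T k F.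
  rewrite T_lin3; [|exact: summ_ex|exact: summ_ex|exact: summ_ex|exact: summ_exs].
  by field.
rewrite -/C -T_scale; last exact: summ_ex.
apply: T_le => [N|]; last by apply: summ_scale; exact: summ_ex.
have y0 : 0 <= N%:R * s by rewrite mulr_ge0.
have -> : F N = ex t N * (sin (u * (N%:R * s)) - u * ((expR (N%:R * s) -
    expR (- (N%:R * s))) / 2)).
  rewrite /F /ex /exs.
  have -> : expR (- (N%:R * (t - s))) = expR (- (N%:R * t)) * expR (N%:R * s).
    by rewrite -expRD; congr expR; ring.
  have -> : expR (- (N%:R * (t + s))) = expR (- (N%:R * t)) * expR (- (N%:R * s)).
    by rewrite -expRD; congr expR; ring.
  have -> : N%:R * (s * u) = u * (N%:R * s) by ring.
  by field.
rewrite normrM ger0_norm ?expR_ge0//.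
apply: le_trans (ler_wpM2l (expR_ge0 _) (sin_sinh_taylor u0 y0)) _.
rewrite mulrCA; have u2 : 0 <= u ^+ 3 + u by rewrite addr_ge0 ?exprn_ge0.
apply: le_trans (ler_wpM2l u2 (pow_exp_le 2 N t0 s0 st)) _.
have -> : 3`! = 6%N by [].
by rewrite /C /ex !mulrA.
Qed.

(* Keeping only the terms j = 0 of the series. *)
Lemma upto_log_re_le k t theta : 0 < t ->
  upto_log_re (expR (- t)) k theta - upto_log_gen k t <=
  - 2 * \sum_(0 <= i < k) expR (- t) ^+ i.+2 * (1 - cos (i.+2%:R * theta)).
Proof.
move=> t0; rewrite -T_exc// -T_ex// /T -sumrB mulr_sumr; apply: ler_sum => i _.
pose v := fun j => tm (exc t theta) i j + -1 * tm (ex t) i j.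
have sc : cvgn (series (tm (exc t theta) i)) by exact: summ_exc.
have se : cvgn (series (tm (ex t) i)) by exact: summ_ex.
have se' : cvgn (series (fun j => -1 * tm (ex t) i j)) by exact: cvg_series_mull.
have sv : cvgn (series v) by exact: cvg_series_add.
have -> : limn (series (tm (exc t theta) i)) - limn (series (tm (ex t) i)) = limn (series v).
  by rewrite lim_series_add// lim_series_mull// mulN1r.
have v0 j : v j <= 0.
  by rewrite /v mulN1r subr_le0 /tm ler_wpM2l ?wt_ge0// /exc /ex ler_piMr ?expR_ge0 ?cos_le1.
apply: le_trans (_ : series v 1%N <= _).
  apply: (@nonincreasing_cvgn_ge R (series v)) => // m n mn.
  by rewrite -subr_le0 sub_series mn; apply: sumr_le0 => j _; exact: v0.
rewrite /series /= big_nat1 /v /tm /exc /ex /= divr1 muln1 -expRM_natl mulrN.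
by rewrite le_eqVlt; apply/orP; left; apply/eqP; ring.
Qed.

End OddSum.

(** * Domination away from the real axis *)

Section Domination.
Context {R : realType}.
Implicit Types (q t s u v theta : R).

Lemma sum_geometric_cos q theta (M : nat) :
  (1 - 2 * q * cos theta + q ^+ 2) * (\sum_(0 <= N < M) q ^+ N * cos (N%:R * theta)) =
  1 - q * cos theta - q ^+ M * cos (M%:R * theta) + q ^+ M.+1 * cos ((M%:R - 1) * theta).
Proof.
elim: M => [|M ih].
  rewrite big_geq// mulr0 mul0r cos0 expr0 expr1 sub0r mulN1r cosN; ring.
rewrite big_nat_recr//= mulrDr ih -(natr1 M) addrK.
have e : cos ((M%:R + 1) * theta) = 2 * cos theta * cos (M%:R * theta) - cos ((M%:R - 1) * theta).
  by rewrite mulrDl mulrBl mul1r cosD cosB; ring.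
by rewrite e !exprS; ring.
Qed.

(** The first fraction is the sum of the whole series, 1 / (1 - q) minus the real part of 1 / (1 - q
    exp (i theta)). Cutting at M leaves three boundary terms, each at most q^M / (1 - q)^2. *)
Lemma sum_geometric_oneB_cos_ge q theta (M : nat) : 0 < q < 1 ->
  q * (1 + q) * (1 - cos theta) / ((1 - q) * ((1 - q) ^+ 2 + 2 * q * (1 - cos theta)))
    - 3 * q ^+ M / (1 - q) ^+ 2 <=
  \sum_(0 <= N < M) q ^+ N * (1 - cos (N%:R * theta)).
Proof.
move=> /andP[q0 q1]; have w0 : 0 < 1 - q by rewrite subr_gt0.
have c1 : cos theta <= 1 := cos_le1 theta.
pose D := (1 - q) ^+ 2 + 2 * q * (1 - cos theta).
have wD : (1 - q) ^+ 2 <= D by rewrite lerDl !mulr_ge0 ?subr_ge0 ?(ltW q0).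
have D0 : 0 < D by apply: lt_le_trans wD; rewrite exprn_gt0.
have eD : D = 1 - 2 * q * cos theta + q ^+ 2 by rewrite /D; ring.
have e1 : \sum_(0 <= N < M) q ^+ N * cos (N%:R * theta) =
   (1 - q * cos theta - q ^+ M * cos (M%:R * theta) + q ^+ M.+1 * cos ((M%:R - 1) * theta)) / D.
  by rewrite -sum_geometric_cos -eD mulrC mulKf// gt_eqF.
have e2 : \sum_(0 <= N < M) q ^+ N = (1 - q ^+ M) / (1 - q).
  apply: (canRL (mulfK _)); first by rewrite gt_eqF.
  elim: M {e1} => [|M ih]; first by rewrite big_geq// mul0r expr0 subrr.
  by rewrite big_nat_recr//= mulrDl ih exprS; ring.
have -> : \sum_(0 <= N < M) q ^+ N * (1 - cos (N%:R * theta)) =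
   \sum_(0 <= N < M) q ^+ N - \sum_(0 <= N < M) q ^+ N * cos (N%:R * theta).
  by rewrite -sumrB; apply: eq_bigr => N _; rewrite mulrBr mulr1.
rewrite e1 e2 -/D.
have -> : q * (1 + q) * (1 - cos theta) / ((1 - q) * D) = (1 - q)^-1 - (1 - q * cos theta) / D.
  by rewrite eD in D0 *; field; rewrite !gt_eqF.
have p0 : 0 < q ^+ M by rewrite exprn_gt0.
have i1 : D^-1 <= ((1 - q) ^+ 2)^-1 by rewrite lef_pV2 ?posrE ?exprn_gt0.
have i2 : (1 - q)^-1 <= ((1 - q) ^+ 2)^-1.
  by rewrite lef_pV2 ?posrE ?exprn_gt0//; nra.
have i0 : 0 < D^-1 by rewrite invr_gt0.
have cM := cos_le1 (M%:R * theta); have cM' := cos_geN1 (M%:R * theta).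
have cN := cos_le1 ((M%:R - 1) * theta); have cN' := cos_geN1 ((M%:R - 1) * theta).
have h1 : q ^+ M * (1 - q)^-1 <= q ^+ M * ((1 - q) ^+ 2)^-1 by rewrite ler_wpM2l// ltW.
have h2 : q ^+ M * D^-1 <= q ^+ M * ((1 - q) ^+ 2)^-1 by rewrite ler_wpM2l// ltW.
have pD : 0 < q ^+ M * D^-1 by rewrite mulr_gt0.
have h3 : - (q ^+ M * D^-1) <= q ^+ M * D^-1 * cos (M%:R * theta).
  by rewrite -mulrN1 ler_wpM2l// ltW.
have h4 : q * (q ^+ M * D^-1) * cos ((M%:R - 1) * theta) <= q ^+ M * D^-1.
  apply: le_trans (_ : q * (q ^+ M * D^-1) <= _).
    by rewrite ler_piMr// mulr_ge0// ltW.
  by rewrite ler_piMl// ltW.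
rewrite (exprS q M); move: h1 h2 h3 h4.
move: (D^-1) ((1 - q)^-1) (((1 - q) ^+ 2)^-1) (q ^+ M) (cos _) (cos (_ * _)) (cos (_ * _)).
move=> I V W P c cM1 cN1; lra.
Qed.

(** The condition on v t^3 makes v t = O(v^(2/3)), so for large v the exponent E is at least of
    order v^(1/3). The cubic term of the exponential series then gives growth of order v, enough for
    integrability in u when v is a multiple of u^2. *)
Lemma expRN_le_inv v t : 0 <= v -> 0 < t -> v * t ^+ 3 <= 2 ->
  expR (- (3 / 2 * v / (1 + 2 * v * t))) <= 16 * 32 / (1 + v).
Proof.
move=> v0 t0 vt; have d1 : 0 < 1 + 2 * v * t by rewrite ltr_pwDl// !mulr_ge0// ltW.
set E := 3 / 2 * v / _; have E0 : 0 <= E by rewrite divr_ge0 ?mulr_ge0// ltW.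
have v1 : 0 < 1 + v by rewrite ltr_pwDl.
rewrite ler_pdivlMr// expRN mulrC ler_pdivrMr ?expR_gt0//.
have h := expR_ge1Dxn 2 E0; rewrite -[3`!%:R]/(6 : R) in h.
have C0 : 0 <= 16 * 32 :> R by rewrite mulr_ge0.
apply: le_trans (ler_wpM2l C0 h).
have [v1'|v1'] := leP v 1.
  have : 0 <= E ^+ 3 / 6 by rewrite divr_ge0// exprn_ge0.
  lra.
have x0 : 0 <= 2 * v * t by rewrite !mulr_ge0// ltW.
have c1 : (1 + 2 * v * t) ^+ 3 <= 4 * (1 + (2 * v * t) ^+ 3).
  rewrite -subr_ge0; set x := 2 * v * t in x0 *.
  have -> : 4 * (1 + x ^+ 3) - (1 + x) ^+ 3 = 3 * ((1 - x) ^+ 2 * (1 + x)) by ring.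
  by rewrite mulr_ge0// mulr_ge0 ?sqr_ge0// addr_ge0.
have c2 : (2 * v * t) ^+ 3 <= 16 * v ^+ 2.
  have -> : (2 * v * t) ^+ 3 = 8 * v ^+ 2 * (v * t ^+ 3) by ring.
  have : 8 * v ^+ 2 * (v * t ^+ 3) <= 8 * v ^+ 2 * 2 by rewrite ler_wpM2l// mulr_ge0// sqr_ge0.
  by lra.
have c3 : (1 + 2 * v * t) ^+ 3 <= 68 * v ^+ 2.
  have : 1 <= v ^+ 2 by rewrite exprn_ege1// ltW.
  by lra.
have c4 : 27 / 8 * v ^+ 3 / (68 * v ^+ 2) <= E ^+ 3.
  have -> : E ^+ 3 = 27 / 8 * v ^+ 3 / (1 + 2 * v * t) ^+ 3.
    by rewrite /E; field; rewrite gt_eqF.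
  rewrite ler_wpM2l//; first by rewrite mulr_ge0// exprn_ge0.
  by rewrite lef_pV2 ?posrE ?exprn_gt0// mulr_gt0// exprn_gt0// (lt_trans ltr01).
have e : 27 / 8 * v ^+ 3 / (68 * v ^+ 2) = 27 / 544 * v.
  by field; rewrite gt_eqF// (lt_trans ltr01).
by rewrite e in c4; lra.
Qed.

Lemma oneB_cos_ge theta : 0 <= theta <= pi -> 2 * theta ^+ 2 / pi ^+ 2 <= 1 - cos theta.
Proof.
move=> /andP[h0 h1]; have p0 := @pi_gt0 R.
have j := @sin_ge_chord R (theta / 2).
have e : cos theta = 1 - 2 * sin (theta / 2) ^+ 2.
  have {1}-> : theta = 2 * (theta / 2) by rewrite mulrC divfK.
  by rewrite cos_double cos2sin2; ring.
have : (2 / pi * (theta / 2)) ^+ 2 <= sin (theta / 2) ^+ 2.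
  have th : 0 <= theta / 2 <= pi / 2 by apply/andP; split; lra.
  have a0 : 0 <= 2 / pi * (theta / 2) by rewrite mulr_ge0 ?divr_ge0// ltW.
  by rewrite lerXn2r ?nnegrE ?j// (le_trans a0 (j th)).
have -> : (2 / pi * (theta / 2)) ^+ 2 = theta ^+ 2 / pi ^+ 2.
  by move: (pi : R) p0 => p p0; field; rewrite gt_eqF.
by rewrite e; lra.
Qed.

(** The product has no factor k = 1, which costs q (1 - cos theta) <= 2 in the sum; truncation costs
    at most 1. Doubling yields the constant 6. *)
Lemma upto_log_re_dominated (k : nat) t theta : 0 < t <= 1 / 2 ->
  3 * expR (- t) ^+ k.+2 / (1 - expR (- t)) ^+ 2 <= 1 -> 0 <= theta <= pi ->
  upto_log_re (expR (- t)) k theta - upto_log_gen k t <= 6 - 3 / 2 / t *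
    (2 * theta ^+ 2 / pi ^+ 2) / (t ^+ 2 + 2 * (2 * theta ^+ 2 / pi ^+ 2)).
Proof.
move=> /andP[t0 t1] hk hth; have p0 := @pi_gt0 R; pose Y := 2 * theta ^+ 2 / pi ^+ 2; rewrite -/Y.
have yY := oneB_cos_ge hth; rewrite -/Y in yY.
apply: le_trans (upto_log_re_le k theta t0) _.
have h1 := expR_ge1Dx (- t); have := expRN_itv t0.
set q := expR (- t) in h1 hk * => /andP[q0' q1]; have q0 : 0 < q by exact: expR_gt0.
have /(sum_geometric_oneB_cos_ge theta k.+2) : 0 < q < 1 by rewrite q0.
rewrite big_nat_recl// big_nat_recl//= !mul0r cos0 subrr mulr0 add0r expr1 mul1r.
set S := \sum_(0 <= i < k) _; set y := 1 - cos theta in yY *.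
have y2 : y <= 2 by rewrite /y; have := cos_geN1 theta; lra.
have Y0 : 0 <= Y by rewrite divr_ge0 ?sqr_ge0// mulr_ge0 ?sqr_ge0.
have w0 : 0 < 1 - q by rewrite subr_gt0.
have D0 : 0 < (1 - q) * ((1 - q) ^+ 2 + 2 * q * y).
  by rewrite mulr_gt0// ltr_wpDr ?exprn_gt0// !mulr_ge0 ?(ltW q0)// (le_trans Y0).
have D1 : 0 < t ^+ 2 + 2 * Y by rewrite ltr_wpDr ?exprn_gt0// mulr_ge0.
(* The right-hand side increases with y >= Y and is compared through 1 - q <= t. As q >= 1 - t >= 1
   / 2, the factor q (1 + q) is at least 3 / 4. *)
have full : 3 / 4 / t * Y / (t ^+ 2 + 2 * Y) <=
   q * (1 + q) * y / ((1 - q) * ((1 - q) ^+ 2 + 2 * q * y)).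
  have wt : 1 - q <= t by lra.
  have a1 : Y / (t * (t ^+ 2 + 2 * Y)) <= y / ((1 - q) * ((1 - q) ^+ 2 + 2 * q * y)).
    rewrite ler_pdivrMr ?mulr_gt0// mulrAC ler_pdivlMr//.
    have b1 : (1 - q) ^+ 3 <= t ^+ 3 by rewrite lerXn2r ?nnegrE// ltW.
    have b2 : Y * (1 - q) ^+ 3 <= y * t ^+ 3.
      by apply: ler_pM => //; rewrite exprn_ge0// ltW.
    have b3 : q * (1 - q) <= t.
      by apply: le_trans wt; rewrite ler_piMl// ltW.
    have b4 : Y * y * (q * (1 - q)) <= Y * y * t.
      by rewrite ler_wpM2l// mulr_ge0// (le_trans Y0).
    have -> : Y * ((1 - q) * ((1 - q) ^+ 2 + 2 * q * y)) =
      Y * (1 - q) ^+ 3 + 2 * (Y * y * (q * (1 - q))) by ring.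
    have -> : y * (t * (t ^+ 2 + 2 * Y)) = y * t ^+ 3 + 2 * (Y * y * t) by ring.
    lra.
  have -> : 3 / 4 / t * Y / (t ^+ 2 + 2 * Y) = 3 / 4 * (Y / (t * (t ^+ 2 + 2 * Y))).
    by field; rewrite !gt_eqF.
  rewrite -[leRHS]mulrA; apply: ler_pM => //.
    by rewrite divr_ge0// mulr_ge0 ?(ltW t0) ?(ltW D1).
  have : 1 / 2 <= q by lra.
  nra.
have qy : q * y <= 2.
  have : q * y <= 1 * y by rewrite ler_wpM2r ?(le_trans Y0 yY)// ltW.
  by rewrite mul1r; lra.
have -> : 3 / 2 / t * Y / (t ^+ 2 + 2 * Y) = 2 * (3 / 4 / t * Y / (t ^+ 2 + 2 * Y)).
  by field; rewrite !gt_eqF.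
lra.
Qed.

End Domination.

(** * Fourier coefficients *)

Section Fourier.
Context {R : realType}.
Let mu := @lebesgue_measure R.
Implicit Types (s x : R) (A f F : R^nat).

Lemma is_derive_continuous (g : R -> R) x (a : R) : is_derive x 1 g a -> {for x, continuous g}.
Proof. by move=> [dg _]; apply/differentiable_continuous/derivable1_diffP. Qed.

Lemma continuous_is_derive (g dg : R -> R) : (forall x, is_derive x 1 g (dg x)) -> continuous g.
Proof. by move=> h x; exact: is_derive_continuous (h x). Qed.

Lemma integral_is_derive (F f : R -> R) (b : R) : 0 < b ->
  (forall x, is_derive x 1 F (f x)) -> continuous f ->
  (\int[mu]_(x in `[0%R, b]) (f x)%:E = (F b - F 0)%:E)%E.
Proof.
move=> b0 dF cf; have cF := continuous_is_derive dF.
rewrite (@continuous_FTC2 _ f F 0 b b0) ?EFinB//.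
- exact: continuous_subspaceT.
- split.
  + by move=> x _; have [] := dF x.
  + by apply: cvg_at_right_filter; exact: cF.
  + by apply: cvg_at_left_filter; exact: cF.
- by move=> x _; rewrite derive1E; have [_ ->] := dF x.
Qed.

Lemma sin_natmul_pi (n : nat) : sin (n%:R * pi) = 0 :> R.
Proof.
elim: n => [|n ih]; first by rewrite mul0r sin0.
by rewrite -natr1 mulrDl mul1r sinDpi ih oppr0.
Qed.

Let wave A (n : nat) s x : R^nat := fun j => A j * cos (j%:R * (s * x) - n%:R * (s * x)).

(** A primitive of [wave] in x. It vanishes at 0 and, for j <> n, also at pi / s, so orthogonality
    holds already on half a period. *)
Let prim A (n : nat) s x : R^nat := fun j => A j *
  (if j == n then x else sin (j%:R * (s * x) - n%:R * (s * x)) / ((j%:R - n%:R) * s)).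

Let is_derive_prim A n s j x : 0 < s -> is_derive x 1 (fun x => prim A n s x j) (wave A n s x j).
Proof.
move=> s0; rewrite /prim /wave; case: eqP => [->|/eqP jn].
  by derive_by (rewrite subrr cos0; ring).
have d : j%:R - n%:R != 0 :> R by rewrite subr_eq0 eqr_nat.
by derive_by (field; rewrite d gt_eqF).
Qed.

Let is_derive_series A n s L x : 0 < s ->
  is_derive x 1 (fun x => series (prim A n s x) L) (series (wave A n s x) L).
Proof.
move=> s0; elim: L => [|L ih].
  have -> : (fun x => series (prim A n s x) 0) = (fun=> 0).
    by apply/funext => y; rewrite /series /= big_geq.
  by rewrite /series /= big_geq//; exact: is_derive_cst.
have -> : (fun x => series (prim A n s x) L.+1) =
   (fun x => series (prim A n s x) L + prim A n s x L).
  by apply/funext => y; rewrite seriesSr.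
rewrite seriesSr; apply: is_derive_addf; exact: is_derive_prim.
Qed.

Let continuous_series A n s L : continuous (fun x => series (wave A n s x) L).
Proof.
have d j x : is_derive x 1 (fun x => wave A n s x j)
    (- (A j * ((j%:R - n%:R) * s) * sin (j%:R * (s * x) - n%:R * (s * x)))).
  by rewrite /wave; derive_by ring.
move=> x; rewrite /series /=; apply: cvg_big => [|j _]; first exact: add_continuous.
exact: is_derive_continuous (d j x).
Qed.

Let integral_series A n s L : 0 < s -> (n < L)%N ->
  (\int[mu]_(x in `[0%R, (pi / s)%R]) (series (wave A n s x) L)%:E = (A n * (pi / s))%:E)%E.
Proof.
move=> s0 nL; have ps : 0 < pi / s :> R by rewrite divr_gt0// pi_gt0.
rewrite (integral_is_derive ps (fun x => @is_derive_series A n s L x s0)); last first.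
  exact: continuous_series.
congr EFin; rewrite /series /=.
have -> : \sum_(0 <= j < L) prim A n s 0 j = 0.
  apply: big1 => j _; rewrite /prim !mulr0 subrr sin0 mul0r.
  by case: ifP => _; rewrite mulr0.
have es : s * (pi / s) = pi by rewrite mulrCA divff ?mulr1// gt_eqF.
rewrite subr0 (big_cat_nat _ (n := n.+1))//= big_nat_recr//=.
rewrite [X in X + _ + _]big_nat [X in X + _ + _]big1 ?add0r; last first.
  move=> j /= jn; rewrite /prim (ltn_eqF jn) es.
  by rewrite sinB !sin_natmul_pi mul0r mulr0 subrr mul0r mulr0.
rewrite [X in _ + X]big_nat [X in _ + X]big1 ?addr0; last first.
  move=> j /andP[jn _]; rewrite /prim (gtn_eqF jn) es.
  by rewrite sinB !sin_natmul_pi mul0r mulr0 subrr mul0r mulr0.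
by rewrite /prim eqxx.
Qed.

Lemma measurable_cos_series A n s (g : R -> R) :
  (forall x, series (wave A n s x) @ \oo --> g x) -> measurable_fun setT g.
Proof.
move=> h; apply: (measurable_fun_cvg (h := fun L x => series (wave A n s x) L)).
  by move=> L; apply: continuous_measurable_fun; exact: continuous_series.
by move=> x _; exact: h.
Qed.

(** The partial sums are dominated by the constant sum of A on a bounded interval, so limit and
    integral may be exchanged. *)
Lemma integral_cos_series A n s (g : R -> R) : 0 < s -> (forall j, 0 <= A j) ->
  cvgn (series A) -> (forall x, series (wave A n s x) @ \oo --> g x) ->
  (\int[mu]_(x in `[0%R, (pi / s)%R]) (g x)%:E = (A n * (pi / s))%:E)%E.
Proof.
move=> s0 A0 cA h.
have mD : measurable (`[0%R, (pi / s)%R]%classic : set R) by exact: measurable_itv.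
have := @dominated_cvg _ _ R mu _ mD (fun L x => (series (wave A n s x) L)%:E)
  (fun x => (g x)%:E) (EFin \o cst (limn (series A))).
have m1 L : measurable_fun (`[0%R, (pi / s)%R]%classic : set R)
    (fun x => (series (wave A n s x) L)%:E).
  apply/measurable_EFinP; apply: measurable_funTS.
  by apply: continuous_measurable_fun; exact: continuous_series.
move=> /(_ m1); have c1 x : (`[0%R, (pi / s)%R]%classic : set R) x ->
    (series (wave A n s x) L)%:E @[L --> \oo] --> (g x)%:E.
  by move=> _; apply: cvg_EFin; [exact: nearW|exact: h].
move=> /(_ c1) /(_ (fun _ _ => isT)).
have i1 : mu.-integrable (`[0%R, (pi / s)%R]%classic : set R) (EFin \o cst (limn (series A))).
  apply: continuous_compact_integrable; first exact: segment_compact.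
  by apply: continuous_subspaceT => x; exact: cvg_cst.
move=> /(_ i1) H.
have {}H : (\int[mu]_(x in `[0%R, (pi / s)%R]) (series (wave A n s x) L)%:E)%E
    @[L --> \oo] --> (\int[mu]_(x in `[0%R, (pi / s)%R]) (g x)%:E)%E.
  apply: H => L x _ /=; rewrite lee_fin.
  apply: le_trans (_ : series A L <= _).
    rewrite /series /= (le_trans (ler_norm_sum _ _ _))// ler_sum// => j _.
    by rewrite /wave normrM ger0_norm// ler_piMr// cos_max.
  by apply: nondecreasing_cvgn_le => //; apply: nondecreasing_series.
(* Once the partial sum contains the index n, its integral no longer changes. *)
have e : (fun L => \int[mu]_(x in `[0%R, (pi / s)%R]) (series (wave A n s x) L)%:E)%E @ \oo -->
   (A n * (pi / s))%:E.
  apply: cvg_near_cst; exists n.+1 => // L /= nL; exact: integral_series.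
exact: (cvg_unique _ H e).
Qed.

Let q_itv (t : R) : 0 < t -> 0 < expR (- t) < 1.
Proof. by move=> t0; rewrite expR_gt0 expR_lt1 oppr_lt0. Qed.

(** The real part of exp (- i n s x) times the truncated product at exp (- t + i s x). *)
Definition fourier_integrand t (k n : nat) s x : R :=
  expR (upto_log_re (expR (- t)) k (s * x)) *
  cos (upto_log_im (expR (- t)) k (s * x) - n%:R * (s * x)).

Let cvg_fourier t k n s c x : 0 < t ->
  series (wave (fun j => c * ((overp_upto k j)%:R * expR (- t) ^+ j)) n s x) @ \oo -->
  c * fourier_integrand t k n s x.
Proof.
move=> t0; have h := @cvg_series_overp_upto_cos R _ (q_itv t0) k (s * x) (- (n%:R * (s * x))).
have cu := cvg_series_mull (k := c) (cvgP _ h); have := lim_series_mull c (cvgP _ h).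
rewrite (cvg_lim _ h)// [- _ + _]addrC => e; rewrite /fourier_integrand -e.
have -> : wave (fun j => c * ((overp_upto k j)%:R * expR (- t) ^+ j)) n s x =
  (fun j => c * ((overp_upto k j)%:R * expR (- t) ^+ j * cos (j%:R * (s * x) - n%:R * (s * x)))).
  by apply/funext => j; rewrite /wave; ring.
exact: cu.
Qed.

Lemma measurable_fourier_integrand t k n s c : 0 < t ->
  measurable_fun setT (fun x => c * fourier_integrand t k n s x).
Proof. by move=> t0; apply: measurable_cos_series => x; exact: cvg_fourier. Qed.

Lemma integral_fourier_integrand t k n s c : 0 < t -> 0 < s -> 0 <= c ->
  (\int[mu]_(x in `[0%R, (pi / s)%R]) (c * fourier_integrand t k n s x)%:E =
   (c * ((overp_upto k n)%:R * expR (- t) ^+ n) * (pi / s))%:E)%E.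
Proof.
move=> t0 s0 c0.
apply: (@integral_cos_series (fun j => c * ((overp_upto k j)%:R * expR (- t) ^+ j))) => //.
- by move=> j; rewrite !mulr_ge0// exprn_ge0// expR_ge0.
- by apply: cvg_series_mull; exact: (@cvg_series_overp_upto R _ (q_itv t0)).
- by move=> x; exact: cvg_fourier.
Qed.

End Fourier.

(** * The saddle point method *)

Section Asymptotics.
Context {R : realType}.
Implicit Types (t x e : R).

Lemma cvg_to_at_right0 (T : Type) (F : set_system T) {FF : Filter F} (f : T -> R) :
  f x @[x --> F] --> (0 : R) -> (\forall x \near F, 0 < f x) -> f x @[x --> F] --> 0^'+.
Proof.
move=> f0 fp A [e /= e0 hA]; have /cvgrPdist_lt/(_ e e0) h := f0.
by near=> x; apply: hA => /=; [near: x|near: x].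
Unshelve. all: by end_near. Qed.

Lemma log_factor_antitone x y : 0 < x -> x <= y -> log_factor y <= log_factor x.
Proof.
move=> x0 xy; have y0 := lt_le_trans x0 xy.
have /andP[p0 p1] := expRN_itv x0; have /andP[q0 q1] := expRN_itv y0.
have qp : expR (- y) <= expR (- x) by rewrite ler_expR lerN2.
rewrite /log_factor ler_ln ?posrE ?divr_gt0 ?subr_gt0 ?ltr_pwDl//.
rewrite ler_pdivrMr ?subr_gt0// mulrAC ler_pdivlMr ?subr_gt0//.
by move: (expR _) (expR _) p0 p1 q0 q1 qp => p q; nra.
Qed.

Definition log_gen2 t : R := log_gen t - log_factor t.

Lemma cvg_upto_log_gen t : 0 < t -> upto_log_gen k t @[k --> \oo] --> log_gen2 t.
Proof.
move=> t0; have h := cvg_sum_log_factor t0.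
have h' : series (fun k => log_factor (k.+1%:R * t)) k.+1 @[k --> \oo] --> log_gen t.
  by rewrite (@cvg_shiftS _ (series (fun k => log_factor (k.+1%:R * t)))).
have -> : (fun k => upto_log_gen k t) =
    (fun k => series (fun k => log_factor (k.+1%:R * t)) k.+1 - log_factor t).
  apply/funext => k; rewrite /series /= big_nat_recl//= mul1r addrC addKr.
  by [].
by apply: cvgB => //; exact: cvg_cst.
Qed.

Definition upto_tail k t : R := log_gen2 t - upto_log_gen k t.

(** Every [log_factor] is decreasing, so one tail bound at t / 2 serves for t - s, t and t + s
    together. *)
Lemma upto_tail_itv k t t' : 0 < t -> t <= t' -> 0 <= upto_tail k t' <= upto_tail k t.
Proof.
move=> t0 tt; have t0' := lt_le_trans t0 tt.
have diff n x : upto_log_gen (n + k) x - upto_log_gen k x =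
    \sum_(0 <= i < n) log_factor ((i + k).+2%:R * x).
  rewrite /upto_log_gen (@big_cat_nat _ _ _ k _ (n + k))//= ?leq_addl// [X in X - _]addrC addrK.
  by rewrite -{1}[k]add0n big_addn addnK.
have lim x : 0 < x -> upto_log_gen (n + k) x - upto_log_gen k x @[n --> \oo] --> upto_tail k x.
  move=> x0; apply: cvgB; last exact: cvg_cst.
  by have := cvg_upto_log_gen x0; rewrite -(cvg_shiftn k).
apply/andP; split.
  apply: (cvgr_to_ge (lim t' t0')); near=> n; rewrite diff; apply: sumr_ge0 => i _.
  by rewrite log_factor_ge0// mulr_gt0.
apply: (ler_cvg_to (lim t' t0') (lim t t0)); near=> n; rewrite !diff.
apply: ler_sum => i _; apply: log_factor_antitone; first by rewrite mulr_gt0.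
by rewrite ler_wpM2l.
Unshelve. all: by end_near. Qed.

(** The three demands on the number of factors: the n-th coefficient is exact, the truncated
    logarithms keep their asymptotics, and [upto_log_re_dominated] applies. *)
Lemma exists_upto_tail_le (n : nat) t e : 0 < t -> 0 < e -> exists k, [/\ (n <= k)%N,
  upto_tail k (t / 2) <= e & 3 * expR (- t) ^+ k.+2 / (1 - expR (- t)) ^+ 2 <= 1].
Proof.
move=> t0 e0; have t20 : 0 < t / 2 by rewrite divr_gt0.
have /andP[q0 q1] := expRN_itv t0.
have h1 : upto_tail k (t / 2) @[k --> \oo] --> 0.
  rewrite -(subrr (log_gen2 (t / 2))); apply: cvgB; [exact: cvg_cst|exact: cvg_upto_log_gen].
have h2 : 3 * expR (- t) ^+ k.+2 / (1 - expR (- t)) ^+ 2 @[k --> \oo] --> 0.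
  have : 3 * (expR (- t) ^+ k) @[k --> \oo] --> (3 * 0 : R).
    by apply: cvgM; [exact: cvg_cst|apply: cvg_expr; rewrite ger0_norm].
  rewrite mulr0 -(cvg_shiftn 2) => h.
  have := cvgM h (cvg_cst ((1 - expR (- t)) ^+ 2)^-1); rewrite mul0r.
  by under eq_fun do rewrite /= addn2; exact.
have [N _ hN] : \forall k \near \oo, [/\ (n <= k)%N,
    upto_tail k (t / 2) <= e & 3 * expR (- t) ^+ k.+2 / (1 - expR (- t)) ^+ 2 <= 1].
  near=> k; split.
  - by near: k; exists n.
  - near: k; move/cvgrPdist_le : h1 => /(_ e e0); apply: filterS => k.
    by rewrite sub0r normrN; apply: le_trans; exact: ler_norm.
  - near: k; move/cvgrPdist_le : h2 => /(_ 1 ltr01); apply: filterS => k.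
    by rewrite sub0r normrN; apply: le_trans; exact: ler_norm.
by exists N; exact: (hN N (leqnn N)).
Unshelve. all: by end_near. Qed.

(** Of the 3 / 2, one half comes from [log_gen]; removing the factor k = 1, whose logarithm is ln 2
    - ln t + o(1), adds 1. *)
Definition log_gen2_main t : R := pi ^+ 2 / 4 / t + 3 / 2 * ln t.

Lemma cvg_log_gen2 : log_gen2 t - log_gen2_main t @[t --> 0^'+] -->
  (- (ln (4 * pi) / 2) - ln 2 : R).
Proof.
have : log_gen_error t - ln (4 * pi) / 2 - (log_factor t + ln t) @[t --> 0^'+] -->
   (0 - ln (4 * pi) / 2 - ln 2 : R).
  apply: cvgB; last exact: cvg_log_factor_add_ln.
  by apply: cvgB; [exact: cvg_log_gen_error|exact: cvg_cst].
rewrite sub0r; have -> // : (fun t => log_gen_error t - ln (4 * pi) / 2 - (log_factor t + ln t)) =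
  (fun t => log_gen2 t - log_gen2_main t).
apply/funext => t; rewrite /log_gen_error /log_gen2 /log_gen2_main.
by move: (pi ^+ 2 / 4 / t) (ln (4 * pi)) => a b; field.
Qed.

(* With t = pi / (2 sqrt n), the scale [dev t] is the standard deviation of the
   Gaussian limit, rescaled so that this limit is exp (- u ^ 2). *)
Definition dev_ratio t : R := 2 / pi * Num.sqrt t.
Definition dev t : R := t * dev_ratio t.

Lemma dev_ratio_gt0 t : 0 < t -> 0 < dev_ratio t.
Proof. by move=> t0; rewrite mulr_gt0 ?divr_gt0 ?pi_gt0 ?sqrtr_gt0. Qed.

Lemma dev_ratio_sqr t : 0 <= t -> pi ^+ 2 / 4 * dev_ratio t ^+ 2 = t.
Proof.
move=> t0; rewrite exprMn sqr_sqrtr//; have := @pi_gt0 R; move: (pi : R) => p p0.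
by field; rewrite gt_eqF.
Qed.

Lemma cvg_dev_ratio : dev_ratio t @[t --> 0^'+] --> (0 : R).
Proof.
have : Num.sqrt t @[t --> (0 : R)^'+] --> Num.sqrt (0 : R).
  apply: cvg_at_right_filter; exact: sqrt_continuous.
rewrite sqrtr0 => s; have := cvgM (cvg_cst (2 / pi : R)) s; rewrite mulr0; exact.
Qed.

Lemma dev_ratio_le t : 0 <= t -> dev_ratio t <= Num.sqrt t.
Proof.
move=> t0; rewrite /dev_ratio ler_piMl ?sqrtr_ge0// ler_pdivrMr ?pi_gt0// mul1r.
exact: pi_ge2.
Qed.

Lemma cvg_mul_oneDB_dev_ratio :
  t * (1 - dev_ratio t) @[t --> 0^'+] --> 0^'+ /\
  t * (1 + dev_ratio t) @[t --> 0^'+] --> 0^'+.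
Proof.
have c0 : t @[t --> (0:R)^'+] --> (0:R) by exact: cvg_at_right_filter.
split.
- apply: cvg_to_at_right0.
    have := cvgM c0 (cvgB (cvg_cst (1 : R)) cvg_dev_ratio); rewrite mul0r; exact.
  near=> t; have t0 : 0 < t by near: t; exact: nbhs_right_gt.
  rewrite mulr_gt0// subr_gt0 (le_lt_trans (dev_ratio_le (ltW t0)))//.
  by rewrite -sqrtr1 ltr_sqrt//; near: t; exact: nbhs_right_lt.
- apply: cvg_to_at_right0.
    have := cvgM c0 (cvgD (cvg_cst (1 : R)) cvg_dev_ratio); rewrite mul0r; exact.
  near=> t; have t0 : 0 < t by near: t; exact: nbhs_right_gt.
  by rewrite mulr_gt0// ltr_pwDl// ltW// dev_ratio_gt0.
Unshelve. all: by end_near. Qed.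

Let cvg_ln_oneDB :
  ln (1 - dev_ratio t) @[t --> 0^'+] --> (0 : R) /\
  ln (1 + dev_ratio t) @[t --> 0^'+] --> (0 : R).
Proof.
split; rewrite -[X in _ --> X](@ln1 R).
- apply: (@continuous_cvg _ _ _ _ _ _ (@ln R)); first exact: continuous_ln.
  have := cvgB (cvg_cst (1 : R)) cvg_dev_ratio; rewrite subr0; exact.
- apply: (@continuous_cvg _ _ _ _ _ _ (@ln R)); first exact: continuous_ln.
  have := cvgD (cvg_cst (1 : R)) cvg_dev_ratio; rewrite addr0; exact.
Qed.

Let cvg_inv_oneB_sqr : (1 - dev_ratio t ^+ 2)^-1 @[t --> 0^'+] --> (1 : R).
Proof.
rewrite -[X in _ --> X]invr1; apply: cvgV; first exact: oner_neq0.
have := cvgB (cvg_cst (1 : R)) (cvg_expn (n := 2) cvg_dev_ratio).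
rewrite expr0n subr0; exact.
Qed.

(** With d = [dev_ratio t], the term pi^2 / (4 t) contributes pi^2 d^2 / (4 t (1 - d^2)), which is 1
    / (1 - d^2) by the choice of d. The logarithms leave only ln (1 - d) and ln (1 + d), and the
    constants cancel. *)
Lemma cvg_second_moment :
  (log_gen2 (t * (1 - dev_ratio t)) + log_gen2 (t * (1 + dev_ratio t))) / 2 - log_gen2 t
    @[t --> 0^'+] --> (1 : R).
Proof.
have [m1 m2] := cvg_mul_oneDB_dev_ratio; have [l1 l2] := cvg_ln_oneDB.
have h := cvg_log_gen2; set kappa := - _ - _ in h.
have h1 := cvg_comp _ _ m1 h; have h2 := cvg_comp _ _ m2 h.
have : (1 - dev_ratio t ^+ 2)^-1 + 3 / 4 * (ln (1 - dev_ratio t) + ln (1 + dev_ratio t)) +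
   ((log_gen2 (t * (1 - dev_ratio t)) - log_gen2_main (t * (1 - dev_ratio t)) +
     (log_gen2 (t * (1 + dev_ratio t)) - log_gen2_main (t * (1 + dev_ratio t)))) / 2
   - (log_gen2 t - log_gen2_main t)) @[t --> 0^'+] -->
   (1 + 3 / 4 * (0 + 0) + ((kappa + kappa) / 2 - kappa) : R).
  apply: cvgD.
    apply: cvgD; first exact: cvg_inv_oneB_sqr.
    by apply: cvgM; [exact: cvg_cst|apply: cvgD].
  apply: cvgB => //; apply: cvgM; last exact: cvg_cst.
  by apply: cvgD; [exact: h1|exact: h2].
have -> : 1 + 3 / 4 * (0 + 0) + ((kappa + kappa) / 2 - kappa) = 1 :> R by field.
apply: cvg_trans; apply: near_eq_cvg; near=> t.
have t0 : 0 < t by near: t; exact: nbhs_right_gt.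
have d0 := dev_ratio_gt0 t0.
have d1 : dev_ratio t < 1.
  rewrite (le_lt_trans (dev_ratio_le (ltW t0)))//.
  by rewrite -sqrtr1 ltr_sqrt//; near: t; exact: nbhs_right_lt.
have e := dev_ratio_sqr (ltW t0).
rewrite /log_gen2_main !lnM ?posrE ?subr_gt0 ?ltr_pwDl ?(ltW d0)//.
have e1 : pi ^+ 2 / 4 / (t * (1 - dev_ratio t)) + pi ^+ 2 / 4 / (t * (1 + dev_ratio t))
  - 2 * (pi ^+ 2 / 4 / t) = 2 * (1 - dev_ratio t ^+ 2)^-1.
  have b1 : 1 - dev_ratio t != 0 by rewrite gt_eqF// subr_gt0.
  have b2 : 1 + dev_ratio t != 0 by rewrite gt_eqF// ltr_pwDl// ltW.
  have b3 : 1 - dev_ratio t ^+ 2 != 0.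
    by rewrite -[1](expr1n _ 2) subr_sqr mulf_neq0.
  have t0' : t != 0 by rewrite gt_eqF.
  transitivity (2 * (pi ^+ 2 / 4 * dev_ratio t ^+ 2) / t / (1 - dev_ratio t ^+ 2)).
    move: (dev_ratio t) (pi ^+ 2 / 4) b1 b2 b3 => d c b1 b2 b3.
    by field; rewrite ?t0' ?b1 ?b2 ?b3.
  by rewrite e; move: (1 - dev_ratio t ^+ 2) b3 => z b3; field; rewrite ?t0' ?b3.
move: e1; move: (pi ^+ 2 / 4 / _) (pi ^+ 2 / 4 / _) (pi ^+ 2 / 4 / _) (ln _) (ln _) (ln _).
move: (log_gen2 _) (log_gen2 _) (log_gen2 _) (_^-1).
by move=> A B C D E F G H I J e1; lra.
Unshelve. all: by end_near. Qed.

(** The half difference of pi^2 / (4 t) exceeds its linear part by d / (1 - d^2), where d =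
    [dev_ratio t]. At the saddle point that linear part equals n times the step and cancels the
    phase of the coefficient. *)
Lemma cvg_first_moment :
  (log_gen2 (t * (1 - dev_ratio t)) - log_gen2 (t * (1 + dev_ratio t))) / 2 -
    pi ^+ 2 / 4 * dev_ratio t / t @[t --> 0^'+] --> (0 : R).
Proof.
have [m1 m2] := cvg_mul_oneDB_dev_ratio; have [l1 l2] := cvg_ln_oneDB.
have h := cvg_log_gen2; set kappa := - _ - _ in h.
have h1 := cvg_comp _ _ m1 h; have h2 := cvg_comp _ _ m2 h.
have : dev_ratio t * (1 - dev_ratio t ^+ 2)^-1 +
   3 / 4 * (ln (1 - dev_ratio t) - ln (1 + dev_ratio t)) +
   (log_gen2 (t * (1 - dev_ratio t)) - log_gen2_main (t * (1 - dev_ratio t)) -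
     (log_gen2 (t * (1 + dev_ratio t)) - log_gen2_main (t * (1 + dev_ratio t)))) / 2
   @[t --> 0^'+] --> (0 * 1 + 3 / 4 * (0 - 0) + (kappa - kappa) / 2 : R).
  apply: cvgD.
    apply: cvgD; first by apply: cvgM; [exact: cvg_dev_ratio|exact: cvg_inv_oneB_sqr].
    by apply: cvgM; [exact: cvg_cst|apply: cvgB].
  apply: cvgM; last exact: cvg_cst.
  by apply: cvgB; [exact: h1|exact: h2].
have -> : 0 * 1 + 3 / 4 * (0 - 0) + (kappa - kappa) / 2 = 0 :> R by field.
apply: cvg_trans; apply: near_eq_cvg; near=> t.
have t0 : 0 < t by near: t; exact: nbhs_right_gt.
have d0 := dev_ratio_gt0 t0.
have d1 : dev_ratio t < 1.
  rewrite (le_lt_trans (dev_ratio_le (ltW t0)))//.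
  by rewrite -sqrtr1 ltr_sqrt//; near: t; exact: nbhs_right_lt.
have e := dev_ratio_sqr (ltW t0).
rewrite /log_gen2_main !lnM ?posrE ?subr_gt0 ?ltr_pwDl ?(ltW d0)//.
have e1 : pi ^+ 2 / 4 / (t * (1 - dev_ratio t)) - pi ^+ 2 / 4 / (t * (1 + dev_ratio t))
  - 2 * (pi ^+ 2 / 4 * dev_ratio t / t) = 2 * (dev_ratio t * (1 - dev_ratio t ^+ 2)^-1).
  have b1 : 1 - dev_ratio t != 0 by rewrite gt_eqF// subr_gt0.
  have b2 : 1 + dev_ratio t != 0 by rewrite gt_eqF// ltr_pwDl// ltW.
  have b3 : 1 - dev_ratio t ^+ 2 != 0.
    by rewrite -[1](expr1n _ 2) subr_sqr mulf_neq0.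
  have t0' : t != 0 by rewrite gt_eqF.
  transitivity (2 * (pi ^+ 2 / 4 * dev_ratio t ^+ 2) * dev_ratio t / t / (1 - dev_ratio t ^+ 2)).
    move: (dev_ratio t) (pi ^+ 2 / 4) b1 b2 b3 => d c b1 b2 b3.
    by field; rewrite ?t0' ?b1 ?b2 ?b3.
  by rewrite e; move: (1 - dev_ratio t ^+ 2) b3 => z b3; field; rewrite ?t0' ?b3.
move: e1; move: (pi ^+ 2 / 4 * dev_ratio t / t) (pi ^+ 2 / 4 / (t * (1 - dev_ratio t))).
move: (pi ^+ 2 / 4 / (t * (1 + dev_ratio t))) (dev_ratio t * (1 - dev_ratio t ^+ 2)^-1).
move=> A B C D e1; lra.
Unshelve. all: by end_near. Qed.

End Asymptotics.

(** * Convergence of the scaled Fourier integral to half a Gaussian integral *)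

Section SaddlePoint.
Context {R : realType}.
Let mu := @lebesgue_measure R.

(* Saddle point of exp (n t) exp (pi ^ 2 / (4 t)). *)
Definition saddle (n : nat) : R := pi / (2 * Num.sqrt n%:R).

Lemma saddle_gt0 n : (0 < n)%N -> 0 < saddle n.
Proof. by move=> n0; rewrite divr_gt0 ?pi_gt0// mulr_gt0// sqrtr_gt0 ltr0n. Qed.

Lemma saddle_sqr n : (0 < n)%N -> n%:R * saddle n ^+ 2 = pi ^+ 2 / 4.
Proof.
move=> n0; have s0 : 0 < Num.sqrt n%:R :> R by rewrite sqrtr_gt0 ltr0n.
have {1}-> : n%:R = Num.sqrt n%:R ^+ 2 :> R by rewrite sqr_sqrtr.
by rewrite /saddle; move: (pi : R) (Num.sqrt _) s0 => p s s0; field; rewrite gt_eqF.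
Qed.

Lemma cvg_saddle : saddle n @[n --> \oo] --> 0^'+.
Proof.
apply: cvg_to_at_right0; last by exists 1%N => // n /= n0; exact: saddle_gt0.
rewrite -cvg_shiftS.
have -> : (fun n => saddle n.+1) = (fun n => pi / 2 * Num.sqrt (harmonic n)).
  by apply/funext => n; rewrite /saddle /harmonic /= sqrtrV// invfM mulrA.
have h : Num.sqrt (harmonic n) @[n --> \oo] --> Num.sqrt (0 : R).
  apply: (@continuous_cvg _ _ _ _ _ _ (@Num.sqrt R)); first exact: sqrt_continuous.
  exact: cvg_harmonic.
have := cvgM (cvg_cst (pi / 2 : R)) h; rewrite sqrtr0 mulr0; exact.
Qed.

Variables (k : nat -> nat)
  (k_ge : forall n, (0 < n)%N -> (n <= k n)%N)
  (k_tail : forall n, (0 < n)%N -> upto_tail (k n) (saddle n / 2) <= harmonic n)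
  (k_geo : forall n, (0 < n)%N ->
    3 * expR (- saddle n) ^+ (k n).+2 / (1 - expR (- saddle n)) ^+ 2 <= 1).

Let t := saddle.
Let d n : R := dev_ratio (t n).
Let s n : R := dev (t n).
Let gen n (x : R) := upto_log_gen (k n) x.

Let cvg_tail (x : nat -> R) : (\forall n \near \oo, t n / 2 <= x n) ->
  upto_tail (k n) (x n) @[n --> \oo] --> (0 : R).
Proof.
move=> hx; apply: (squeeze_cvgr _ (cvg_cst 0) cvg_harmonic); near=> n.
have n0 : (0 < n)%N by near: n; exists 1%N.
have t20 : 0 < t n / 2 by rewrite divr_gt0// saddle_gt0.
have /andP[-> h] : 0 <= upto_tail (k n) (x n) <= upto_tail (k n) (t n / 2).
  by apply: upto_tail_itv => //; near: n.
exact: le_trans h (k_tail n0).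
Unshelve. all: by end_near. Qed.

Let cvg_d : d n @[n --> \oo] --> (0 : R).
Proof. exact: (cvg_comp _ _ cvg_saddle cvg_dev_ratio). Qed.

Let near_small : \forall n \near \oo, [/\ (0 < n)%N, 0 < t n, t n <= 1 / 16, 0 < d n & d n <= 1 / 4].
Proof.
(* The bound 1 / 16 gives d <= sqrt t <= 1 / 4, hence s <= t / 4 as the Taylor estimates require. *)
have h16 : 0 < 1 / 16 :> R by rewrite divr_gt0.
have c0 : t n @[n --> \oo] --> 0 by exact: cvg_trans cvg_saddle (cvg_within _).
near=> n; have n0 : (0 < n)%N by near: n; exists 1%N.
have t0 := saddle_gt0 n0.
have t16 : t n <= 1 / 16.
  near: n; move/cvgrPdist_le : c0 => /(_ _ h16); apply: filterS => n.
  by rewrite sub0r normrN; apply: le_trans; exact: ler_norm.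
split=> //; first exact: dev_ratio_gt0.
apply: le_trans (dev_ratio_le (ltW t0)) _.
have -> : 1 / 4 = Num.sqrt (1 / 16) :> R.
  have -> : 1 / 16 = (1 / 4) ^+ 2 :> R by field.
  by rewrite sqrtr_sqr ger0_norm// divr_ge0.
by rewrite ler_sqrt// divr_gt0.
Unshelve. all: by end_near. Qed.

Let second n := (gen n (t n - s n) + gen n (t n + s n)) / 2 - gen n (t n).
Let first_ n := (gen n (t n - s n) - gen n (t n + s n)) / 2 - n%:R * s n.

Let s1E n : t n - s n = t n * (1 - d n). Proof. by rewrite /s /dev /d; ring. Qed.
Let s2E n : t n + s n = t n * (1 + d n). Proof. by rewrite /s /dev /d; ring. Qed.

Let cvg_tail1 : upto_tail (k n) (t n * (1 - d n)) @[n --> \oo] --> (0 : R).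
Proof.
apply: cvg_tail; apply: filterS near_small => n [_ t0 _ _ d1].
by rewrite ler_pM2l//; lra.
Qed.

Let cvg_tail2 : upto_tail (k n) (t n * (1 + d n)) @[n --> \oo] --> (0 : R).
Proof.
apply: cvg_tail; apply: filterS near_small => n [_ t0 _ d0 d1].
by rewrite ler_pM2l//; lra.
Qed.

Lemma cvg_upto_tail : upto_tail (k n) (t n) @[n --> \oo] --> (0 : R).
Proof. by apply: cvg_tail; apply: filterS near_small => n [_ t0 _ d0 d1]; lra. Qed.

Let cvg_second : second n @[n --> \oo] --> (1 : R).
Proof.
have h := cvg_comp _ _ cvg_saddle cvg_second_moment.
have H : (log_gen2 (t n * (1 - d n)) + log_gen2 (t n * (1 + d n))) / 2 - log_gen2 (t n) -
    ((upto_tail (k n) (t n * (1 - d n)) + upto_tail (k n) (t n * (1 + d n))) / 2 -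
      upto_tail (k n) (t n)) @[n --> \oo] --> (1 - ((0 + 0) / 2 - 0) : R).
  apply: cvgB; first exact: h.
  apply: cvgB; last exact: cvg_upto_tail.
  apply: cvgM; last exact: cvg_cst.
  by apply: cvgD; [exact: cvg_tail1|exact: cvg_tail2].
rewrite addr0 mul0r !subr0 in H; apply: (cvg_near_eq _ H); apply: nearW => n.
by rewrite /second s1E s2E /gen /upto_tail /=; ring.
Qed.

Let cvg_first : first_ n @[n --> \oo] --> (0 : R).
Proof.
have h := cvg_comp _ _ cvg_saddle cvg_first_moment.
have H : (log_gen2 (t n * (1 - d n)) - log_gen2 (t n * (1 + d n))) / 2 -
    pi ^+ 2 / 4 * d n / t n -
    (upto_tail (k n) (t n * (1 - d n)) - upto_tail (k n) (t n * (1 + d n))) / 2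
    @[n --> \oo] --> (0 - (0 - 0) / 2 : R).
  apply: cvgB; first exact: h.
  apply: cvgM; last exact: cvg_cst.
  by apply: cvgB; [exact: cvg_tail1|exact: cvg_tail2].
rewrite subr0 mul0r subr0 in H; apply: (cvg_near_eq _ H).
apply: filterS near_small => n [n0 t0 _ d0 d1] /=.
have -> : pi ^+ 2 / 4 * d n / t n = n%:R * s n.
  rewrite -(saddle_sqr n0) -/(t n) /s /dev -/(d n).
  by field; rewrite gt_eqF.
by rewrite /first_ s1E s2E /gen /upto_tail; ring.
Qed.

(** Here d^2 is a multiple of t and [log_gen (t / 2)] is O(1 / t), so their product stays bounded;
    one further factor d makes the cubic Taylor remainder vanish. *)
Let cvg_error : d n ^+ 2 * gen n (t n / 2) * d n @[n --> \oo] --> (0 : R).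
Proof.
have th : t n * 2^-1 @[n --> \oo] --> 0^'+.
  apply: cvg_to_at_right0.
    have c0 : t n @[n --> \oo] --> 0 by exact: cvg_trans cvg_saddle (cvg_within _).
    by rewrite -(mul0r (2^-1 : R)); apply: cvgM; [exact: c0|exact: cvg_cst].
  by apply: filterS near_small => n [n0 t0 _ d0 d1]; rewrite mulr_gt0.
have h := cvg_comp _ _ th cvg_mul_log_gen.
have hu : 8 / pi ^+ 2 * (t n / 2 * log_gen (t n / 2)) * d n @[n --> \oo] --> (0 : R).
  rewrite -(mulr0 (8 / pi ^+ 2 * (pi ^+ 2 / 4))); apply: cvgM; last exact: cvg_d.
  by apply: cvgM; [exact: cvg_cst|exact: h].
apply: (squeeze_cvgr _ (cvg_cst 0) hu).
apply: filterS near_small => n [n0 t0 _ d0 d1].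
have t20 : 0 < t n / 2 by rewrite divr_gt0.
have g0 : 0 <= gen n (t n / 2).
  by apply: sumr_ge0 => i _; rewrite log_factor_ge0// mulr_gt0.
have g1 : gen n (t n / 2) <= log_gen (t n / 2).
  have /andP[h1 _] := upto_tail_itv (k n) t20 (lexx _).
  have h2 := log_factor_ge0 t20.
  by move: h1; rewrite /upto_tail /log_gen2 /gen; lra.
have e : d n ^+ 2 = 8 / pi ^+ 2 * (t n / 2).
  have := dev_ratio_sqr (ltW t0); rewrite -/(d n) => e1; rewrite -[X in _ = _ * (X / 2)]e1.
  by have := @pi_gt0 R; move: (pi : R) => p p0; field; rewrite gt_eqF.
apply/andP; split.
  by apply: mulr_ge0; [apply: mulr_ge0 => //; exact: sqr_ge0|exact: ltW].
rewrite ler_pM2r// e -[leLHS]mulrA; apply: ler_wpM2l.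
  by rewrite divr_ge0// sqr_ge0.
by rewrite ler_wpM2l// ltW.
Qed.

Let re n u := upto_log_re (expR (- t n)) (k n) (s n * u).
Let im n u := upto_log_im (expR (- t n)) (k n) (s n * u).

Let dev_div n : 0 < t n -> 4 * s n / t n = 4 * d n.
Proof. by move=> t0; rewrite /s /dev -/(d n); field; rewrite gt_eqF. Qed.

Let cvg_re u : 0 <= u -> re n u - gen n (t n) @[n --> \oo] --> - u ^+ 2.
Proof.
move=> u0; pose C : R := (u ^+ 4 + u ^+ 2) * 24 * 4 ^+ 4.
have C0 : 0 <= C by rewrite !mulr_ge0// addr_ge0// exprn_ge0.
have e0 : (re n u - gen n (t n)) + u ^+ 2 * second n @[n --> \oo] --> (0 : R).
  apply/norm_cvg0P.
  have hu : C * (d n ^+ 2 * gen n (t n / 2) * d n * d n) @[n --> \oo] --> (0 : R).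
    rewrite -(mulr0 C); apply: cvgM; first exact: cvg_cst.
    by rewrite -(mulr0 0); apply: cvgM; [exact: cvg_error|exact: cvg_d].
  apply: (squeeze_cvgr _ (cvg_cst 0) hu).
  apply: filterS near_small => n [n0 t0 _ d0 d1]; rewrite normr_ge0/=.
  have s0 : 0 <= s n by rewrite mulr_ge0// ltW.
  have st : s n <= t n / 4 by rewrite /s /dev -/(d n) ler_pM2l//; lra.
  apply: le_trans (upto_log_re_taylor (k n) t0 s0 st u0) _.
  rewrite dev_div// -/(gen n _) /C.
  by rewrite le_eqVlt; apply/orP; left; apply/eqP; ring.
have H : (re n u - gen n (t n)) + u ^+ 2 * second n - u ^+ 2 * second n
    @[n --> \oo] --> (0 - u ^+ 2 * 1 : R).
  by apply: cvgB; [exact: e0|apply: cvgM; [exact: cvg_cst|exact: cvg_second]].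
rewrite mulr1 sub0r in H; apply: (cvg_near_eq _ H); apply: nearW => n.
by rewrite addrK.
Qed.

Let cvg_im u : 0 <= u -> im n u - n%:R * (s n * u) @[n --> \oo] --> (0 : R).
Proof.
move=> u0; pose C : R := (u ^+ 3 + u) * 6 * 4 ^+ 3.
have C0 : 0 <= C by rewrite !mulr_ge0// addr_ge0// exprn_ge0.
have e0 : (im n u - n%:R * (s n * u)) - u * first_ n @[n --> \oo] --> (0 : R).
  apply/norm_cvg0P.
  have hu : C * (d n ^+ 2 * gen n (t n / 2) * d n) @[n --> \oo] --> (0 : R).
    by rewrite -(mulr0 C); apply: cvgM; [exact: cvg_cst|exact: cvg_error].
  apply: (squeeze_cvgr _ (cvg_cst 0) hu).
  apply: filterS near_small => n [n0 t0 _ d0 d1]; rewrite normr_ge0/=.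
  have s0 : 0 <= s n by rewrite mulr_ge0// ltW.
  have st : s n <= t n / 4 by rewrite /s /dev -/(d n) ler_pM2l//; lra.
  have -> : im n u - n%:R * (s n * u) - u * first_ n =
     im n u - u * ((gen n (t n - s n) - gen n (t n + s n)) / 2) by rewrite /first_; ring.
  apply: le_trans (upto_log_im_taylor (k n) t0 s0 st u0) _.
  rewrite dev_div// -/(gen n _) /C.
  by rewrite le_eqVlt; apply/orP; left; apply/eqP; ring.
have H : (im n u - n%:R * (s n * u)) - u * first_ n + u * first_ n
    @[n --> \oo] --> (0 + u * 0 : R).
  by apply: cvgD; [exact: e0|apply: cvgM; [exact: cvg_cst|exact: cvg_first]].
rewrite mulr0 addr0 in H; apply: (cvg_near_eq _ H); apply: nearW => n.
by rewrite subrK.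
Qed.

Let scaled n u := expR (- gen n (t n)) * fourier_integrand (t n) (k n) n (s n) u.

Let scaledE n u : scaled n u = expR (re n u - gen n (t n)) * cos (im n u - n%:R * (s n * u)).
Proof. by rewrite /scaled /fourier_integrand mulrA -expRD [- _ + _]addrC. Qed.

Let cvg_scaled u : 0 <= u -> scaled n u @[n --> \oo] --> gauss_fun u.
Proof.
move=> u0; have -> : gauss_fun u = expR (- u ^+ 2) * cos 0 by rewrite cos0 mulr1.
under eq_fun do rewrite scaledE.
apply: cvgM.
  apply: (@continuous_cvg _ _ _ _ _ _ (@expR R)); first exact: continuous_expR.
  exact: cvg_re.
apply: (@continuous_cvg _ _ _ _ _ _ (@cos R)); first exact: continuous_cos.
exact: cvg_im.
Qed.

(** As s^2 = 4 t^3 / pi^2, the lower bound 2 (s u)^2 / pi^2 for 1 - cos (s u) equals [kappa] u^2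
    t^3. *)
Let kappa : R := 8 / pi ^+ 4.

Let kappa_itv : 0 < kappa <= 1.
Proof.
have p0 := @pi_gt0 R; have p4 : 0 < pi ^+ 4 :> R by rewrite exprn_gt0.
rewrite /kappa divr_gt0//= ler_pdivrMr// mul1r.
apply: le_trans (_ : 2 ^+ 4 <= _).
  by rewrite -natrX ler_nat.
by rewrite lerXn2r ?nnegrE ?pi_ge2// ltW.
Qed.

Let bound : R := expR 6 * (16 * 32) / kappa.

(** The angle s u is at most pi, so v = [kappa] u^2 satisfies v t^3 <= 2 and [expRN_le_inv] gives a
    multiple of 1 / (1 + v). Since [kappa] <= 1, this is at most a multiple of 1 / (1 + u^2),
    independent of n. *)
Let scaled_le n u : (0 < n)%N -> t n <= 1 / 16 -> 0 <= u <= pi / s n ->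
  `|scaled n u| <= bound * (1 + u ^+ 2)^-1.
Proof.
move=> n0 t16 /andP[u0 us]; have t0 := saddle_gt0 n0; have d0 := dev_ratio_gt0 t0.
have p0 := @pi_gt0 R; have s0 : 0 < s n by rewrite mulr_gt0.
have /andP[k0 k1] := kappa_itv.
rewrite scaledE normrM ger0_norm ?expR_ge0//.
apply: le_trans (_ : expR (re n u - gen n (t n)) * 1 <= _).
  by rewrite ler_wpM2l ?expR_ge0// cos_max.
rewrite mulr1; have th : 0 <= s n * u <= pi.
  by rewrite mulr_ge0 ?(ltW s0)//= mulrC -ler_pdivlMr.
have t1 : 0 < t n <= 1 / 2 by rewrite t0/=; lra.
have := upto_log_re_dominated t1 (k_geo n0) th.
set Y := 2 * (s n * u) ^+ 2 / pi ^+ 2.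
have eY : Y = kappa * u ^+ 2 * t n ^+ 3.
  have := dev_ratio_sqr (ltW t0); rewrite -/(t n) -/(d n) /Y /s /dev -/(d n) => e.
  transitivity (8 / pi ^+ 4 * u ^+ 2 * t n ^+ 2 * (pi ^+ 2 / 4 * d n ^+ 2)).
    by move: (pi : R) p0 => p p0; field; rewrite gt_eqF.
  by rewrite e /kappa; ring.
have Y2 : Y <= 2.
  rewrite /Y ler_pdivrMr ?exprn_gt0// ler_pM2l//; case/andP: th => th0 th1.
  by rewrite lerXn2r ?nnegrE// ltW.
have v0 : 0 <= kappa * u ^+ 2 by rewrite mulr_ge0 ?sqr_ge0// ltW.
have := expRN_le_inv v0 t0; rewrite -/(t n) -eY => /(_ Y2).
set v := kappa * u ^+ 2 in v0 eY *.
have -> : 3 / 2 / t n * Y / (t n ^+ 2 + 2 * Y) = 3 / 2 * v / (1 + 2 * v * t n).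
  have d1 : 0 < 1 + 2 * v * t n.
    by rewrite ltr_pwDl//; apply: mulr_ge0; [exact: mulr_ge0|exact: ltW].
  have d2 : t n ^+ 2 + 2 * Y = t n ^+ 2 * (1 + 2 * v * t n) by rewrite eY; ring.
  by rewrite d2 eY; field; rewrite !gt_eqF.
set E := 3 / 2 * v / _ => h1 h2.
apply: le_trans (_ : expR 6 * expR (- E) <= _).
  by rewrite -expRD ler_expR.
apply: le_trans (ler_wpM2l (expR_ge0 6) h1) _.
have v1 : 0 < 1 + v by rewrite ltr_pwDl.
have u1 : 0 < 1 + u ^+ 2 by rewrite ltr_pwDl// sqr_ge0.
have -> : bound * (1 + u ^+ 2)^-1 = expR 6 * (16 * 32 / (kappa * (1 + u ^+ 2))).
  have aux (a b x y : R) : a * b / x * y^-1 = a * (b / (x * y)) by rewrite invfM !mulrA.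
  exact: aux.
rewrite ler_wpM2l ?expR_ge0// ler_wpM2l//.
have ku : 0 < kappa * (1 + u ^+ 2) := mulr_gt0 k0 u1.
by rewrite lef_pV2 ?posrE// mulrDr mulr1 lerD2r.
Qed.

Let halfline : set (measurableTypeR R) := `[0, +oo[%classic.

(** The range of u when the angle runs from 0 to pi. It is made empty for the finitely many n
    outside the estimates, so that domination holds for every n. *)
Let win n : set (measurableTypeR R) := if (0 < n)%N && (t n <= 1 / 16) then `[0, pi / s n]%classic else set0.

Let mwin n : measurable (win n).
Proof. by rewrite /win; case: ifP => _; [exact: measurable_itv|exact: measurable0]. Qed.

Let windowed n : measurableTypeR R -> \bar R := (fun u => (scaled n u)%:E) \_ (win n).

Let measurable_windowed n : measurable_fun halfline (windowed n).
Proof.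
have [n0|n0] := posnP n.
  have -> : windowed n = cst 0%E; last exact: measurable_cst.
  by rewrite /windowed /win n0 /= patch_set0.
apply: measurable_funTS; rewrite /windowed; apply/(measurable_restrictT _ (mwin n)).
apply: measurable_funTS; apply/measurable_EFinP; rewrite /scaled.
exact: measurable_fourier_integrand (saddle_gt0 n0).
Qed.

Let cvg_windowed u : halfline u -> windowed n u @[n --> \oo] --> (gauss_fun u)%:E.
Proof.
rewrite /halfline /= in_itv/= andbT => u0.
have h : (scaled n u)%:E @[n --> \oo] --> (gauss_fun u)%:E.
  by apply: cvg_EFin; [exact: nearW|exact: cvg_scaled].
apply: cvg_trans h; apply: near_eq_cvg.
have c0 : s n @[n --> \oo] --> (0 : R).
  have ct : t n @[n --> \oo] --> (0 : R) by exact: cvg_trans cvg_saddle (cvg_within _).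
  by rewrite -(mulr0 0); apply: cvgM; [exact: ct|exact: cvg_d].
(* Once s <= pi / (u + 1), the point u lies in the window; u + 1 avoids a division by 0 at u = 0. *)
have u1 : 0 < pi / (u + 1) :> R by rewrite divr_gt0 ?pi_gt0// ltr_wpDl.
near=> n; have [n0 t0 t16 d0 d1] : [/\ (0 < n)%N, 0 < t n, t n <= 1 / 16, 0 < d n & d n <= 1 / 4].
  by near: n; exact: near_small.
rewrite /windowed patchE mem_set// /win n0 t16 /= in_itv/= u0/=.
have s0 : 0 < s n by rewrite mulr_gt0.
have un : s n <= pi / (u + 1).
  near: n; move/cvgrPdist_le : c0 => /(_ _ u1); apply: filterS => n.
  by rewrite sub0r normrN; apply: le_trans; exact: ler_norm.
rewrite ler_pdivlMr//; move: un; rewrite ler_pdivlMr ?ltr_wpDl// => un.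
by apply: le_trans un; rewrite mulrC ler_pM2l// lerDl.
Unshelve. all: by end_near. Qed.

Let integrable_bound : mu.-integrable halfline (fun u => (bound * (1 + u ^+ 2)^-1)%:E).
Proof.
have mo : measurable_fun halfline (fun u : R => (oneDsqr u)^-1).
  by apply: measurable_funTS; apply: continuous_measurable_fun; exact: continuous_oneDsqrV.
have h : mu.-integrable halfline (fun u : R => ((oneDsqr u)^-1)%:E).
  apply/integrableP; split; first exact/measurable_EFinP.
  under eq_integral do rewrite /= ger0_norm ?invr_ge0 ?oneDsqr_ge0//.
  by rewrite integral0y_oneDsqr ltry.
have mD : measurable halfline by exact: measurable_itv.
have -> : (fun u : R => (bound * (1 + u ^+ 2)^-1)%:E) =
    (fun u => (bound%:E * ((oneDsqr u)^-1)%:E)%E) by apply/funext => u; rewrite -EFinM.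
exact: (integrableZl mD bound h).
Qed.

Let integral_windowed n : (0 < n)%N -> t n <= 1 / 16 ->
  (\int[mu]_(u in halfline) windowed n u =
   (expR (- gen n (t n)) * ((overp_ge 2 n)%:R * expR (- t n) ^+ n) * (pi / s n))%:E)%E.
Proof.
move=> n0 t16; have t0 := saddle_gt0 n0.
have s0 : 0 < s n by rewrite mulr_gt0// dev_ratio_gt0.
rewrite -integral_mkcondr.
have -> : halfline `&` win n = `[0, pi / s n]%classic.
  rewrite /win n0 t16 /=; apply/setIidr => u /=.
  by rewrite /halfline /= !in_itv/= andbT => /andP[].
rewrite /scaled integral_fourier_integrand// ?expR_ge0//.
by rewrite overp_uptoE// k_ge.
Qed.

Lemma cvg_saddle_integral :
  expR (- gen n (t n)) * ((overp_ge 2 n)%:R * expR (- t n) ^+ n) * (pi / s n)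
    @[n --> \oo] --> Num.sqrt pi / 2.
Proof.
have mD : measurable halfline by exact: measurable_itv.
have H : (\int[mu]_(u in halfline) windowed n u)%E @[n --> \oo] -->
    (\int[mu]_(u in halfline) (gauss_fun u)%:E)%E.
  apply: (dominated_cvg mD measurable_windowed cvg_windowed _ integrable_bound) => //.
  move=> n u; rewrite /halfline /= in_itv/= andbT => u0.
  have b0 : 0 <= bound * (1 + u ^+ 2)^-1.
    have /andP[k0 _] := kappa_itv.
    by rewrite mulr_ge0 ?invr_ge0 ?addr_ge0 ?sqr_ge0// divr_ge0 ?(ltW k0)// mulr_ge0 ?expR_ge0// mulr_ge0.
  rewrite /windowed patchE; case: ifPn => [|_]; last by rewrite abse0 lee_fin.
  move=> /set_mem; rewrite /win; case: ifP => // /andP[n0 t16]; rewrite /= in_itv/= => hu.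
  by rewrite lee_fin; exact: scaled_le.
rewrite integral0y_gauss in H.
have H' : (expR (- gen n (t n)) * ((overp_ge 2 n)%:R * expR (- t n) ^+ n) * (pi / s n))%:E
    @[n --> \oo] --> (Num.sqrt pi / 2)%:E.
  apply: cvg_trans H; apply: near_eq_cvg.
  by apply: filterS near_small => n [n0 _ t16 _ _]; rewrite integral_windowed.
by move: H' => /fine_cvgP[].
Qed.

End SaddlePoint.

(** * The constant and the final limit *)

Section Ratio.
Context {R : realType}.

Lemma powRN_three_halves (n : nat) : (0 < n)%N ->
  n%:R `^ (- (3%:R / 2%:R)) = (Num.sqrt n%:R ^+ 3)^-1 :> R.
Proof.
move=> n0; rewrite powRN; congr (_^-1).
have -> : 3%:R / 2%:R = 1 + 2^-1 :> R by field.
rewrite powRD; last by rewrite pnatr_eq0 -lt0n n0 implybT.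
by rewrite powRr1// powR12_sqrt// exprS sqr_sqrtr// mulrC.
Qed.

(** An exact identity. Since sqrt n = pi / (2 t), the denominator is t^3 / (4 pi^2) times exp (n t +
    pi^2 / (4 t)). The cube of t is shared between [dev t] = (2 / pi) t^(3/2) and the term 3 / 2 ln
    t of [log_gen2_main]; the numbers leave 8. *)
Lemma overp_ratioE (k n : nat) : (0 < n)%N -> let t : R := saddle n in
  (overp_ge 2 n)%:R / (pi / 32%:R * (n%:R `^ (- (3%:R / 2%:R))) * expR (pi * Num.sqrt n%:R)) =
  8 * (expR (- upto_log_gen k t) * ((overp_ge 2 n)%:R * expR (- t) ^+ n) * (pi / dev t)) *
   expR (log_gen2 t - log_gen2_main t - upto_tail k t).
Proof.
move=> n0 t; have t0 : 0 < t := saddle_gt0 n0; have p0 := @pi_gt0 R.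
have r0 : 0 < Num.sqrt n%:R :> R by rewrite sqrtr_gt0 ltr0n.
have st0 : 0 < Num.sqrt t by rewrite sqrtr_gt0.
have et : Num.sqrt t ^+ 2 = t by rewrite sqr_sqrtr// ltW.
have er : Num.sqrt n%:R = pi / (2 * t).
  rewrite /t /saddle; move: (pi : R) p0 (Num.sqrt _) r0 => p p0 r r0.
  by field; rewrite !gt_eqF.
have ln3 : expR (3 / 2 * ln t) = t * Num.sqrt t.
  have el : ln t = 2 * ln (Num.sqrt t) by rewrite -{1}et lnXn// mulr_natl.
  have -> : 3 / 2 * ln t = ln (t * Num.sqrt t) by rewrite lnM ?posrE// el; field.
  by rewrite lnK// posrE mulr_gt0.
have enx : expR (- t) ^+ n = expR (- (pi ^+ 2 / 4 / t)).
  rewrite -expRM_natl; congr expR; rewrite -(saddle_sqr n0) -/t.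
  by field; rewrite gt_eqF.
have emain : log_gen2 t - log_gen2_main t - upto_tail k t =
    upto_log_gen k t - pi ^+ 2 / 4 / t - 3 / 2 * ln t.
  by rewrite /upto_tail /log_gen2_main; ring.
rewrite emain enx powRN_three_halves// er.
have -> : expR (upto_log_gen k t - pi ^+ 2 / 4 / t - 3 / 2 * ln t) =
   expR (upto_log_gen k t) * expR (- (pi ^+ 2 / 4 / t)) / (t * Num.sqrt t).
  by rewrite -ln3 -expRN !expRD.
have -> : expR (pi * (pi / (2 * t))) = (expR (- (pi ^+ 2 / 4 / t)) * expR (- (pi ^+ 2 / 4 / t)))^-1.
  rewrite -expRD -expRN; congr expR; move: (pi : R) => p; field; exact: lt0r_neq0.
rewrite (expRN (upto_log_gen k t)) /dev /dev_ratio.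
have := expR_gt0 (upto_log_gen k t); have := expR_gt0 (- (pi ^+ 2 / 4 / t)).
move: (expR (upto_log_gen k t)) (expR (- _)) => e1 e2 h2 h1.
move: (Num.sqrt t) st0 et t0 => z z0 <- _; move: (overp_ge 2 n)%:R (pi : R) p0 => a p p0.
by field; rewrite !gt_eqF.
Qed.

End Ratio.

Theorem theorem1p14 (R : realType) :
  (fun n : nat => (overp_ge 2 n)%:R /
     (pi / 32%:R * (n%:R `^ (- (3%:R / 2%:R))) * expR (pi * Num.sqrt n%:R)) : R)
    @ \oo --> (1 : R).
Proof.
have h0 (n : nat) : 0 < harmonic n :> R by rewrite invr_gt0 ltr0n.
have /choice[k hk] : forall n : nat, exists k : nat, (0 < n)%N ->
  [/\ (n <= k)%N, upto_tail k (saddle n / 2) <= harmonic n :> R &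
    3 * expR (- saddle n) ^+ k.+2 / (1 - expR (- saddle n)) ^+ 2 <= 1 :> R].
  move=> n; have [n0|n0] := posnP n; first by exists 0%N; rewrite n0.
  by have [k hk] := exists_upto_tail_le n (saddle_gt0 n0) (h0 n); exists k.
have k1 n (n0 : (0 < n)%N) : (n <= k n)%N by have [] := hk n n0.
have k2 n (n0 : (0 < n)%N) : upto_tail (k n) (saddle n / 2) <= harmonic n :> R.
  by have [] := hk n n0.
have k3 n (n0 : (0 < n)%N) :
  3 * expR (- saddle n) ^+ (k n).+2 / (1 - expR (- saddle n)) ^+ 2 <= 1 :> R.
  by have [] := hk n n0.
have I := cvg_saddle_integral k1 k2 k3.
have T := cvg_upto_tail k2.
have L := cvg_comp _ _ (@cvg_saddle R) cvg_log_gen2.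
have E : expR (log_gen2 (saddle n) - log_gen2_main (saddle n) - upto_tail (k n) (saddle n))
   @[n --> \oo] --> expR (- (ln (4 * pi) / 2) - ln 2 - 0 : R).
  apply: (@continuous_cvg _ _ _ _ _ _ (@expR R)); first exact: continuous_expR.
  by apply: cvgB; [exact: L|exact: T].
have p0 := @pi_gt0 R; have s0 : 0 < Num.sqrt pi :> R by rewrite sqrtr_gt0.
(* The exponential of the constant in the expansion of [log_gen2] is 1 / (4 sqrt pi), which cancels
   8 times the half Gaussian integral. *)
have lim : 8 * (Num.sqrt pi / 2) * expR (- (ln (4 * pi) / 2) - ln 2 - 0) = 1 :> R.
  have es : Num.sqrt pi ^+ 2 = pi :> R by rewrite sqr_sqrtr// ltW.
  have -> : - (ln (4 * pi) / 2) - ln 2 - 0 = - ln (4 * Num.sqrt pi) :> R.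
    have e4 : 4 = 2 ^+ 2 :> R by ring.
    by rewrite -{1}es e4 !lnM ?posrE ?exprn_gt0//; field.
  rewrite expRN lnK ?posrE ?mulr_gt0//.
  by move: (Num.sqrt _) s0 => z z0; field; rewrite gt_eqF.
have H : 8 * (expR (- upto_log_gen (k n) (saddle n)) *
    ((overp_ge 2 n)%:R * expR (- saddle n) ^+ n) * (pi / dev (saddle n))) *
    expR (log_gen2 (saddle n) - log_gen2_main (saddle n) - upto_tail (k n) (saddle n))
    @[n --> \oo] --> (8 * (Num.sqrt pi / 2) * expR (- (ln (4 * pi) / 2) - ln 2 - 0) : R).
  by apply: cvgM; [apply: cvgM; [exact: cvg_cst|exact: I]|exact: E].
rewrite lim in H; apply: (cvg_near_eq _ H).
by exists 1%N => // n /= n0; rewrite (overp_ratioE (k n) n0).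
Qed.
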